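(* Let $(X,\{g,J\})$ be a connected Kähler manifold with $\dim_{\mathbb{R}}X=2n\geq 4$. Then the holomorphic conformal group $\mathrm{Conf}(X,\{g,J\})$ acts properly on $X$, unless $X$ is holomorphically isometric to the complex space $\mathbb{C}^n$.
   Context: $J$ is the complex structure and $g$ the Kähler metric. $\mathrm{Conf}(X,\{g,J\})$ is the Lie group of biholomorphic diffeomorphisms $\alpha$ of $(X,J)$ such that $\alpha^*g=f\cdot g$ for some $f\in C^\infty(X,\mathbb{R}^{>0})$. $\mathbb{C}^n$ carries its standard flat Kähler metric. *)

(* Defs.v *)
From HB Require Import structures.
From mathcomp Require Import all_boot all_order all_algebra.
From mathcomp Require Import all_classical all_reals all_analysis.

Set Implicit Arguments.
Unset Strict Implicit.
Unset Printing Implicit Defensive.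

Import Order.TTheory GRing.Theory Num.Theory.
Import numFieldNormedType.Exports.

Local Open Scope classical_set_scope.
Local Open Scope ring_scope.

(* [Ck] and [smooth_on] are meant for open [U]; values of [f] off [U] are
   irrelevant. *)
Fixpoint Ck (R : realType) (V W : normedModType R) (k : nat) (U : set V)
    (f : V -> W) : Prop :=
  match k with
  | 0%N => forall p, U p -> {for p, continuous f}
  | k'.+1 => (forall p, U p -> differentiable f p) /\
             (forall v, Ck k' U ('D_v f))
  end.

Definition smooth_on (R : realType) (V W : normedModType R) (U : set V)
    (f : V -> W) : Prop :=
  forall k, Ck k U f.

(* [Cspace R n] is C^n regarded as R^(2n): the vector z = x + iy is
   [row_mx x y], with x, y in R^n, so that iz = -y + ix. *)
Notation Cspace R n := ('rV[R]_(n + n)).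

Definition Jstd (R : realType) (n : nat) (v : Cspace R n) : Cspace R n :=
  row_mx (- rsubmx v) (lsubmx v).

Definition holomorphic_on (R : realType) (n m : nat) (U : set (Cspace R n))
    (f : Cspace R n -> Cspace R m) : Prop :=
  smooth_on U f /\
  forall p, U p -> forall v, 'd f p (Jstd v) = Jstd ('d f p v).

(* The chart with index [i] is the homeomorphism [chart i] from the open set
   [dom i] to the open set [chart i @` dom i], with inverse [param i]; both
   functions are total, and arbitrary outside these sets.  The complex
   structure J of X is the one that reads [Jstd] in every chart. *)
Record complex_atlas (R : realType) (n : nat) (X : topologicalType) :=
  ComplexAtlas {
    idx : Type;
    dom : idx -> set X;
    chart : idx -> X -> Cspace R n;
    param : idx -> Cspace R n -> X;
    dom_open : forall i, open (dom i);
    dom_cover : forall x, exists i, dom i x;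
    img_open : forall i, open (chart i @` dom i);
    chartK : forall i x, dom i x -> param i (chart i x) = x;
    chart_continuous : forall i x, dom i x -> {for x, continuous (chart i)};
    param_continuous : forall i p, (chart i @` dom i) p ->
      {for p, continuous (param i)};
    transition_holomorphic : forall i j,
      holomorphic_on (chart i @` (dom i `&` dom j)) (chart j \o param i)
  }.

Definition inner (R : realType) (m : nat) (G : 'M[R]_m) (u v : 'rV[R]_m) : R :=
  (u *m G *m v^T) 0 0.

(* [gram i p] is the Gram matrix of the metric, in the real coordinates of the
   chart [i], at the point with coordinates [p].  The Kaehler form is
   omega(u, v) = g(Ju, v), and [kaehler_closed] is d omega = 0 evaluated on
   constant vector fields. *)
Record kaehler_metric (R : realType) (n : nat) (X : topologicalType)
    (A : complex_atlas R n X) :=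
  KaehlerMetric {
    gram : idx A -> Cspace R n -> 'M[R]_(n + n);
    gram_smooth : forall i, smooth_on (chart i @` dom i) (gram i);
    gram_sym : forall i x, dom i x -> forall u v,
      inner (gram i (chart i x)) u v = inner (gram i (chart i x)) v u;
    gram_pos : forall i x, dom i x -> forall u, u != 0 ->
      0 < inner (gram i (chart i x)) u u;
    gram_transition : forall i j x, dom i x -> dom j x -> forall u v,
      let T := 'd (chart j \o param i) (chart i x) in
      inner (gram j (chart j x)) (T u) (T v) =
      inner (gram i (chart i x)) u v;
    gram_hermitian : forall i x, dom i x -> forall u v,
      inner (gram i (chart i x)) (Jstd u) (Jstd v) =
      inner (gram i (chart i x)) u v;
    kaehler_closed : forall i x, dom i x -> forall u v w,
      let omega a b p := inner (gram i p) (Jstd a) b in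
      'D_u (omega v w) (chart i x) + 'D_v (omega w u) (chart i x)
      + 'D_w (omega u v) (chart i x) = 0
  }.

Definition local_map (R : realType) (n m : nat) (X Y : topologicalType)
    (A : complex_atlas R n X) (B : complex_atlas R m Y)
    (i : idx A) (j : idx B) (f : X -> Y) : Cspace R n -> Cspace R m :=
  chart j \o f \o param i.

Definition holomorphic_map (R : realType) (n m : nat) (X Y : topologicalType)
    (A : complex_atlas R n X) (B : complex_atlas R m Y) (f : X -> Y) : Prop :=
  continuous f /\
  forall i j, holomorphic_on (chart (c := A) i @` (dom i `&` f @^-1` dom j))
                (local_map (A := A) (B := B) i j f).

Definition biholomorphic (R : realType) (n m : nat) (X Y : topologicalType)
    (A : complex_atlas R n X) (B : complex_atlas R m Y) (f : X -> Y) : Prop :=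
  holomorphic_map A B f /\
  exists h : Y -> X,
    [/\ holomorphic_map B A h, cancel f h & cancel h f].

Definition smooth_function (R : realType) (n : nat) (X : topologicalType)
    (A : complex_atlas R n X) (c : X -> R) : Prop :=
  forall i, smooth_on (chart i @` dom i) (c \o param (c := A) i).

(* f^*h = c . g *)
Definition pullback_eq (R : realType) (n m : nat) (X Y : topologicalType)
    (A : complex_atlas R n X) (g : kaehler_metric A)
    (B : complex_atlas R m Y) (h : kaehler_metric B)
    (f : X -> Y) (c : X -> R) : Prop :=
  forall (i : idx A) (j : idx B) (x : X), dom i x -> dom j (f x) ->
  forall u v,
    let T := 'd (local_map i j f) (chart i x) in
    inner (gram h j (chart j (f x))) (T u) (T v) =
    c x * inner (gram g i (chart i x)) u v.

Definition Conf (R : realType) (n : nat) (X : topologicalType)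
    (A : complex_atlas R n X) (g : kaehler_metric A) : set (X -> X) :=
  [set a | biholomorphic A A a /\
           exists c : X -> R,
             [/\ smooth_function A c, forall x, 0 < c x
               & pullback_eq g g a c]].

Definition holomorphically_isometric (R : realType) (n m : nat)
    (X Y : topologicalType)
    (A : complex_atlas R n X) (g : kaehler_metric A)
    (B : complex_atlas R m Y) (h : kaehler_metric B) : Prop :=
  exists f : X -> Y, biholomorphic A B f /\ pullback_eq g h f (fun=> 1).

(* [G] carries the compact-open topology, which on the holomorphic conformal
   group is the Lie group topology, and the action is proper when
   (a, x) |-> (a x, x) is a proper map from G x X to X x X. *)
Definition acts_properly (X : topologicalType) (G : set (X -> X)) : Prop :=
  let GX : set ({compact-open, X -> X} * X)%type := [set q | G q.1] in
  let act : {compact-open, X -> X} * X -> X * X := fun q => (q.1 q.2, q.2) in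
  {within GX, continuous act} /\
  forall K : set (X * X), compact K -> compact (GX `&` act @^-1` K).

Section StandardCn.
Variables (R : realType) (n : nat).

Lemma Ck_cst (V W : normedModType R) (U : set V) k (c : W) :
  Ck k U (fun=> c).
Proof.
elim: k c => [|k IH] c /=; first by move=> p _; exact: cst_continuous.
split=> [p _|v]; first exact: differentiable_cst.
by have -> : 'D_v (fun=> c) = (fun=> 0) :> (V -> W)
  by apply/funext => p; exact: derive_cst.
Qed.

Lemma smooth_on_id (V : normedModType R) (U : set V) : smooth_on U (@id V).
Proof.
case=> [|k] /=; first by move=> p _; exact: cvg_id.
split=> [p _|v]; first exact: ex_diff.
have -> : 'D_v (@id V) = (fun=> v) by apply/funext => p; exact: derive_id.
exact: Ck_cst.
Qed.

Lemma holomorphic_on_id (U : set (Cspace R n)) :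
  holomorphic_on U (@id (Cspace R n)).
Proof.
split; first exact: smooth_on_id.
by move=> p _ v; rewrite diff_val.
Qed.

Definition Cn_atlas : complex_atlas R n (Cspace R n).
Proof.
refine (@ComplexAtlas R n (Cspace R n) unit (fun=> setT) (fun=> id) (fun=> id)
  _ _ _ _ _ _ _).
- by move=> _; exact: openT.
- by move=> x; exists tt.
- by move=> _; rewrite image_id; exact: openT.
- by [].
- by move=> _ x _; exact: cvg_id.
- by move=> _ x _; exact: cvg_id.
- by move=> _ _; exact: holomorphic_on_id.
Defined.

Lemma inner1 m (u v : 'rV[R]_m) : inner 1%:M u v = \sum_k u 0 k * v 0 k.
Proof.
by rewrite /inner mulmx1 mxE; apply: eq_bigr => k _; rewrite mxE.
Qed.

Definition Cn_flat : kaehler_metric Cn_atlas.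
Proof.
refine (@KaehlerMetric R n _ Cn_atlas (fun _ _ => 1%:M) _ _ _ _ _ _).
- by move=> i k; exact: Ck_cst.
- move=> i x _ u v; rewrite !inner1.
  by apply: eq_bigr => k _; rewrite mulrC.
- move=> i x _ u u0; rewrite inner1 lt_neqAle sumr_ge0 ?andbT; last first.
    by move=> k _; rewrite -expr2 sqr_ge0.
  apply: contra u0 => /eqP/esym/eqP; rewrite psumr_eq0 => [/allP u0|k _];
    last by rewrite -expr2 sqr_ge0.
  apply/eqP/rowP => k; rewrite mxE; apply/eqP.
  by have := u0 k (mem_index_enum _); rewrite /= mulf_eq0 orbb.
- by move=> i j x _ _ u v /=; rewrite diff_val.
- move=> i x _ u v; rewrite !inner1 !big_split_ord /= addrC.
  congr (_ + _); apply: eq_bigr => k _.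
    by rewrite !row_mxEr !mxE.
  by rewrite !row_mxEl !mxE mulrNN.
- by move=> i x _ u v w /=; rewrite !derive_cst !addr0.
Defined.

End StandardCn.

(* Main.v *)
(* A holomorphic conformal map a satisfies a^* omega = c omega; as omega is
   closed and nondegenerate and n >= 2, dc = 0, so a is a homothety of some
   ratio l, and it scales the Riemannian distance by l.

   Take an ultrafilter of pairs (a, x), a in Conf, along which x -> x0 and
   a x -> y0.  If the ratios stay in a compact subset of ]0, +oo[, then, X being
   connected and locally compact, a z converges for every z, and likewise for
   the inverses; the limit is holomorphic because locally bounded families of
   holomorphic maps have locally bounded derivatives, and it is a homothety.
   This is properness.

   If the ratios tend to 0, blow up: the maps l^-1 (chart (a z) - chart (a x))
   are equi-Lipschitz and defined on larger and larger balls, and they are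
   holomorphic and almost isometric from g to the constant metric of the
   tangent space at y0.  Both they and their inverses converge, and the limit is
   a holomorphic isometry from X onto C^n.  If the ratios tend to infinity, this
   applies to the inverses. *)

From HB Require Import structures.
Require Import Defs.
From mathcomp Require Import all_boot all_order all_algebra.
From mathcomp Require Import all_classical all_reals all_analysis.
From mathcomp Require Import ring lra.

Set Implicit Arguments.
Unset Strict Implicit.
Unset Printing Implicit Defensive.

Import Order.TTheory GRing.Theory Num.Theory.
Import numFieldNormedType.Exports.

Local Open Scope classical_set_scope.
Local Open Scope ring_scope.

(** * Second derivatives and the maximum principle *)

(** The derivative bounds come from harmonic functions: the maximum principle on a rectangle gives
    an interior gradient estimate that stands in for Cauchy's, and since derivatives of
    pluriharmonic maps are pluriharmonic it can be iterated. Along an ultrafilter, values in a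
    compact set converge by themselves, so limits are taken pointwise without extracting
    subsequences, and equi-Lipschitz bounds then make the convergence locally uniform. The distance
    is defined by duality with test functions instead of lengths of curves; a homothety scales it
    because it scales the test functions. The obstacle is that X is not assumed complete, so bounded
    sets need not be relatively compact. For ratios in a compact range, connectedness spreads
    compactness from one point; for ratios tending to 0, a large ball is sent into a compact
    neighbourhood of y and brought back by the inverse of one member. The inverses are followed
    throughout, since a limit of bijections need not be one. *)

Lemma MVT_cc (R : realType) (f df : R -> R) (a b : R) : a < b ->
  (forall x, x \in `[a, b] -> is_derive x 1 f (df x)) ->
  exists2 c, c \in `[a, b] & f b - f a = df c * (b - a).
Proof.
move=> ab fdf.
have fdf' x : x \in `]a, b[ -> is_derive x 1 f (df x).
  rewrite in_itv/= => /andP[ax xb].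
  by apply: fdf; rewrite in_itv/= !ltW.
apply: (@MVT_segment R f df a b (ltW ab) fdf').
apply: derivable_within_continuous => x xab.
by have [] := fdf x xab.
Qed.

Section Lines.
Variables (R : realType) (V W : normedModType R).

Lemma is_derive_line (f : V -> W) (p v : V) (s : R) :
  derivable f (p + s *: v) v ->
  is_derive s 1 (fun t : R => f (p + t *: v)) ('D_v f (p + s *: v)).
Proof.
have E : (fun h : R => h^-1 *: (((fun t => f (p + t *: v)) \o shift s) (h *: 1)
            - f (p + s *: v))) =
  (fun h : R => h^-1 *: ((f \o shift (p + s *: v)) (h *: v) - f (p + s *: v))).
  apply/funext => h /=; rewrite (_ : h *: 1 = h); last exact: mulr1.
  by rewrite scalerDl addrCA.
by move=> df; split; rewrite /derivable /derive E.
Qed.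

End Lines.

Section Schwarz.
Variables (R : realType) (V : normedModType R).

(** The mean value theorem is used along u for the difference of f in direction v, then along v for
    ['D_u f]. The left-hand side is symmetric in u and v, which is what [schwarz] exploits. *)
Lemma second_difference (f : V -> R) (p u v : V) (r s : R) :
  (forall q, ball p r q -> derivable f q u) ->
  (forall q, ball p r q -> derivable ('D_u f) q v) ->
  0 < s -> s * (`|u| + `|v|) < r ->
  exists2 q, `|p - q| <= s * (`|u| + `|v|) &
    f (p + s *: u + s *: v) - f (p + s *: u) - f (p + s *: v) + f p =
    s ^+ 2 * 'D_v ('D_u f) q.
Proof.
move=> fu fuv s0 sr.
have B x y : 0 <= x <= s -> 0 <= y <= s ->
    `|p - (p + x *: u + y *: v)| <= s * (`|u| + `|v|).
  move=> /andP[x0 xs] /andP[y0 ys].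
  rewrite -addrA opprD addrA subrr sub0r normrN mulrDr.
  apply: le_trans (ler_normD _ _) _; rewrite !normrZ !ger0_norm//.
  by apply: lerD; apply: ler_wpM2r.
have B' x y : 0 <= x <= s -> 0 <= y <= s -> ball p r (p + x *: u + y *: v).
  move=> hx hy; rewrite -ball_normE /ball_ /=.
  by apply: le_lt_trans sr; exact: B.
have s00 : 0 <= s <= s by rewrite lexx ltW.
have z00 : 0 <= (0:R) <= s by rewrite lexx ltW.
pose F x := f (p + s *: v + x *: u) - f (p + x *: u).
pose dF x := 'D_u f (p + s *: v + x *: u) - 'D_u f (p + x *: u).
have [|x xs] := @MVT_cc R F dF 0 s s0.
  move=> x; rewrite in_itv/= => xs.
  apply: is_deriveB; apply: is_derive_line; apply: fu.
    by rewrite addrAC; exact: B'.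
  by have := B' _ _ xs z00; rewrite scale0r addr0.
rewrite in_itv/= in xs.
have [|y ys] := @MVT_cc R (fun y => 'D_u f (p + x *: u + y *: v))
    (fun y => 'D_v ('D_u f) (p + x *: u + y *: v)) 0 s s0.
  move=> y; rewrite in_itv/= => ys.
  by apply: is_derive_line; apply: fuv; exact: B'.
rewrite in_itv/= in ys.
rewrite /F /dF !scale0r !addr0 !subr0 => E2 E1.
exists (p + x *: u + y *: v); first exact: B.
move: E1; rewrite /= [p + s *: v + x *: u]addrAC E2 [p + s *: v + s *: u]addrAC.
by move=> E1; rewrite expr2 [RHS]mulrC mulrA -E1 opprB [f p - _]addrC addrA.
Qed.

(** The same second difference, read in both orders, equates the two mixed derivatives at two points
    q1 and q2 close to p; continuity at p compares them with their values at p. *)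
Lemma schwarz (f : V -> R) (p u v : V) (r : R) : 0 < r ->
  (forall q, ball p r q -> [/\ derivable f q u, derivable f q v,
     derivable ('D_u f) q v & derivable ('D_v f) q u]) ->
  {for p, continuous ('D_v ('D_u f))} -> {for p, continuous ('D_u ('D_v f))} ->
  'D_v ('D_u f) p = 'D_u ('D_v f) p.
Proof.
move=> r0 df c1 c2; apply/eqP; rewrite -subr_eq0 -normr_le0.
apply/ler_addgt0Pl => e e0; rewrite addr0.
have e20 : 0 < e / 2 by rewrite divr_gt0.
have [d1 d10 H1] : exists2 d, 0 < d &
    forall q, `|p - q| < d -> `|'D_v ('D_u f) p - 'D_v ('D_u f) q| < e / 2.
  by have /cvgrPdist_lt/(_ _ e20)/nbhs_normP[d /= d0 H] := c1; exists d.
have [d2 d20 H2] : exists2 d, 0 < d &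
    forall q, `|p - q| < d -> `|'D_u ('D_v f) p - 'D_u ('D_v f) q| < e / 2.
  by have /cvgrPdist_lt/(_ _ e20)/nbhs_normP[d /= d0 H] := c2; exists d.
pose m := Num.min r (Num.min d1 d2).
have m0 : 0 < m by rewrite !lt_min r0 d10 d20.
have mr : m <= r by rewrite /m ge_min lexx.
have N0 : 0 < `|u| + `|v| + 1 by rewrite ltr_wpDl ?addr_ge0.
(* The 1 keeps the denominator positive when u = v = 0 and makes the next inequality strict. *)
pose s := m / (`|u| + `|v| + 1).
have s0 : 0 < s by rewrite divr_gt0.
have sm : s * (`|u| + `|v|) < m.
  by rewrite /s mulrAC ltr_pdivrMr// ltr_pM2l// ltrDl.
have sm' : s * (`|v| + `|u|) < m by rewrite [`|v| + _]addrC.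
have [||q1 q1p E1] := @second_difference f p u v r s _ _ s0 (lt_le_trans sm mr).
- by move=> q /df[].
- by move=> q /df[].
have [||q2 q2p E2] := @second_difference f p v u r s _ _ s0 (lt_le_trans sm' mr).
- by move=> q /df[].
- by move=> q /df[].
have E : 'D_v ('D_u f) q1 = 'D_u ('D_v f) q2.
  apply: (@mulfI _ (s ^+ 2)); first by rewrite expf_neq0// gt_eqF.
  apply: (etrans (esym E1)); apply: etrans E2.
  by rewrite [p + s *: v + s *: u]addrAC [in RHS](addrAC (f _)).
have h1 := H1 q1 (le_lt_trans q1p (lt_le_trans sm _)).
have h2 := H2 q2 (le_lt_trans q2p (lt_le_trans sm' _)).
rewrite -(subrKA ('D_v ('D_u f) q1)) (splitr e).
apply: le_trans (ler_normD _ _) _; apply: lerD; apply: ltW.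
  by apply: h1; rewrite /m !ge_min lexx orbT.
by rewrite E distrC; apply: h2; rewrite /m !ge_min lexx !orbT.
Qed.

End Schwarz.
Section MaximumPrinciple.
Variable R : realType.

(** At the maximum h1 vanishes; a positive h2 would make h1 positive just to the right of s, and the
    mean value theorem would give a value of h above h s. *)
Lemma second_derivative_test (h h1 : R -> R) (a b s h2 : R) :
  s \in `]a, b[ ->
  (forall t, t \in `]a, b[ -> is_derive t 1 h (h1 t)) ->
  is_derive s 1 h1 h2 -> (forall t, t \in `]a, b[ -> h t <= h s) -> h2 <= 0.
Proof.
move=> sab dh dh1 hmax; have := sab; rewrite in_itv/= => /andP[as_ sb].
have h1s : h1 s = 0.
  have := dh s sab; have : is_derive s 1 h 0.
    apply: (@derive1_at_max R h a b s) => //.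
      exact: ltW (lt_trans as_ sb).
    by move=> t /dh[].
  by move=> [_ E1] [_ E2]; rewrite -E1 -E2.
rewrite leNgt; apply/negP => h20.
have [/cvg_ex/= [l Hl] Eh2] := dh1.
have {Eh2} : l = h2 by rewrite -Eh2; apply/esym/cvg_lim.
move=> El; rewrite El in Hl.
move/cvgrPdist_lt/(_ _ h20): Hl => /nbhs_normP[d /= d0 Hd].
pose k := Num.min (d / 2) ((b - s) / 2).
have k0 : 0 < k by rewrite lt_min !divr_gt0 ?subr_gt0.
have kd : k < d.
  by apply: (@le_lt_trans _ _ (d / 2)); [rewrite ge_min lexx | lra].
have kb : s + k < b.
  have : k <= (b - s) / 2 by rewrite /k ge_min lexx orbT.
  by move=> ?; lra.
have ssk : s < s + k by rewrite ltrDl.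
have dh' t : t \in `]s, (s + k)[ -> is_derive t 1 h (h1 t).
  rewrite in_itv/= => /andP[st tk]; apply: dh.
  by rewrite in_itv/= (lt_trans as_ st) (lt_trans tk kb).
have [|c] := @MVT R h h1 s (s + k) ssk dh'.
  apply: derivable_within_continuous => t; rewrite in_itv/= => /andP[st tk].
  have : t \in `]a, b[ by rewrite in_itv/= (lt_le_trans as_ st) (le_lt_trans tk kb).
  by move=> /dh[].
rewrite in_itv/= => /andP[sc ck] E.
have h1c : 0 < h1 c.
  have cs0 : 0 < c - s by rewrite subr_gt0.
  have := Hd (c - s); rewrite /= sub0r normrN gtr0_norm//.
  have csd : c - s < d by lra.
  move=> /(_ csd); rewrite gt_eqF// => /(_ isT).
  have -> : (c - s) *: (1 : R) = c - s by exact: mulr1.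
  rewrite /= subrK h1s subr0 ltr_norml => /andP[_ H].
  have {}H : h2 - (c - s)^-1 * h1 c < h2 by exact: H.
  have : 0 < (c - s)^-1 * h1 c by lra.
  by rewrite pmulr_rgt0// invr_gt0.
have skab : s + k \in `]a, b[ by rewrite in_itv/= kb andbT; lra.
have := hmax _ skab.
rewrite leNgt => /negP; apply.
by rewrite -subr_gt0 E [s + k]addrC addrK mulr_gt0.
Qed.

(** The partial derivatives are separate arguments because in [gradient_estimate] they are known in
    closed form, as directional derivatives of a function on V. *)
Lemma maximum_principle_rect (rho : R) (w ws wt wss wtt : R -> R -> R) :
  0 < rho ->
  (forall s t, s \in `[0, rho] -> t \in `[- rho, rho] ->
    {for (s, t), continuous (fun z : R * R => w z.1 z.2)}) ->
  (forall s t, s \in `]0, rho[ -> t \in `]- rho, rho[ ->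
    [/\ is_derive s 1 (w^~ t) (ws s t), is_derive s 1 (ws^~ t) (wss s t),
        is_derive t 1 (w s) (wt s t), is_derive t 1 (wt s) (wtt s t) &
        wss s t + wtt s t = 0]) ->
  (forall t, t \in `[- rho, rho] -> w 0 t <= 0) ->
  (forall t, t \in `[- rho, rho] -> w rho t <= 0) ->
  (forall s, s \in `[0, rho] -> w s (- rho) <= 0) ->
  (forall s, s \in `[0, rho] -> w s rho <= 0) ->
  forall s t, s \in `[0, rho] -> t \in `[- rho, rho] -> w s t <= 0.
Proof.
move=> rho0 cw dw b1 b2 b3 b4 s1 t1 s1I t1I; rewrite leNgt; apply/negP => w0.
(* w + e Q has positive Laplacian 4e, so it has no interior maximum; e is so
   small that it is still positive at (s1, t1), while Q <= 0 on the rectangle. *)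
pose e := w s1 t1 / (4 * rho ^+ 2).
have rho2 : 0 < rho ^+ 2 by rewrite exprn_gt0.
have e0 : 0 < e by rewrite divr_gt0// mulr_gt0.
pose Q s t : R := s ^+ 2 + t ^+ 2 - 2 * rho ^+ 2.
pose W s t := w s t + e * Q s t.
have sq x : - rho <= x <= rho -> x ^+ 2 <= rho ^+ 2 by move=> /andP[? ?]; nra.
have Q0 s t : s \in `[0, rho] -> t \in `[- rho, rho] -> Q s t <= 0.
  rewrite !in_itv/= => /andP[s0 sr] /sq tr.
  have : s ^+ 2 <= rho ^+ 2 by nra.
  by rewrite /Q; lra.
have [|||[s t]] := @compact_EVT_max _ R (fun z : R * R => W z.1 z.2)
    (`[0, rho]%classic `*` `[- rho, rho]%classic).
- by exists (s1, t1).
- by apply: compact_setX; exact: segment_compact.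
- apply: continuous_in_subspaceT => -[s t]; rewrite inE => -[/= sI tI].
  rewrite /prop_for /continuous_at /W; apply: cvgD; first exact: cw.
  apply: cvgM; first exact: cvg_cst.
  apply: cvgB; last exact: cvg_cst.
  by apply: cvgD; rewrite !expr2; apply: cvgM; (exact: cvg_fst || exact: cvg_snd).
rewrite inE => -[/= sI tI] Wmax.
have Wpos : 0 < W s t.
  apply: lt_le_trans (Wmax (s1, t1) _); last by rewrite inE.
  rewrite /W /=.
  have : 2 * (e * rho ^+ 2) = w s1 t1 / 2 by rewrite /e; field; lra.
  have : 0 <= e * (s1 ^+ 2 + t1 ^+ 2) by rewrite mulr_ge0 ?addr_ge0 ?sqr_ge0 ?ltW.
  by rewrite /Q; lra.
have wpos : 0 < w s t.
  have := Q0 _ _ sI tI; move: Wpos; rewrite /W.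
  have := e0; nra.
have sI' : s \in `]0, rho[.
  move: (sI); rewrite !in_itv/= !le_eqVlt => /andP[/predU1P[E|->] /predU1P[E'|->]] //.
  - by move: wpos; rewrite -E ltNge b1.
  - by move: wpos; rewrite -E ltNge b1.
  - by move: wpos; rewrite E' ltNge b2.
have tI' : t \in `]-rho, rho[.
  move: (tI); rewrite !in_itv/= !le_eqVlt => /andP[/predU1P[E|->] /predU1P[E'|->]] //.
  - by move: wpos; rewrite -E ltNge b3.
  - by move: wpos; rewrite -E ltNge b3.
  - by move: wpos; rewrite E' ltNge b4.
have [_ dwss _ dwtt E] := dw s t sI' tI'.
(* The second derivative test in each variable separately; the two inequalities add up to 4 e <=
   0. *)
have i1 : wss s t + 2 * e <= 0.
  apply: (@second_derivative_test (W^~ t) (fun s => ws s t + e * (2 * s)) 0 rho s) => //.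
  - move=> x xI; have [d1 _ _ _ _] := dw x t xI tI'.
    rewrite /W; apply: is_deriveD.
    by rewrite /Q; apply: is_derive_eq; rewrite /GRing.scale/=; ring.
  - by apply: is_deriveD; apply: is_derive_eq; rewrite /GRing.scale/=; ring.
  - move=> x xI; apply: (Wmax (x, t)); rewrite inE; split => //=.
    by move: xI; rewrite in_itv/= => /andP[x0 xr]; rewrite in_itv/= !ltW.
have i2 : wtt s t + 2 * e <= 0.
  apply: (@second_derivative_test (W s) (fun t => wt s t + e * (2 * t)) (- rho) rho t) => //.
  - move=> x xI; have [_ _ d1 _ _] := dw s x sI' xI.
    rewrite /W; apply: is_deriveD.
    by rewrite /Q; apply: is_derive_eq; rewrite /GRing.scale/=; ring.
  - by apply: is_deriveD; apply: is_derive_eq; rewrite /GRing.scale/=; ring.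
  - move=> x xI; apply: (Wmax (s, x)); rewrite inE; split => //=.
    by move: xI; rewrite in_itv/= => /andP[x0 xr]; rewrite in_itv/= !ltW.
by lra.
Qed.
End MaximumPrinciple.
Section GradientEstimate.
Variables (R : realType) (V : normedModType R).

(** A comparison on the right of 0 suffices because the derivative is known to exist; the barrier of
    [gradient_estimate] controls the odd part for s >= 0 only. *)
Lemma derive_le_bound (g : R -> R) (d K delta : R) : 0 < delta ->
  is_derive (0 : R) (1 : R) g d -> (forall s, 0 < s < delta -> g s - g 0 <= K * s) -> d <= K.
Proof.
move=> delta0 [/cvg_ex/= [l Hl] Ed] gK.
have {Ed} El : l = d by rewrite -Ed; apply/esym/cvg_lim.
apply/ler_addgt0Pl => e e0; rewrite El in Hl.
move/cvgrPdist_lt/(_ _ e0): Hl => /nbhs_normP[r /= r0 Hr].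
pose k := Num.min (r / 2) (delta / 2).
have k0 : 0 < k by rewrite lt_min !divr_gt0.
have kr : k <= r / 2 by rewrite /k ge_min lexx.
have kd : k <= delta / 2 by rewrite /k ge_min lexx orbT.
have := Hr k; rewrite /= sub0r normrN gtr0_norm//.
have kr' : k < r by lra.
move=> /(_ kr'); rewrite gt_eqF// => /(_ isT).
have -> : k *: (1 : R) = k by exact: mulr1.
rewrite /= addr0 ltr_norml => /andP[_ H].
have {}H : d - k^-1 * (g k - g 0) < e by exact: H.
have kd' : 0 < k < delta by rewrite k0/=; lra.
have := gK k kd'; rewrite -ler_pdivrMr// mulrC.
by lra.
Qed.

Lemma is_derive_line_diff (f : V -> R) (p v : V) (s : R) :
  differentiable f (p + s *: v) ->
  is_derive s 1 (fun t : R => f (p + t *: v)) ('D_v f (p + s *: v)).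
Proof. by move=> df; apply: is_derive_line; exact: diff_derivable. Qed.

Lemma is_derive_mulD (f g : R -> R) (k s a b : R) :
  is_derive s 1 f a -> is_derive s 1 g b ->
  is_derive s 1 (fun t => k * (f t + g t)) (k * (a + b)).
Proof. by move=> df dg; exact: is_deriveZ (is_deriveD df dg). Qed.

Lemma is_derive_mulB (f g : R -> R) (k s a b : R) :
  is_derive s 1 f a -> is_derive s 1 g b ->
  is_derive s 1 (fun t => k * (f t - g t)) (k * (a - b)).
Proof. by move=> df dg; exact: is_deriveZ (is_deriveB df dg). Qed.

(* The odd part u(p + sv + tv') - u(p - sv + tv') vanishes for s = 0 and is at
   most 2M; on the rectangle [0, rho] x [-rho, rho] it is compared with the
   harmonic barrier (2M / rho^2) (t^2 - s^2 + 2 rho s). *)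
Lemma gradient_estimate (u : V -> R) (p v v' : V) (r rho M : R) :
  0 < rho -> rho * (`|v| + `|v'|) < r ->
  (forall q, ball p r q -> [/\ differentiable u q, differentiable ('D_v u) q,
     differentiable ('D_v' u) q, 'D_v ('D_v u) q + 'D_v' ('D_v' u) q = 0 &
     `|u q| <= M]) ->
  `|'D_v u p| <= 2 * M / rho.
Proof.
move=> rho0 rhor Hu.
have M0 : 0 <= M.
  have /Hu[_ _ _ _] : ball p r p.
    apply: ballxx; apply: le_lt_trans rhor.
    by rewrite mulr_ge0 ?(ltW rho0) ?addr_ge0.
  by move=> /(le_trans (normr_ge0 _)).
have B s t : `|s| <= rho -> `|t| <= rho -> ball p r (p + s *: v + t *: v').
  move=> sr tr; rewrite -ball_normE /ball_ /= -addrA opprD addrA subrr sub0r normrN.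
  apply: le_lt_trans (ler_normD _ _) _; rewrite !normrZ.
  by apply: le_lt_trans rhor; rewrite mulrDr; apply: lerD; apply: ler_wpM2r.
(* The two signs together bound the absolute value. *)
suff H sg : sg ^+ 2 = 1 -> sg * 'D_v u p <= 2 * M / rho.
  rewrite ler_norml; apply/andP; split.
    by have := H (-1); rewrite sqrrN expr1n => /(_ erefl); lra.
  by have := H 1; rewrite expr1n mul1r => /(_ erefl).
move=> sg1.
have sgn : `|sg| = 1 by apply/eqP; rewrite -sqrp_eq1// real_normK ?num_real// sg1.
pose K := 2 * M / rho ^+ 2.
have K0 : 0 <= K by rewrite /K divr_ge0 ?mulr_ge0 ?exprn_ge0 ?(ltW rho0).
(* P is harmonic, nonnegative on the side s = 0 and at least rho ^+ 2 on the three others, so K * P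
   dominates the odd part on the boundary. Its s-derivative at the origin is 2 * rho, while the odd
   part has derivative 2 * 'D_v u p up to sign: this yields K * rho = 2 * M / rho. *)
pose P (s t : R) : R := t ^+ 2 - s ^+ 2 + 2 * rho * s.
pose w s t := sg * (u (p + s *: v + t *: v') - u (p + s *: - v + t *: v')) - K * P s t.
pose ws s t := sg * ('D_v u (p + s *: v + t *: v') + 'D_v u (p + s *: - v + t *: v'))
  - K * (2 * rho - 2 * s).
pose wt s t := sg * ('D_v' u (p + s *: v + t *: v') - 'D_v' u (p + s *: - v + t *: v'))
  - K * (2 * t).
pose wss s t := sg * ('D_v ('D_v u) (p + s *: v + t *: v')
  - 'D_v ('D_v u) (p + s *: - v + t *: v')) - K * (- 2).
pose wtt s t := sg * ('D_v' ('D_v' u) (p + s *: v + t *: v')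
  - 'D_v' ('D_v' u) (p + s *: - v + t *: v')) - K * 2.
have BN s t : `|s| <= rho -> `|t| <= rho -> ball p r (p + s *: - v + t *: v').
  by move=> sr tr; rewrite scalerN -scaleNr; apply: B => //; rewrite normrN.
have bound s t : `|s| <= rho -> `|t| <= rho ->
    sg * (u (p + s *: v + t *: v') - u (p + s *: - v + t *: v')) <= 2 * M.
  move=> sr tr; apply: le_trans (ler_norm _) _; rewrite normrM sgn mul1r.
  have [_ _ _ _ b1] := Hu _ (B _ _ sr tr).
  have [_ _ _ _ b2] := Hu _ (BN _ _ sr tr).
  by apply: le_trans (ler_normB _ _) _; lra.
have I0 x : x \in `[0, rho] -> `|x| <= rho.
  by rewrite in_itv/= => /andP[x0 xr]; rewrite ger0_norm.
have I1 x : x \in `[- rho, rho] -> `|x| <= rho by rewrite in_itv/= ler_norml.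
have KM : K * rho ^+ 2 = 2 * M by rewrite /K; field; rewrite gt_eqF.
have wc s t : s \in `[0, rho] -> t \in `[- rho, rho] ->
    {for (s, t), continuous (fun z : R * R => w z.1 z.2)}.
  move=> /I0 sr /I1 tr.
  have [c1 _ _ _ _] := Hu _ (B _ _ sr tr).
  have [c2 _ _ _ _] := Hu _ (BN _ _ sr tr).
  have L (x : V) : (p + z.1 *: x + z.2 *: v') @[z --> (s, t)] --> p + s *: x + t *: v'.
    apply: cvgD; last by apply: cvgZr_tmp; exact: cvg_snd.
    by apply: cvgD; [exact: cvg_cst|apply: cvgZr_tmp; exact: cvg_fst].
  rewrite /prop_for /continuous_at /w; apply: cvgB.
    apply: cvgM; first exact: cvg_cst.
    apply: cvgB.
      by apply: (cvg_comp _ _ (L v)); exact: differentiable_continuous.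
    by apply: (cvg_comp _ _ (L (- v))); exact: differentiable_continuous.
  apply: cvgM; first exact: cvg_cst.
  apply: cvgD.
    by apply: cvgB; rewrite !expr2; apply: cvgM; (exact: cvg_fst || exact: cvg_snd).
  by apply: cvgM; [exact: cvg_cst|exact: cvg_fst].
have wd s t : s \in `]0, rho[ -> t \in `]- rho, rho[ ->
    [/\ is_derive s 1 (w^~ t) (ws s t), is_derive s 1 (ws^~ t) (wss s t),
        is_derive t 1 (w s) (wt s t), is_derive t 1 (wt s) (wtt s t) &
        wss s t + wtt s t = 0].
  move=> sI tI.
  have sr : `|s| <= rho.
    by apply: I0; move: sI; rewrite !in_itv/= => /andP[? ?]; rewrite !ltW.
  have tr : `|t| <= rho.
    by apply: I1; move: tI; rewrite !in_itv/= => /andP[? ?]; rewrite !ltW.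
  have [d1 d2 d3 E1 _] := Hu _ (B _ _ sr tr).
  have [e1 e2 e3 E2 _] := Hu _ (BN _ _ sr tr).
  have X (f : V -> R) x : differentiable f (p + s *: x + t *: v') ->
      is_derive s 1 (fun s => f (p + s *: x + t *: v')) ('D_x f (p + s *: x + t *: v')).
    rewrite addrAC => /is_derive_line_diff; apply: near_eq_is_derive.
    by near=> y; rewrite addrAC.
  have XN (f : V -> R) : differentiable f (p + s *: - v + t *: v') ->
      is_derive s 1 (fun s => f (p + s *: - v + t *: v'))
        (- 'D_v f (p + s *: - v + t *: v')).
    by move=> df; have := X _ _ df; rewrite [in X in X -> _]deriveE// linearN -deriveE.
  split.
  - rewrite /w; apply: is_deriveB.
      have H := is_derive_mulB sg (X _ _ d1) (XN _ e1).
      by rewrite opprK in H; exact: H.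
    by rewrite /P; apply: is_derive_eq; rewrite /GRing.scale/=; ring.
  - rewrite /ws; apply: is_deriveB.
      exact: is_derive_mulD (X _ _ d2) (XN _ e2).
    by apply: is_derive_eq; rewrite /GRing.scale/=; ring.
  - rewrite /w; apply: is_deriveB.
      exact: is_derive_mulB (is_derive_line_diff d1) (is_derive_line_diff e1).
    by rewrite /P; apply: is_derive_eq; rewrite /GRing.scale/=; ring.
  - rewrite /wt; apply: is_deriveB.
      exact: is_derive_mulB (is_derive_line_diff d3) (is_derive_line_diff e3).
    by apply: is_derive_eq; rewrite /GRing.scale/=; ring.
  - rewrite /wss /wtt; move: E1 E2.
    have ring_id (k c a b a' b' : R) : a + b = 0 -> a' + b' = 0 ->
        k * (a - a') - c * (- 2) + (k * (b - b') - c * 2) = 0.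
      by move=> /eqP; rewrite addr_eq0 => /eqP-> /eqP; rewrite addr_eq0 => /eqP->; ring.
    exact: ring_id.
have wle s t : s \in `[0, rho] -> t \in `[- rho, rho] -> w s t <= 0.
  move: s t; apply: (@maximum_principle_rect R rho w ws wt wss wtt rho0 wc wd).
  - move=> t _; rewrite /w !scale0r subrr mulr0 sub0r oppr_le0 mulr_ge0// /P.
    by have := sqr_ge0 t; lra.
  - move=> t /I1 tr; have rr : `|rho| <= rho by rewrite gtr0_norm.
    have := bound _ _ rr tr; rewrite /w -KM.
    have : K * rho ^+ 2 <= K * P rho t.
      by apply: ler_wpM2l => //; rewrite /P; have := sqr_ge0 t; lra.
    by lra.
  - move=> s sI; have rr : `|- rho| <= rho by rewrite normrN gtr0_norm.
    have := bound _ _ (I0 _ sI) rr; rewrite /w -KM.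
    have : K * rho ^+ 2 <= K * P s (- rho).
      apply: ler_wpM2l => //; rewrite /P.
      by move: sI; rewrite in_itv/= => /andP[? ?]; nra.
    by lra.
  - move=> s sI; have rr : `|rho| <= rho by rewrite gtr0_norm.
    have := bound _ _ (I0 _ sI) rr; rewrite /w -KM.
    have : K * rho ^+ 2 <= K * P s rho.
      apply: ler_wpM2l => //; rewrite /P.
      by move: sI; rewrite in_itv/= => /andP[? ?]; nra.
    by lra.
have p0 : ball p r p by have := B 0 0; rewrite !scale0r !addr0 normr0 ltW//; apply.
have [d1 _ _ _ _] := Hu p p0.
have dg : is_derive (0 : R) (1 : R)
    (fun s => sg * (u (p + s *: v) - u (p + s *: - v))) (2 * (sg * 'D_v u p)).
  have d1' : differentiable u (p + 0 *: v) by rewrite scale0r addr0.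
  have d2' : differentiable u (p + 0 *: - v) by rewrite scale0r addr0.
  have := is_derive_line_diff d1'; have := is_derive_line_diff d2'.
  rewrite !scale0r !addr0 [in X in X -> _]deriveE// linearN -deriveE//.
  by move=> ? ?; apply: is_derive_eq; rewrite /GRing.scale/=; ring.
have := @derive_le_bound _ _ (2 * K * rho) _ rho0 dg.
have -> : 2 * K * rho = 2 * (2 * M / rho).
  by rewrite /K; field; rewrite gt_eqF.
rewrite ler_pM2l//; apply => s /andP[s0 sr].
have sI : s \in `[0, rho] by rewrite in_itv/= !ltW.
have z0 : 0 \in `[- rho, rho] by rewrite in_itv/= oppr_le0 ltW.
have := wle _ _ sI z0; rewrite /w /P !scale0r !addr0 subrr mulr0 subr0.
have -> : 2 * (2 * M / rho) = 2 * K * rho.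
  by rewrite /K; field; rewrite gt_eqF.
have : 0 <= K * s ^+ 2 by rewrite mulr_ge0 ?sqr_ge0.
by lra.
Unshelve. all: by end_near.
Qed.

End GradientEstimate.
(** * Differentiable and smooth maps *)

Section Differentiability.
Variables (R : realType) (V W : normedModType R).

Lemma differentiable_epsP (f : V -> W) (p : V) (L : {linear V -> W}) :
  continuous L ->
  (forall e, 0 < e -> exists2 d, 0 < d & forall h, `|h| < d ->
     `|f (p + h) - f p - L h| <= e * `|h|) ->
  differentiable f p /\ 'd f p = L :> (V -> W).
Proof.
move=> cL H.
have E : f \o shift p = cst (f p) + L +o_ 0 id.
  apply/eqaddoP => e e0; have [d d0 Hd] := H e e0.
  apply/nbhs_normP; exists d => //= h; rewrite /= sub0r normrN => hd.
  by have := Hd h hd; rewrite !fctE /= [h + p]addrC opprD addrA.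
have EL := diff_unique cL E; split => //.
by apply/diff_locallyP; rewrite EL.
Qed.

Lemma differentiable_eps (f : V -> W) (p : V) : differentiable f p ->
  forall e, 0 < e -> exists2 d, 0 < d & forall h, `|h| < d ->
     `|f (p + h) - f p - 'd f p h| <= e * `|h|.
Proof.
move=> /diff_locallyP[_ /eqaddoP H] e e0.
have /nbhs_normP[d /= d0 Hd] := H e e0; exists d => // h hd.
have := Hd h; rewrite /= sub0r normrN => /(_ hd).
by rewrite !fctE [h + p]addrC opprD addrA.
Qed.

Lemma near_eq_diff (f g : V -> W) (p : V) :
  (\near p, f p = g p) -> differentiable f p ->
  differentiable g p /\ 'd g p = 'd f p :> (V -> W).
Proof.
move=> fg df; apply: differentiable_epsP; first exact: diff_continuous.
have fgp := nbhs_singleton fg.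
move: fg => /nbhs_normP[d1 /= d10 H1] e e0.
have [d2 d20 H2] := differentiable_eps df e0.
exists (Num.min d1 d2); first by rewrite lt_min d10 d20.
move=> h; rewrite lt_min => /andP[h1 h2].
rewrite -fgp -H1; first exact: H2.
by rewrite /= opprD addrA subrr sub0r normrN.
Qed.

(** As U is open, f and g have the same germ at each of its points, so their derivatives agree on U
    too and the induction continues. *)
Lemma Ck_eq (U : set V) (k : nat) (f g : V -> W) : open U ->
  (forall q, U q -> f q = g q) -> Ck k U f -> Ck k U g.
Proof.
move=> oU; elim: k f g => [|k IH] f g fg /=.
  move=> cf p Up; rewrite /prop_for /continuous_at -fg//.
  apply: cvg_trans (cf p Up); apply: near_eq_cvg.
  by apply: filterS (open_nbhs_nbhs (conj oU Up)) => q /fg.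
move=> [df Cf]; split=> [p Up|v].
  have [] := @near_eq_diff f g p _ (df p Up) => //.
  by apply: filterS (open_nbhs_nbhs (conj oU Up)) => q /fg.
apply: (IH _ _ _ (Cf v)) => q Uq; apply: near_eq_derive.
by apply: filterS (open_nbhs_nbhs (conj oU Uq)) => r /fg.
Qed.

Lemma smooth_on_sub (U U' : set V) (f : V -> W) : U' `<=` U ->
  smooth_on U f -> smooth_on U' f.
Proof.
move=> UU sf k; have := sf k; elim: k f {sf} => [|k IH] f /= Cf.
  by move=> p /UU; exact: Cf.
by have [df Cf'] := Cf; split=> [p /UU/df//|v]; exact: IH.
Qed.

Lemma smooth_on_differentiable (U : set V) (f : V -> W) p :
  smooth_on U f -> U p -> differentiable f p.
Proof. by move=> /(_ 1%N)[+ _]; exact. Qed.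

Lemma smooth_on_continuous (U : set V) (f : V -> W) p :
  smooth_on U f -> U p -> {for p, continuous f}.
Proof. by move=> /(_ 0%N); exact. Qed.

Lemma smooth_on_derive (U : set V) (f : V -> W) v :
  smooth_on U f -> smooth_on U ('D_v f).
Proof. by move=> sf k; have [_] := sf k.+1; exact. Qed.

End Differentiability.

Section AffineComposition.
Variables (R : realType) (V W : normedModType R).

Lemma diff_affine_comp (W' : normedModType R) (L : {linear W -> W'}) (b : W')
    (f : V -> W) (p : V) : continuous L -> differentiable f p ->
  differentiable (fun q => L (f q) + b) p /\
  'd (fun q => L (f q) + b) p = L \o 'd f p :> (V -> W').
Proof.
move=> cL df.
have dL : is_diff (f p) L L by apply: DiffDef; [exact: linear_differentiable|exact: diff_lin].
have dLf := is_diff_comp (differentiableP df) dL.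
have H := is_diffD dLf (is_diff_cst b p).
by rewrite addr0 in H; split; [exact: ex_diff|exact: diff_val].
Qed.

(** Differentiating removes the translation, so the induction is over all b and is resumed at b =
    0. *)
Lemma Ck_affine_comp (W' : normedModType R) (L : {linear W -> W'}) (b : W')
    (U : set V) k f :
  continuous L -> open U -> Ck k U f -> Ck k U (fun q => L (f q) + b).
Proof.
move=> cL oU; elim: k f b => [|k IH] f b /= Cf.
  move=> p Up; apply: cvgD; last exact: cvg_cst.
  by apply: continuous_comp; [exact: Cf|exact: cL].
have [df Cf'] := Cf; split=> [p /df/(diff_affine_comp b cL)[]//|v].
apply: (Ck_eq oU _ (IH _ 0 (Cf' v))) => q /df dfq /=.
have [d1 E] := diff_affine_comp b cL dfq.
by rewrite addr0 !deriveE// E.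
Qed.

Lemma diff_comp_affine (U' : normedModType R) (L : {linear U' -> V}) (b : V)
    (f : V -> W) (p : U') : continuous L -> differentiable f (L p + b) ->
  differentiable (fun q => f (L q + b)) p /\
  'd (fun q => f (L q + b)) p = 'd f (L p + b) \o L :> (U' -> W).
Proof.
move=> cL df.
have dL : is_diff p (fun q => L q + b) L.
  have dL : is_diff p L L by apply: DiffDef; [exact: linear_differentiable|exact: diff_lin].
  have := is_diffD dL (is_diff_cst b p).
  by rewrite addr0.
split; first by apply: (@differentiable_comp _ _ _ _ (fun q => L q + b)).
have /= -> := @diff_comp _ _ _ _ (fun q => L q + b) f p (@ex_diff _ _ _ _ _ _ _ _) df.
by rewrite (@diff_val _ _ _ _ _ _ _ dL).
Qed.

Lemma Ck_comp_affine (U' : normedModType R) (L : {linear U' -> V}) (b : V)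
    (U : set V) k (f : V -> W) : continuous L -> open U -> Ck k U f ->
  Ck k ((fun q => L q + b) @^-1` U) (fun q => f (L q + b)).
Proof.
move=> cL oU.
have cLb : continuous (fun q => L q + b).
  by move=> q; apply: cvgD; [exact: cL|exact: cvg_cst].
have oLU : open ((fun q => L q + b) @^-1` U).
  by apply: open_comp => // q _; exact: cLb.
elim: k f => [|k IH] f /= Cf.
  by move=> p Up; apply: (continuous_comp (cLb p)); exact: Cf.
have [df Cf'] := Cf; split=> [p /df/(diff_comp_affine cL)[]//|v].
apply: (Ck_eq oLU _ (IH _ (Cf' (L v)))) => q /df dfq /=.
have [d1 E] := diff_comp_affine cL dfq.
by rewrite !deriveE// E.
Qed.

End AffineComposition.

(** * Row vectors, limits along ultrafilters, and components *)

Section RowVectors.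
Variables (R : realType) (m : nat).

Lemma rV_norm_le (u : 'rV[R]_m) (M : R) : 0 <= M ->
  (forall j, `|u 0 j| <= M) -> `|u| <= M.
Proof.
move=> M0 H; rewrite [leLHS]/Num.Def.normr/= mx_normrE.
by apply: bigmax_le => // -[i j] _ /=; rewrite ord1.
Qed.

Lemma rV_coord_le (u : 'rV[R]_m) j : `|u 0 j| <= `|u|.
Proof. by rewrite [leRHS]/Num.Def.normr/= mx_normrE; exact: (le_bigmax _ _ (ord0, j)). Qed.

Lemma linear_rV_continuous (W : normedModType R) (L : {linear 'rV[R]_m -> W}) :
  continuous L.
Proof.
apply: bounded_linear_continuous; apply/linear_boundedP.
exists (\sum_(j < m) `|L (delta_mx 0 j)|); split; first exact: num_real.
move=> K hK v; rewrite [in leLHS](row_sum_delta v) linear_sum.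
apply: le_trans (ler_norm_sum _ _ _) _.
apply: (@le_trans _ _ (\sum_(j < m) `|L (delta_mx 0 j)| * `|v|)).
  apply: ler_sum => j _; rewrite linearZ normrZ mulrC.
  by apply: ler_wpM2l => //; exact: rV_coord_le.
by rewrite -mulr_suml ler_wpM2r// ltW.
Qed.

End RowVectors.

Lemma ultra_fmap (T U : Type) (f : T -> U) (F : set_system T) :
  UltraFilter F -> UltraFilter (f @ F).
Proof.
move=> FU; split; first exact: fmap_proper_filter.
move=> G PG FG; apply/seteqP; split=> // A GA.
have [//|FnA] := in_ultra_setVsetC (f @^-1` A) FU.
have GnA : G (~` A) by apply: FG.
exfalso; apply: (@filter_not_empty _ G PG).
by rewrite -(setICr A); exact: filterI.
Qed.

Lemma ultra_compact_cvg (T : Type) (X : topologicalType) (F : set_system T)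
    (f : T -> X) (K : set X) :
  UltraFilter F -> compact K -> (\forall t \near F, K (f t)) ->
  exists2 l, K l & f @ F --> l.
Proof.
move=> FU; rewrite compact_ultra => cK FK.
by have [l [Kl Fl]] := cK _ (ultra_fmap f FU) FK; exists l.
Qed.

Lemma closed_ball_compact (R : realType) (m : nat) (p : 'rV[R]_m) (M : R) :
  compact [set q | `|p - q| <= M].
Proof.
apply: bounded_closed_compact.
  exists (`|p| + M); split; first exact: num_real.
  move=> x hx q /= qM; apply: le_trans (ltW hx).
  rewrite -lerBlDl; apply: le_trans qM.
  by rewrite distrC; exact: lerB_dist.
exact: (@closed_closed_ball_ _ _ p M).
Qed.

(** Boundedness along an ultrafilter already gives a limit: this takes the place of every extraction
    of a convergent subsequence in R^m. *)
Lemma rV_ultra_cvg (R : realType) (m : nat) (T : Type) (F : set_system T)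
    (f : T -> 'rV[R]_m) (M : R) :
  UltraFilter F -> (\forall t \near F, `|f t| <= M) -> exists l : 'rV[R]_m, f @ F --> l.
Proof.
move=> FU FM.
have [|l _ Hl] := ultra_compact_cvg (f := f) FU (@closed_ball_compact R m 0 M).
  by apply: filterS FM => t; rewrite /= sub0r normrN.
by exists l.
Qed.

Lemma near_eq_continuous (T U : topologicalType) (f g : T -> U) (p : T) :
  (\near p, f p = g p) -> {for p, continuous f} -> {for p, continuous g}.
Proof.
move=> fg cf; rewrite /prop_for /continuous_at -(nbhs_singleton fg).
by apply: cvg_trans cf; exact: near_eq_cvg.
Qed.

Section Components.
Variables (R : realType) (V : normedModType R) (m : nat).
Implicit Types f : V -> 'rV[R]_m.

Lemma differentiable_component f p j : differentiable f p ->
  differentiable (fun q => f q 0 j) p.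
Proof.
move=> df; apply: (@differentiable_comp _ _ _ _ f (fun M : 'rV[R]_m => M 0 j)) => //.
exact: differentiable_coord.
Qed.

Lemma derive_component f p v j : differentiable f p ->
  'D_v (fun q => f q 0 j) p = 'D_v f p 0 j.
Proof. by move=> df; rewrite derive_mx ?mxE//; exact: diff_derivable. Qed.

Lemma derive2_component f p u v j : (\near p, differentiable f p) ->
  'D_u ('D_v (fun q => f q 0 j)) p = 'D_u (fun q => 'D_v f q 0 j) p.
Proof.
move=> df; apply: near_eq_derive; apply: filterS df => q; exact: derive_component.
Qed.

Lemma smooth_schwarz (U : set V) f p u v : open U -> smooth_on U f -> U p ->
  'D_u ('D_v f) p = 'D_v ('D_u f) p.
Proof.
move=> oU sf Up; have Unbhs q : U q -> nbhs q U by move=> Uq; exact: (open_nbhs_nbhs (conj oU Uq)).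
have dU q : U q -> differentiable f q by exact: smooth_on_differentiable.
have dUv w q : U q -> differentiable ('D_w f) q.
  by apply: smooth_on_differentiable; exact: smooth_on_derive.
have ndU q : U q -> \forall q \near q, differentiable f q.
  by move=> /Unbhs; apply: filterS.
have /nbhs_ballP[r /= r0 rU] := Unbhs p Up.
apply/rowP => j.
have E a b q : U q -> 'D_a ('D_b f) q 0 j = 'D_a ('D_b (fun q => f q 0 j)) q.
  move=> Uq; rewrite (derive2_component _ _ _ (ndU q Uq)).
  by rewrite (derive_component _ _ (dUv b q Uq)).
apply: (etrans (E u v p Up)); apply: (etrans _ (esym (E v u p Up))).
have cU a b : {for p, continuous ('D_a ('D_b (fun q => f q 0 j)))}.
  have c : {for p, continuous (fun q => 'D_a ('D_b f) q 0 j)}.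
    apply: (@differentiable_continuous _ _ _ p); apply: differentiable_component.
    by apply: (smooth_on_differentiable _ Up); do 2 apply: smooth_on_derive.
  by apply: near_eq_continuous c; apply: filterS (Unbhs p Up) => q; exact: E.
apply: (@schwarz R V _ p _ _ r r0) => // q /rU Uq.
have D a : derivable (fun q => f q 0 j) q a.
  by apply: diff_derivable; apply: differentiable_component; exact: dU.
have D2 a b : derivable ('D_a (fun q => f q 0 j)) q b.
  apply: (@near_eq_derivable _ _ _ (fun q => 'D_a f q 0 j)).
    by apply: filterS (ndU q Uq) => x dx; rewrite derive_component.
  by apply: diff_derivable; apply: differentiable_component; exact: dUv.
by split.
Qed.

End Components.
(** * Pluriharmonic maps and limits of holomorphic maps *)

Section ComplexStructure.
Variables (R : realType) (n : nat).

Lemma Jstd_l (v : Cspace R n) k : Jstd v 0 (lshift n k) = - v 0 (rshift n k).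
Proof. by rewrite row_mxEl !mxE. Qed.

Lemma Jstd_r (v : Cspace R n) k : Jstd v 0 (rshift n k) = v 0 (lshift n k).
Proof. by rewrite row_mxEr mxE. Qed.

Lemma eq_Cspace (u v : Cspace R n) :
  (forall k, u 0 (lshift n k) = v 0 (lshift n k)) ->
  (forall k, u 0 (rshift n k) = v 0 (rshift n k)) -> u = v.
Proof.
move=> hl hr; rewrite -[u]hsubmxK -[v]hsubmxK.
by congr row_mx; apply/rowP => k; rewrite !mxE.
Qed.

Lemma Jstd_is_linear : linear (@Jstd R n).
Proof.
move=> a u v; apply: eq_Cspace => k.
  by rewrite [RHS]mxE [X in _ = X + _]mxE !Jstd_l !mxE; ring.
by rewrite [RHS]mxE [X in _ = X + _]mxE !Jstd_r !mxE.
Qed.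

HB.instance Definition _ :=
  GRing.isLinear.Build R (Cspace R n) (Cspace R n) *:%R (@Jstd R n) Jstd_is_linear.

Lemma JstdK (v : Cspace R n) : Jstd (Jstd v) = - v.
Proof.
by apply: eq_Cspace => k; rewrite ?Jstd_l ?Jstd_r ?Jstd_l !mxE.
Qed.

Lemma norm_Jstd (v : Cspace R n) : `|Jstd v| <= `|v|.
Proof.
apply: rV_norm_le => // j; rewrite -(fintype.splitK j).
case: (fintype.split j) => k /=.
  by rewrite Jstd_l normrN rV_coord_le.
by rewrite Jstd_r rV_coord_le.
Qed.

End ComplexStructure.

Section Pluriharmonic.
Variables (R : realType) (n m : nat).
Implicit Types (U : set (Cspace R n)) (f : Cspace R n -> 'rV[R]_m).

(** Harmonicity on every complex line: the Laplacian in the plane spanned by v and Jv vanishes. It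
    makes sense for targets without complex structure, is inherited by components and derivatives,
    and is what the gradient estimate consumes. *)
Definition pluriharmonic U f := smooth_on U f /\
  forall p, U p -> forall v,
    'D_v ('D_v f) p + 'D_(Jstd v) ('D_(Jstd v) f) p = 0.

Lemma pluriharmonic_sub U U' f : U' `<=` U -> pluriharmonic U f -> pluriharmonic U' f.
Proof.
move=> UU [sf hf]; split; first exact: smooth_on_sub sf.
by move=> p /UU; exact: hf.
Qed.

(** The defining operator has constant coefficients, so by [smooth_schwarz] it commutes with
    ['D_v]. *)
Lemma pluriharmonic_derive U f v : open U -> pluriharmonic U f ->
  pluriharmonic U ('D_v f).
Proof.
move=> oU [sf hf]; split; first exact: smooth_on_derive.
move=> p Up w.
have nU q : U q -> nbhs q U by move=> Uq; exact: open_nbhs_nbhs (conj oU Uq).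
have C a : 'D_a ('D_a ('D_v f)) p = 'D_v ('D_a ('D_a f)) p.
  apply: (@etrans _ _ ('D_a ('D_v ('D_a f)) p)).
    apply: near_eq_derive; apply: filterS (nU p Up) => q Uq.
    exact: smooth_schwarz oU sf Uq.
  exact: (@smooth_schwarz _ _ _ U ('D_a f) p a v oU (smooth_on_derive a sf) Up).
apply: (etrans (congr2 +%R (C w) (C (Jstd w)))).
have D a : derivable ('D_a ('D_a f)) p v.
  apply: diff_derivable; apply: (smooth_on_differentiable _ Up).
  by do 2 apply: smooth_on_derive.
apply: (etrans (esym (deriveD (D w) (D (Jstd w))))).
apply: (@etrans _ _ ('D_v (cst 0) p)); last exact: derive_cst.
by apply: near_eq_derive; apply: filterS (nU p Up) => q Uq; exact: hf.
Qed.

Lemma pluriharmonic_gradient f p (r M : R) v : 0 < r ->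
  pluriharmonic (ball p r) f -> (forall q, ball p r q -> `|f q| <= M) ->
  `|'D_v f p| <= 8 * M / r * `|v|.
Proof.
move=> r0 [sf hf] fM.
have [->|v0] := eqVneq v 0; first by rewrite derive0 !normr0 mulr0.
have M0 : 0 <= M := le_trans (normr_ge0 _) (fM p (ballxx p r0)).
have nv : 0 < `|v| by rewrite normr_gt0.
apply: rV_norm_le => [|j].
  by apply: mulr_ge0 => //; apply: divr_ge0 (ltW r0); exact: mulr_ge0.
have dU q : ball p r q -> differentiable f q by exact: smooth_on_differentiable.
have oB : open (ball p r) by exact: ball_open.
have dUv w q : ball p r q -> differentiable ('D_w f) q.
  by apply: smooth_on_differentiable; exact: smooth_on_derive.
have ndU q : ball p r q -> \forall q \near q, differentiable f q.
  move=> Bq; apply: filterS dU _; exact: (open_nbhs_nbhs (conj oB Bq)).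
rewrite -(derive_component _ _ (dU p (ballxx p r0))).
have -> : 8 * M / r * `|v| = 2 * M / (r / (4 * `|v|)).
  by field; rewrite !gt_eqF.
apply: (@gradient_estimate _ _ _ p v (Jstd v) r) => [||q Bq].
- by rewrite divr_gt0// mulr_gt0.
- apply: (@le_lt_trans _ _ (r / (4 * `|v|) * (`|v| + `|v|))).
    apply: ler_wpM2l; last by rewrite lerD2l norm_Jstd.
    by rewrite divr_ge0 ?ltW// mulr_gt0.
  have -> : r / (4 * `|v|) * (`|v| + `|v|) = r / 2 by field; rewrite gt_eqF.
  by lra.
- have D w : differentiable ('D_w (fun q => f q 0 j)) q.
    have [] := @near_eq_diff _ _ _ (fun q => 'D_w f q 0 j) ('D_w (fun q => f q 0 j)) q => //.
      by apply: filterS (ndU q Bq) => x dx; rewrite derive_component.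
    by apply: differentiable_component; exact: dUv.
  split => //; first by apply: differentiable_component; exact: dU.
    rewrite (derive2_component v v j (ndU q Bq)) (derive_component _ _ (dUv v q Bq)).
    rewrite (derive2_component _ _ j (ndU q Bq)) (derive_component _ _ (dUv _ q Bq)).
    by have /rowP/(_ j) := hf q Bq v; rewrite !mxE.
  by apply: le_trans (fM q Bq); exact: rV_coord_le.
Qed.

End Pluriharmonic.

(** The Cauchy-Riemann equation says that ['D_(Jstd v)] is J after ['D_v]. Used twice, with the
    symmetry of second derivatives in between, it produces J^2 = -1. *)
Lemma holomorphic_pluriharmonic (R : realType) (n k : nat) (U : set (Cspace R n))
    (f : Cspace R n -> Cspace R k) :
  open U -> holomorphic_on U f -> pluriharmonic U f.
Proof.
move=> oU [sf cr]; split=> // p Up v.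
have nU q : U q -> nbhs q U by move=> Uq; exact: open_nbhs_nbhs (conj oU Uq).
have dU q : U q -> differentiable f q by exact: smooth_on_differentiable.
have dUv w q : U q -> differentiable ('D_w f) q.
  by apply: smooth_on_differentiable; exact: smooth_on_derive.
have crD w q : U q -> 'D_(Jstd w) f q = Jstd ('D_w f q).
  by move=> Uq; rewrite !deriveE ?cr//; exact: dU.
have DJ w : 'D_w ('D_(Jstd v) f) p = Jstd ('D_w ('D_v f) p).
  apply: (@etrans _ _ ('D_w (@Jstd R k \o 'D_v f) p)).
    by apply: near_eq_derive; apply: filterS (nU p Up) => q; exact: crD.
  have cJ : continuous (@Jstd R k) by exact: linear_rV_continuous.
  have dJ : differentiable (@Jstd R k) ('D_v f p) by exact: linear_differentiable.
  rewrite deriveE; last exact: differentiable_comp (dUv v p Up) dJ.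
  by rewrite (diff_comp (dUv v p Up) dJ) /= (diff_lin _ cJ) -deriveE//; exact: dUv.
apply/eqP; rewrite addrC addr_eq0; apply/eqP.
apply: (etrans (DJ (Jstd v))).
apply: (etrans (congr1 _ (smooth_schwarz (Jstd v) v oU sf Up))).
apply: (etrans (congr1 _ (DJ v))); exact: JstdK.
Qed.
Section Taylor.
Variables (R : realType) (V : normedModType R) (m : nat).

Lemma line_variation (f : V -> 'rV[R]_m) (p h : V) (K x : R) :
  (forall s, s \in `[0, 1] -> differentiable f (p + s *: h)) ->
  (forall s, s \in `[0, 1] -> `|'D_h f (p + s *: h)| <= K) ->
  x \in `[0, 1] -> `|f (p + x *: h) - f p| <= K.
Proof.
move=> df dK xI.
have K0 : 0 <= K by apply: le_trans (normr_ge0 _) (dK x xI).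
move: xI; rewrite in_itv/= le_eqVlt => /andP[/predU1P[<- _|x0 x1]].
  by rewrite scale0r addr0 subrr normr0.
have I s : s \in `[0, x] -> s \in `[0, 1].
  by rewrite !in_itv/= => /andP[-> /le_trans]; apply.
apply: rV_norm_le => // j.
have [|y yI] := @MVT_cc R (fun s => f (p + s *: h) 0 j)
  (fun s => 'D_h (fun q => f q 0 j) (p + s *: h)) 0 x x0.
  move=> s sI; apply: is_derive_line.
  by apply: diff_derivable; apply: differentiable_component; exact/df/I.
rewrite scale0r addr0 subr0 derive_component; last exact/df/I.
rewrite !mxE => ->; rewrite normrM [`|x|]gtr0_norm// -[leRHS]mulr1.
apply: ler_pM => //; first exact: ltW.
exact: le_trans (rV_coord_le _ _) (dK y (I _ yI)).
Qed.

(** Two uses of the mean value theorem give the remainder without the factor 1/2. They are made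
    coordinate by coordinate, since the intermediate point depends on the coordinate. *)
Lemma taylor2 (f : V -> 'rV[R]_m) (U : set V) (p h : V) (K : R) :
  smooth_on U f -> (forall s, s \in `[0, 1] -> U (p + s *: h)) ->
  (forall s, s \in `[0, 1] -> `|'D_h ('D_h f) (p + s *: h)| <= K) ->
  `|f (p + h) - f p - 'D_h f p| <= K.
Proof.
move=> sf hU dK.
have z0 : (0 : R) \in `[0, 1] by rewrite in_itv/= lexx ler01.
have K0 : 0 <= K by apply: le_trans (normr_ge0 _) (dK 0 z0).
have dU q : U q -> differentiable f q by exact: smooth_on_differentiable.
have dUv q : U q -> differentiable ('D_h f) q.
  by apply: smooth_on_differentiable; exact: smooth_on_derive.
apply: rV_norm_le => // j.
have [|x xI] := @MVT_cc R (fun s => f (p + s *: h) 0 j)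
  (fun s => 'D_h (fun q => f q 0 j) (p + s *: h)) 0 1 ltr01.
  move=> s sI; apply: is_derive_line.
  by apply: diff_derivable; apply: differentiable_component; exact/dU/hU.
rewrite scale0r scale1r addr0 subr0 mulr1 derive_component; last exact/dU/hU.
move=> E1; rewrite !mxE E1.
have := @line_variation ('D_h f) p h K x (fun s sI => dUv _ (hU s sI)) dK xI.
by apply: le_trans; have := rV_coord_le ('D_h f (p + x *: h) - 'D_h f p) j; rewrite !mxE.
Qed.

End Taylor.

Section Limits.
Variables (R : realType) (n m : nat) (T : Type) (F : set_system T).
Hypothesis FU : UltraFilter F.
Implicit Types (U : set (Cspace R n)) (u : T -> Cspace R n -> 'rV[R]_m).

Definition locally_bounded_family U u := forall p, U p ->
  exists2 r : R, 0 < r & exists M : R, \forall t \near F,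
    pluriharmonic (ball p r) (u t) /\ forall q, ball p r q -> `|u t q| <= M.

Lemma ball_half (V : normedModType R) (p q : V) (r : R) : ball p (r / 2) q ->
  ball q (r / 2) `<=` ball p r.
Proof. by move=> pq x qx; rewrite [r]splitr; exact: ball_triangle pq qx. Qed.

Lemma gradient_half f (p : Cspace R n) (r M : R) v : 0 < r ->
  @pluriharmonic R n m (ball p r) f -> (forall q, ball p r q -> `|f q| <= M) ->
  forall q, ball p (r / 2) q -> `|'D_v f q| <= 16 * M / r * `|v|.
Proof.
move=> r0 hf fM q pq; have r20 : 0 < r / 2 by rewrite divr_gt0.
have -> : 16 * M / r = 8 * M / (r / 2) by field; rewrite gt_eqF.
apply: pluriharmonic_gradient => //; first exact: pluriharmonic_sub (ball_half pq) hf.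
by move=> x /(ball_half pq)/fM.
Qed.

Lemma locally_bounded_family_derive U u v : locally_bounded_family U u ->
  locally_bounded_family U (fun t => derive (u t) ^~ v).
Proof.
move=> H p /H[r r0 [M FM]]; exists (r / 2); first by rewrite divr_gt0.
exists (16 * M / r * `|v|); apply: filterS FM => t [hu uM]; split.
  apply: pluriharmonic_derive; first exact: ball_open.
  by apply: pluriharmonic_sub hu; apply: le_ball; lra.
exact: gradient_half.
Qed.

(* The second derivatives of the family are bounded, so the quadratic Taylor
   estimate at p passes to the limit. *)
Lemma limit_differentiable U u (w : Cspace R n -> 'rV[R]_m) : open U ->
  locally_bounded_family U u ->
  (forall p, U p -> u t p @[t --> F] --> w p) ->
  forall p, U p -> differentiable w p /\
    forall v, 'D_v (u t) p @[t --> F] --> 'D_v w p.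
Proof.
move=> oU H uw p Up; have [r1 r10 [M FM1]] := H p Up.
have /nbhs_ballP[r2 /= r20 r2U] : nbhs p U by exact: open_nbhs_nbhs.
pose r := Num.min r1 r2.
have r0 : 0 < r by rewrite lt_min r10 r20.
have rU : ball p r `<=` U.
  by apply: subset_trans r2U; apply: le_ball; rewrite /r ge_min lexx orbT.
have {FM1} FM : \forall t \near F,
    pluriharmonic (ball p r) (u t) /\ forall q, ball p r q -> `|u t q| <= M.
  have rr1 : ball p r `<=` ball p r1 by apply: le_ball; rewrite /r ge_min lexx.
  apply: filterS FM1 => t [hu uM]; split; first exact: pluriharmonic_sub hu.
  by move=> q /rr1/uM.
have pr : ball p (r / 2) p by apply: ballxx; rewrite divr_gt0.
have cL h : exists l : 'rV[R]_m, 'D_h (u t) p @[t --> F] --> l.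
  apply: (@rV_ultra_cvg _ _ _ _ _ (16 * M / r * `|h|)).
  by apply: filterS FM => t [hu uM]; exact: gradient_half pr.
have [L HL] := choice cL.
have Llin : linear L.
  move=> a h k.
  have F1 : 'D_(a *: h + k) (u t) p @[t --> F] --> L (a *: h + k) by exact: HL.
  have F2 : a *: 'D_h (u t) p + 'D_k (u t) p @[t --> F] --> a *: L h + L k.
    by apply: cvgD; [apply: cvgZl_tmp; exact: HL|exact: HL].
  have F3 : 'D_(a *: h + k) (u t) p @[t --> F] --> a *: L h + L k.
    apply: cvg_trans F2; apply: near_eq_cvg; apply: filterS FM => t [[su _] _].
    have d : differentiable (u t) p by exact: smooth_on_differentiable su (ballxx p r0).
    by rewrite !deriveE// linearP.
  by apply: (cvg_unique _ F1 F3); exact: norm_hausdorff.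
pose C := 16 * (16 * M / r) / (r / 2).
have quad h : `|h| < r / 4 -> `|w (p + h) - w p - L h| <= C * `|h| ^+ 2.
  move=> hr.
  have hI s : s \in `[0, 1] -> ball p (r / 2 / 2) (p + s *: h).
    rewrite in_itv/= => /andP[s0 s1].
    rewrite -ball_normE /ball_ /= opprD addrA subrr sub0r normrN normrZ ger0_norm//.
    apply: le_lt_trans (ler_piMl _ _) _ => //.
    by rewrite (_ : r / 2 / 2 = r / 4)//; field.
  have B1 : ball p (r / 2) `<=` ball p r by apply: le_ball; lra.
  have Uph : U (p + h).
    apply/rU/B1; have := hI 1; rewrite scale1r in_itv/= lexx ler01 => /(_ isT).
    by apply: le_ball; lra.
  have lim : `|u t (p + h) - u t p - 'D_h (u t) p| @[t --> F] -->
      `|w (p + h) - w p - L h|.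
    by apply: cvg_norm; apply: cvgB (HL h); apply: cvgB; apply: uw.
  apply: (cvgr_to_le lim).
  apply: filterS FM => t [hu uM].
  have bnd := gradient_half h r0 hu uM.
  have hu' : pluriharmonic (ball p (r / 2)) ('D_h (u t)).
    apply: pluriharmonic_derive; first exact: ball_open.
    exact: pluriharmonic_sub hu.
  have bnd2 := gradient_half h _ hu' bnd.
  apply: (@taylor2 _ _ _ (u t) (ball p r)); first by case: hu.
    by move=> s /hI sB; apply: B1; apply: le_ball sB; lra.
  move=> s /hI sB; apply: le_trans (bnd2 _ _ sB) _; first by rewrite divr_gt0.
  by rewrite expr2 /C; lra.
pose Ll : {linear Cspace R n -> 'rV[R]_m} := HB.pack L (GRing.isLinear.Build _ _ _ _ L Llin).
have [dw Ew] : differentiable w p /\ 'd w p = Ll :> (_ -> _).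
  apply: differentiable_epsP; first exact: linear_rV_continuous.
  move=> e e0; pose d := Num.min (r / 4) (e / (`|C| + 1)).
  have C1 : 0 < `|C| + 1 by rewrite ltr_wpDl.
  exists d; first by rewrite lt_min !divr_gt0.
  move=> h; rewrite lt_min => /andP[h1 h2]; apply: le_trans (quad h h1) _.
  rewrite expr2 mulrA; apply: ler_wpM2r => //.
  move: h2; rewrite ltr_pdivlMr// => /ltW; apply: le_trans.
  rewrite mulrC; apply: ler_wpM2l => //.
  by apply: le_trans (ler_norm _) _; rewrite lerDl.
by split=> // v; rewrite deriveE// Ew; exact: HL.
Qed.

(** The derivatives of the family are again locally bounded and converge to the derivative of the
    limit, so differentiability bootstraps. *)
Lemma limit_smooth U u (w : Cspace R n -> 'rV[R]_m) : open U ->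
  locally_bounded_family U u ->
  (forall p, U p -> u t p @[t --> F] --> w p) -> smooth_on U w.
Proof.
move=> oU H uw k; elim: k u w H uw => [|k IH] u w H uw /=.
  move=> p Up; apply: differentiable_continuous.
  by have [] := limit_differentiable oU H uw Up.
split=> [p Up|v]; first by have [] := limit_differentiable oU H uw Up.
apply: (IH (fun t => 'D_v (u t))); first exact: locally_bounded_family_derive.
by move=> p Up; have [_] := limit_differentiable oU H uw Up; apply.
Qed.

End Limits.

Section HolomorphicLimits.
Variables (R : realType) (n m : nat) (T : Type) (F : set_system T).
Hypothesis FU : UltraFilter F.

(** Differentials converge along with the maps, so the Cauchy-Riemann equation passes to the
    limit. *)
Lemma limit_holomorphic (U : set (Cspace R n)) (u : T -> Cspace R n -> Cspace R m)
    (w : Cspace R n -> Cspace R m) : open U ->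
  (forall p, U p -> exists2 r : R, 0 < r & exists M : R, \forall t \near F,
    holomorphic_on (ball p r) (u t) /\ forall q, ball p r q -> `|u t q| <= M) ->
  (forall p, U p -> u t p @[t --> F] --> w p) ->
  holomorphic_on U w /\
  forall p v, U p -> 'd (u t) p v @[t --> F] --> 'd w p v.
Proof.
move=> oU H uw.
have lb : locally_bounded_family F U u.
  move=> p /H[r r0 [M FM]]; exists r => //; exists M; apply: filterS FM.
  by move=> t [hu uM]; split=> //; apply: holomorphic_pluriharmonic hu; exact: ball_open.
have dcvg p v : U p -> 'd (u t) p v @[t --> F] --> 'd w p v.
  move=> Up; have [dw /(_ v)] := limit_differentiable FU oU lb uw Up.
  rewrite deriveE//; apply: cvg_trans; apply: near_eq_cvg.
  have [r r0 [M FM]] := H p Up; apply: filterS FM => t [[su _] _].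
  by rewrite deriveE//; exact: smooth_on_differentiable su (ballxx p r0).
split=> //; split; first exact: limit_smooth oU lb uw.
move=> p Up v; have F1 := dcvg p (Jstd v) Up.
have F2 : Jstd ('d (u t) p v) @[t --> F] --> Jstd ('d w p v).
  have cJ : continuous (@Jstd R m) by exact: linear_rV_continuous.
  by apply: continuous_cvg (dcvg p v Up); exact: cJ.
have F3 : 'd (u t) p (Jstd v) @[t --> F] --> Jstd ('d w p v).
  apply: cvg_trans F2; apply: near_eq_cvg.
  have [r r0 [M FM]] := H p Up; apply: filterS FM => t [[_ hu] _].
  by rewrite hu//; exact: ballxx.
by apply: (cvg_unique _ F1 F3); exact: norm_hausdorff.
Qed.

End HolomorphicLimits.
(** * Hermitian inner products *)

Section InnerProduct.
Variables (R : realType) (m : nat).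
Implicit Types (G : 'M[R]_m) (u v w : 'rV[R]_m).

Lemma innerE G u v : inner G u v = \sum_k \sum_l u 0 l * G l k * v 0 k.
Proof.
rewrite /inner mxE; apply: eq_bigr => k _; rewrite !mxE mulr_suml.
by apply: eq_bigr.
Qed.

Lemma innerDl G u v w : inner G (u + v) w = inner G u w + inner G v w.
Proof. by rewrite /inner !mulmxDl mxE. Qed.

Lemma innerDr G u v w : inner G u (v + w) = inner G u v + inner G u w.
Proof. by rewrite /inner linearD mulmxDr mxE. Qed.

Lemma innerZl G a u v : inner G (a *: u) v = a * inner G u v.
Proof. by rewrite /inner -!scalemxAl mxE. Qed.

Lemma innerZr G a u v : inner G u (a *: v) = a * inner G u v.
Proof. by rewrite /inner linearZ -scalemxAr mxE. Qed.

Lemma innerNl G u v : inner G (- u) v = - inner G u v.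
Proof. by rewrite -scaleN1r innerZl mulN1r. Qed.

Lemma innerNr G u v : inner G u (- v) = - inner G u v.
Proof. by rewrite -scaleN1r innerZr mulN1r. Qed.

Lemma inner0r G u : inner G u 0 = 0.
Proof. by rewrite -(scale0r (0 : 'rV_m)) innerZr mul0r. Qed.

Lemma inner0l G u : inner G 0 u = 0.
Proof. by rewrite -(scale0r (0 : 'rV_m)) innerZl mul0r. Qed.

Lemma inner_mulmx k G (P : 'M[R]_(k, m)) (u v : 'rV[R]_k) :
  inner (P *m G *m P^T) u v = inner G (u *m P) (v *m P).
Proof. by rewrite /inner trmx_mul !mulmxA. Qed.

Lemma inner_bound : exists2 C : R, 0 < C &
  forall G u v, `|inner G u v| <= C * `|G| * `|u| * `|v|.
Proof.
(* The form has m * m terms; the added 1 keeps the constant positive for m = 0. *)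
exists ((m * m)%:R + 1); first by rewrite ltr_wpDl.
move=> G u v; rewrite innerE.
have Gkl k l : `|G l k| <= `|G|.
  by rewrite [leRHS]/Num.Def.normr/= mx_normrE; exact: (le_bigmax _ _ (l, k)).
have term k l : `|u 0 l * G l k * v 0 k| <= `|G| * `|u| * `|v|.
  rewrite !normrM [`|u 0 l| * _]mulrC; apply: ler_pM => //.
  - by apply: ler_pM => //; exact: rV_coord_le.
  - exact: rV_coord_le.
apply: (@le_trans _ _ (\sum_(k < m) \sum_(l < m) `|G| * `|u| * `|v|)).
  apply: le_trans (ler_norm_sum _ _ _) _; apply: ler_sum => k _.
  by apply: le_trans (ler_norm_sum _ _ _) _; apply: ler_sum => l _; exact: term.
rewrite !sumr_const !card_ord -mulrnA -!mulrA -[leLHS]mulr_natl.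
by apply: ler_wpM2r; rewrite ?mulr_ge0// lerDl.
Qed.

Lemma cvg_inner (T : Type) (F : set_system T) {FF : Filter F}
    (G : T -> 'M[R]_m) (u v : T -> 'rV[R]_m) G0 u0 v0 :
  G @ F --> G0 -> u @ F --> u0 -> v @ F --> v0 ->
  inner (G t) (u t) (v t) @[t --> F] --> inner G0 u0 v0.
Proof.
move=> GF uF vF; rewrite (_ : (fun t => _) =
    fun t => \sum_k \sum_l u t 0 l * G t l k * v t 0 k); last first.
  by apply/funext => t; rewrite innerE.
have cc p q (M : T -> 'M[R]_(p, q)) (M0 : 'M[R]_(p, q)) i j :
    M @ F --> M0 -> M t i j @[t --> F] --> M0 i j.
  by move=> MF; apply: (cvg_comp _ _ MF (@coord_continuous _ _ _ i j M0)).
rewrite innerE.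
apply: cvg_big => [|k _]; first exact: add_continuous.
apply: cvg_big => [|l _]; first exact: add_continuous.
apply: cvgM; last exact: cc.
by apply: cvgM; exact: cc.
Qed.

Lemma inner_derive (V : normedModType R) (G : V -> 'M[R]_m) (a b : V -> 'rV[R]_m)
    (p u : V) :
  derivable G p u -> derivable a p u -> derivable b p u ->
  is_derive p u (fun q => inner (G q) (a q) (b q))
    (inner ('D_u G p) (a p) (b p) + inner (G p) ('D_u a p) (b p)
     + inner (G p) (a p) ('D_u b p)).
Proof.
move=> dG da db.
have comp r s (M : V -> 'M[R]_(r, s)) i j : derivable M p u ->
    is_derive p u (fun q => M q i j) ('D_u M p i j).
  move=> dM; rewrite derive_mx// mxE; apply/derivableP.
  by move/derivable_mxP : dM; exact.
rewrite (_ : (fun q => _) =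
    \sum_(k < m) \sum_(l < m) (fun q => a q 0 l * G q l k * b q 0 k)); last first.
  apply/funext => q; rewrite innerE fct_sumE; apply: eq_bigr => k _.
  by rewrite fct_sumE.
rewrite !innerE -!big_split/=.
rewrite (_ : \sum_(i < m) _ = \sum_(k < m) \sum_(l < m)
  ((a p 0 l * G p l k) * 'D_u b p 0 k
   + b p 0 k * (a p 0 l * 'D_u G p l k + G p l k * 'D_u a p 0 l))); last first.
  apply: eq_bigr => k _; rewrite -!big_split/=; apply: eq_bigr => l _.
  by rewrite /GRing.scale/=; ring.
apply: is_derive_sum => k; apply: is_derive_sum => l.
by apply: is_deriveM; [apply: is_deriveM; exact: comp|exact: comp].
Qed.

Lemma kernel_vector k (C : 'M[R]_(m, k)) : (k < m)%N ->
  exists2 v : 'rV[R]_m, v != 0 & v *m C = 0.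
Proof.
move=> km; have : kermx C != 0.
  rewrite -mxrank_eq0 mxrank_ker subn_eq0 -ltnNge.
  exact: leq_ltn_trans (rank_leq_col C) km.
move=> /rowV0Pn[v /sub_kermxP vC v0].
by exists v.
Qed.

(** By homogeneity, c can be taken as the minimum over the unit sphere, which is compact. *)
Lemma inner_lower G : (forall u, u != 0 -> 0 < inner G u u) ->
  exists2 c : R, 0 < c & forall u, c * `|u| ^+ 2 <= inner G u u.
Proof.
move=> Gpos.
(* In dimension zero the sphere is empty and there is no minimum to take. *)
case: (pselect (exists u : 'rV[R]_m, u != 0)) => [[u1 u10]|no]; last first.
  exists 1 => // u; have -> : u = 0.
    by apply: contrapT => /eqP u0; apply: no; exists u.
  by rewrite normr0 expr0n/= mulr0 inner0l.
pose S : set 'rV[R]_m := [set u | `|u| = 1].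
have cS : compact S.
  apply: (@subclosed_compact _ _ [set q | `|0 - q| <= 1]).
  - have -> : S = (fun u => `|u|) @^-1` [set 1] by [].
    by apply: preimage_closed => [u _|]; [exact: norm_continuous|exact: closed_eq].
  - exact: closed_ball_compact.
  - by move=> u /= E; rewrite sub0r normrN E.
have S0 : S !=set0.
  exists (`|u1|^-1 *: u1); rewrite /S /= normrZ normrV ?unitfE ?normr_eq0//.
  by rewrite normr_id mulVf// normr_eq0.
have cf : {within S, continuous (fun u => inner G u u)}.
  apply: continuous_subspaceT => u.
  by apply: (@cvg_inner _ (nbhs u) _ (fun=> G) id id G u u);
    [exact: cvg_cst|exact: cvg_id|exact: cvg_id].
have [c cS' cmin] := compact_EVT_min S0 cS cf.
have c0 : c != 0.
  by move: cS'; rewrite inE /S /= => c1; rewrite -normr_eq0 c1 oner_eq0.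
exists (inner G c c); first exact: Gpos.
move=> u; have [->|u0] := eqVneq u 0; first by rewrite normr0 expr0n/= mulr0 inner0l.
have nu : 0 < `|u| by rewrite normr_gt0.
have := cmin (`|u|^-1 *: u); rewrite inE /S /= => /(_ _); rewrite innerZl innerZr.
rewrite mulrA -expr2 exprVn mulrC ler_pdivlMr ?exprn_gt0//; apply.
by rewrite normrZ gtr0_norm ?invr_gt0// mulVf// gt_eqF.
Qed.

End InnerProduct.

Section Hermitian.
Variables (R : realType) (n : nat) (G : 'M[R]_(n + n)).
Hypothesis G_sym : forall u v, inner G u v = inner G v u.
Hypothesis G_J : forall u v : Cspace R n, inner G (Jstd u) (Jstd v) = inner G u v.

Lemma inner_J_skew (u v : Cspace R n) : inner G (Jstd u) v = - inner G (Jstd v) u.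
Proof. by rewrite -G_J JstdK innerNl G_sym. Qed.

Lemma inner_J_self (u : Cspace R n) : inner G (Jstd u) u = 0.
Proof. by have := inner_J_skew u u; lra. Qed.

(** These are 2k linear conditions on a real space of dimension 2n. The case k = 1 is where n >= 2
    enters the theorem; the general case drives the construction of unitary bases. *)
Lemma orthogonal_vector (k : nat) (e : 'I_k -> Cspace R n) : (k < n)%N ->
  exists2 v : Cspace R n, v != 0 &
    forall i, inner G v (e i) = 0 /\ inner G v (Jstd (e i)) = 0.
Proof.
move=> kn.
pose E (i : 'I_(k + k)) := match fintype.split i with inl i => e i | inr i => Jstd (e i) end.
pose C : 'M[R]_(n + n, k + k) := \matrix_(a, i) (G *m (E i)^T) a 0.
have kn2 : (k + k < n + n)%N by rewrite -addnS leq_add// ltnW.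
have [v v0 vC] := kernel_vector C kn2; exists v => //.
have H i : inner G v (E i) = 0.
  have : (v *m C) 0 i = 0 by rewrite vC mxE.
  rewrite /inner -mulmxA => <-; rewrite [LHS]mxE [RHS]mxE.
  by apply: eq_bigr => a _; rewrite [C a i]mxE.
move=> i; split.
  by have := H (unsplit (inl i)); rewrite /E unsplitK.
by have := H (unsplit (inr i)); rewrite /E unsplitK.
Qed.

Hypothesis G_pos : forall u, u != 0 -> 0 < inner G u u.

(** Gram-Schmidt without projections: the next vector is taken orthogonal to all e i and J e i, then
    normalised. Indexing by [nat] spares a change of type when the family is extended. *)
Lemma unitary_vectors k : (k <= n)%N ->
  exists e : nat -> Cspace R n, forall i j, (i < k)%N -> (j < k)%N ->
    inner G (e i) (e j) = (i == j)%:R /\ inner G (Jstd (e i)) (e j) = 0.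
Proof.
elim: k => [_|k IH kn]; first by exists (fun=> 0).
have [e He] := IH (ltnW kn).
have [v v0 Hv] := orthogonal_vector (fun i : 'I_k => e i) kn.
pose s := Num.sqrt (inner G v v).
have s0 : 0 < s by rewrite sqrtr_gt0 G_pos.
pose w := s^-1 *: v.
have ww : inner G w w = 1.
  rewrite innerZl innerZr mulrA -expr2 exprVn sqr_sqrtr; last exact/ltW/G_pos.
  by rewrite mulVf// gt_eqF// G_pos.
have we i : (i < k)%N -> inner G w (e i) = 0 /\ inner G w (Jstd (e i)) = 0.
  by move=> ik; have [] := Hv (Ordinal ik); rewrite !innerZl => -> ->; rewrite mulr0.
exists (fun i => if (i < k)%N then e i else w) => i j.
have last_index a : (a < k.+1)%N -> (k <= a)%N -> a = k.
  by rewrite ltnS => ? ?; apply/eqP; rewrite eqn_leq; apply/andP.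
move=> /last_index ik /last_index jk.
have [ik'|/ik Ei] := ltnP i k; have [jk'|/jk Ej] := ltnP j k.
- exact: He.
- have [w1 w2] := we i ik'; rewrite Ej (ltn_eqF ik') G_sym w1 G_sym w2.
  by split.
- have [w1 w2] := we j jk'; rewrite Ei (gtn_eqF jk') w1 inner_J_skew G_sym w2 oppr0.
  by split.
- by rewrite Ei Ej eqxx ww inner_J_self.
Qed.

(** The rows of P are a unitary basis followed by its image under J, so that v |-> v *m P is a
    complex linear isometry from the flat metric to G. It turns the metric at one point into the
    standard one. *)
Lemma unitary_frame : exists P : 'M[R]_(n + n),
  P *m G *m P^T = 1%:M /\ forall v : Cspace R n, Jstd v *m P = Jstd (v *m P).
Proof.
have [e He] := unitary_vectors (leqnn n).
pose E : 'M[R]_(n, n + n) := \matrix_(i < n) e i.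
pose F : 'M[R]_(n, n + n) := \matrix_(i < n) Jstd (e i).
have rE i : row i E = e i by rewrite rowK.
have rF i : row i F = Jstd (e i) by rewrite rowK.
have JE (x : 'rV[R]_n) : Jstd (x *m E) = x *m F.
  rewrite !mulmx_sum_row linear_sum; apply: eq_bigr => i _.
  by rewrite rE rF linearZ.
have JF (x : 'rV[R]_n) : Jstd (x *m F) = - (x *m E).
  by rewrite -JE JstdK.
exists (col_mx E F); split.
  apply/matrixP => i j.
  have -> : (col_mx E F *m G *m (col_mx E F)^T) i j =
      inner G (row i (col_mx E F)) (row j (col_mx E F)).
    rewrite /inner -row_mul -[X in _ *m X]trmxK; rewrite tr_row trmxK.
    by rewrite !mxE; apply: eq_bigr => a _; rewrite !mxE.
  rewrite -(fintype.splitK i) -(fintype.splitK j) mxE.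
  have row1 (k : 'I_n) : row (lshift n k) (col_mx E F) = e k.
    by rewrite rowKu rE.
  have row2 (k : 'I_n) : row (rshift n k) (col_mx E F) = Jstd (e k).
    by rewrite rowKd rF.
  case: (fintype.split i) => a; case: (fintype.split j) => b /=;
    rewrite ?row1 ?row2; have [h1 h2] := He a b (ltn_ord a) (ltn_ord b).
  - by rewrite h1 (inj_eq (@lshift_inj _ _)).
  - by rewrite G_sym inner_J_skew h2 oppr0 eq_lrshift.
  - by rewrite h2 eq_rlshift.
  - by rewrite G_J h1 (inj_eq (@rshift_inj _ _)).
move=> v; have -> : Jstd v = row_mx (- rsubmx v) (lsubmx v) by [].
rewrite -[v in RHS]hsubmxK !mul_row_col [RHS]linearD/= JE JF.
by rewrite mulNmx addrC.
Qed.

End Hermitian.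
(** * Conformal factors are constant *)

(** Closedness of P is asked as a transfer from nearby points z back to x, the form in which
    distance estimates provide it. *)
Lemma connected_ind (X : topologicalType) (P : set X) (x0 : X) :
  connected [set: X] -> P x0 -> (forall x, P x -> \forall z \near x, P z) ->
  (forall x, (\forall z \near x, P z -> P x)) -> forall x, P x.
Proof.
move=> cX Px0 Po Pc x.
have oP : open P by rewrite openE => y /Po.
have cP : closed P.
  rewrite -openC openE => y /= nPy.
  by apply: filterS (Pc y) => z + Pz; move=> /(_ Pz).
suff -> : P = [set: X] by [].
apply: cX; first by exists x0.
- by exists P => //; rewrite setTI.
- by exists P => //; rewrite setTI.
Qed.

Section Charts.
Variables (R : realType) (n : nat) (X : topologicalType) (A : complex_atlas R n X).

Lemma param_dom (i : idx A) p : (chart i @` dom i) p ->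
  dom i (param i p) /\ chart i (param i p) = p.
Proof. by move=> [x xi <-]; rewrite chartK. Qed.

Lemma chart_imageP (i : idx A) (O : set X) p :
  (chart i @` (dom i `&` O)) p <-> (chart i @` dom i) p /\ O (param i p).
Proof.
split=> [[x [xi Ox] <-]|[/param_dom[d E] Op]]; last by exists (param i p).
by split; [exists x|rewrite chartK].
Qed.

Lemma nbhs_dom (i : idx A) x : dom i x -> nbhs x (dom i).
Proof. by move=> xi; exact: open_nbhs_nbhs (conj (dom_open i) xi). Qed.

Lemma nbhs_chart_image (i : idx A) x (O : set X) : dom i x -> nbhs x O ->
  nbhs (chart i x) (chart i @` (dom i `&` O)).
Proof.
move=> xi xO; have Ix : (chart i @` dom i) (chart i x) by exists x.
have N1 := open_nbhs_nbhs (conj (@img_open _ _ _ A i) Ix).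
have N2 : \forall q \near chart i x, O (param i q).
  by apply: (param_continuous Ix); rewrite chartK.
by apply: filterS2 N1 N2 => q h1 h2; apply/chart_imageP.
Qed.

Lemma chart_image_open (i : idx A) (O : set X) : open O ->
  open (chart i @` (dom i `&` O)).
Proof.
move=> oO; rewrite openE => p /= [x [xi Ox] <-].
by apply: nbhs_chart_image => //; exact: open_nbhs_nbhs.
Qed.

Lemma nbhs_ball_chart (i : idx A) x (O : set X) : dom i x -> nbhs x O ->
  exists2 r : R, 0 < r & ball (chart i x) r `<=` chart i @` (dom i `&` O).
Proof. by move=> xi /(nbhs_chart_image xi)/nbhs_ballP[r]; exists r. Qed.

Lemma chart_ball (i : idx A) x (r : R) : dom i x -> 0 < r ->
  nbhs x [set z | dom i z /\ ball (chart i x) r (chart i z)].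
Proof.
move=> xi r0; apply: filterI; first exact: nbhs_dom.
by apply: (chart_continuous xi); apply: nbhsx_ballx.
Qed.

End Charts.

Section Constancy.
Variables (R : realType) (n : nat) (X : topologicalType) (A : complex_atlas R n X)
  (g : kaehler_metric A).

(** Once the derivative falls on the Gram matrix alone, the vectors are mere parameters, and values
    such as 'D_u f p can be inserted for them. *)
Lemma kaehler_cyclic (i : idx A) p : (chart i @` dom i) p -> forall u v w,
  inner ('D_u (gram g i) p) (Jstd v) w + inner ('D_v (gram g i) p) (Jstd w) u
  + inner ('D_w (gram g i) p) (Jstd u) v = 0.
Proof.
move=> ip u v w; have [x xi xp] := ip.
have D a b c : 'D_a (fun q => inner (gram g i q) (Jstd b) c) p =
    inner ('D_a (gram g i) p) (Jstd b) c.
  have dG : derivable (gram g i) p a.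
    by apply: diff_derivable; exact: smooth_on_differentiable (gram_smooth g i) ip.
  have := inner_derive dG (derivable_cst (Jstd b) p a) (derivable_cst c p a).
  by rewrite !derive_cst inner0l inner0r !addr0 => -[].
by have := kaehler_closed g xi u v w; rewrite xp /= !D.
Qed.

(** The arithmetic of [factor_cyclic]: the x are the terms in dc, the k and l those of d omega at
    the source and at the target, and the s and t, which cancel in pairs, contain second derivatives
    of the map. *)
Lemma cyclic_sum (x1 x2 x3 k1 k2 k3 l1 l2 l3 s1 s2 s3 t1 t2 t3 d : R) :
  x1 + d * k1 = l1 + s1 + t1 -> x2 + d * k2 = l2 + s2 + t2 ->
  x3 + d * k3 = l3 + s3 + t3 -> k1 + k2 + k3 = 0 -> l1 + l2 + l3 = 0 ->
  s1 + t2 = 0 -> t1 + s3 = 0 -> s2 + t3 = 0 -> x1 + x2 + x3 = 0.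
Proof.
move=> H1 H2 H3 H4 H5 H6 H7 H8.
have : d * (k1 + k2 + k3) = 0 by rewrite H4 mulr0.
by rewrite !mulrDr; lra.
Qed.

(* The closed form a^* omega equals c omega, and omega is closed, so
   dc /\ omega = 0. *)
Lemma factor_cyclic (a : X -> X) (c : X -> R) (i j : idx A) x :
  holomorphic_map A A a -> smooth_function A c -> pullback_eq g g a c ->
  dom i x -> dom j (a x) -> forall u v w,
  let p := chart i x in let C := c \o param i in
  'D_u C p * inner (gram g i p) (Jstd v) w
  + 'D_v C p * inner (gram g i p) (Jstd w) u
  + 'D_w C p * inner (gram g i p) (Jstd u) v = 0.
Proof.
move=> [ca ha] sc pa xi jax u v w p C.
pose U := chart i @` (dom i `&` a @^-1` dom j).
pose f := local_map (A := A) (B := A) i j a.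
have oU : open U by apply: chart_image_open; apply: open_comp (dom_open j) => z _; exact: ca.
have [sf cr] : holomorphic_on U f by exact: ha.
have Up : U p by exists x.
have ip : (chart i @` dom i) p by exists x.
have fp : f p = chart j (a x) by rewrite /f /local_map /= chartK.
have jfp : (chart j @` dom j) (f p) by rewrite fp; exists (a x).
have df q : U q -> differentiable f q by exact: smooth_on_differentiable.
have d2f b q : U q -> differentiable ('D_b f) q.
  by apply: smooth_on_differentiable; exact: smooth_on_derive.
have dG : differentiable (gram g j) (f p) := smooth_on_differentiable (gram_smooth g j) jfp.
have dGi : differentiable (gram g i) p := smooth_on_differentiable (gram_smooth g i) ip.
have dC : differentiable C p := smooth_on_differentiable (sc i) ip.
pose T b := 'D_b f p.
have TE b : 'd f p b = T b := esym (deriveE b (df p Up)).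
have pull q : U q -> forall b e,
    inner (gram g j (f q)) (Jstd ('D_b f q)) ('D_e f q) =
    C q * inner (gram g i q) (Jstd b) e.
  move=> Uq b e; have [z [zi jaz] zq] := Uq.
  have := pa i j z zi jaz (Jstd b) e; rewrite /= -/f zq.
  rewrite (cr q Uq) -(deriveE b (df q Uq)) -(deriveE e (df q Uq)).
  by rewrite -zq /C /f /local_map /= chartK.
have skew y z := @inner_J_skew R n (gram g j (f p))
  (fun u v => ltac:(rewrite fp; exact: (gram_sym g jax u v)))
  (fun u v => ltac:(rewrite fp; exact: (gram_hermitian g jax u v))) y z.
(* The derivative of [pull] along b, computed on both sides. *)
have main b e k : 'D_b C p * inner (gram g i p) (Jstd e) k
   + C p * inner ('D_b (gram g i) p) (Jstd e) k =
   inner ('D_(T b) (gram g j) (f p)) (Jstd (T e)) (T k)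
   + inner (gram g j (f p)) (Jstd ('D_b ('D_e f) p)) (T k)
   + inner (gram g j (f p)) (Jstd (T e)) ('D_b ('D_k f) p).
  have dJ q : U q -> differentiable (fun q => Jstd ('D_e f q)) q /\
      'd (fun q => Jstd ('D_e f q)) q = @Jstd R n \o 'd ('D_e f) q :> (_ -> _).
    move=> Uq; have cJ : continuous (@Jstd R n) by exact: linear_rV_continuous.
    have [] := diff_affine_comp 0 cJ (d2f e q Uq).
    by under [fun q => _ + 0]eq_fun do rewrite addr0.
  have [dJp EJp] := dJ p Up.
  have dGf : differentiable (gram g j \o f) p by exact: differentiable_comp (df p Up) dG.
  have L1 := inner_derive (diff_derivable (v := b) dGf) (diff_derivable (v := b) dJp)
    (diff_derivable (v := b) (d2f k p Up)).
  have L2 := inner_derive (diff_derivable (v := b) dGi) (derivable_cst (Jstd e) p b)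
    (derivable_cst k p b).
  have L3 := is_deriveM (derivableP (diff_derivable (v := b) dC)) L2.
  have E1 := @derive_val _ _ _ _ _ _ _ L1.
  have E3 := @derive_val _ _ _ _ _ _ _ L3.
  move: E1 E3.
  have EG : 'D_b (gram g j \o f) p = 'D_(T b) (gram g j) (f p).
    apply: (etrans (deriveE b dGf)).
    apply: (etrans (congr1 (fun h => h b) (diff_comp (df p Up) dG))).
    by apply: (etrans (congr1 _ (TE b))); apply: (esym (deriveE _ dG)).
  have EJ : 'D_b (fun q => Jstd ('D_e f q)) p = Jstd ('D_b ('D_e f) p).
    apply: (etrans (deriveE b dJp)); apply: (etrans (congr1 (fun h => h b) EJp)).
    by apply: (congr1 _ (esym (deriveE b (d2f e p Up)))).
  rewrite EG EJ.
  rewrite !derive_cst inner0r inner0l !addr0 /GRing.scale/= => <-.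
  have -> : 'D_b (fun q => inner ((gram g j \o f) q) (Jstd ('D_e f q)) ('D_k f q)) p =
      'D_b (C * (fun q => inner (gram g i q) (cst (Jstd e) q) (cst k q))) p.
    apply: near_eq_derive.
    by apply: filterS (open_nbhs_nbhs (conj oU Up)) => q Uq; rewrite /= pull.
  by move=> ->; rewrite mulrC addrC [X in _ + X]mulrC.
have K1 := kaehler_cyclic ip u v w.
have K2 := kaehler_cyclic jfp (T u) (T v) (T w).
have sw b e : 'D_b ('D_e f) p = 'D_e ('D_b f) p := smooth_schwarz b e oU sf Up.
(* Second derivatives are symmetric and omega is skew, so in the cyclic sum they cancel in pairs. *)
have S b e k : inner (gram g j (f p)) (Jstd ('D_b ('D_e f) p)) (T k)
    + inner (gram g j (f p)) (Jstd (T k)) ('D_e ('D_b f) p) = 0.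
  apply: (etrans (congr1 (fun y => _ + inner _ (Jstd (T k)) y) (sw e b))).
  by apply/eqP; rewrite addr_eq0; apply/eqP; exact: skew.
have S' b e k := etrans (addrC _ _) (S b e k).
exact: (cyclic_sum
  (main u v w) (main v w u) (main w u v) K1 K2 (S u v w) (S' w u v) (S v w u)).
Qed.

(* Given u, choose v orthogonal to u and Ju and w = Jv: in the cyclic identity
   only the term du(c) omega(v, Jv) survives. *)
Lemma factor_derive0 (a : X -> X) (c : X -> R) (i : idx A) x : (2 <= n)%N ->
  holomorphic_map A A a -> smooth_function A c -> pullback_eq g g a c ->
  dom i x -> forall u, 'D_u (c \o param i) (chart i x) = 0.
Proof.
move=> n2 ha sc pa xi u.
have [j jax] := dom_cover A (a x).
pose G := gram g i (chart i x).
have n1 : (1 < n)%N by [].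
have [v v0 Hv] := orthogonal_vector (gram g i (chart i x)) (fun _ : 'I_1 => u) n1.
have [vu vJu] := Hv 0.
have GJ := gram_hermitian g xi; have Gs := gram_sym g xi.
have := factor_cyclic ha sc pa xi jax u v (Jstd v); rewrite /=.
have -> : inner (gram g i (chart i x)) (Jstd (Jstd v)) u = 0.
  by rewrite JstdK innerNl vu oppr0.
have -> : inner (gram g i (chart i x)) (Jstd u) v = 0 by rewrite Gs vJu.
rewrite !mulr0 !addr0 GJ => /eqP; rewrite mulf_eq0 => /orP[/eqP//|].
by rewrite gt_eqF//; exact: gram_pos.
Qed.

Lemma factor_constant (a : X -> X) (c : X -> R) : (2 <= n)%N ->
  connected [set: X] ->
  holomorphic_map A A a -> smooth_function A c -> pullback_eq g g a c ->
  forall x y, c x = c y.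
Proof.
move=> n2 cX ha sc pa x y.
have loc z : \forall w \near z, c w = c z.
  have [i zi] := dom_cover A z.
  have [r r0 Br] := nbhs_ball_chart zi (@filterT _ (nbhs z) _).
  apply: filterS (chart_ball zi r0) => w [wi Bw].
  pose h := chart i w - chart i z.
  have B s : s \in `[0, 1] -> ball (chart i z) r (chart i z + s *: h).
    rewrite in_itv/= => /andP[s0 s1]; move: Bw; rewrite -!ball_normE /ball_ /=.
    rewrite opprD addrA subrr sub0r normrN normrZ ger0_norm// distrC.
    by apply: le_lt_trans; exact: ler_piMl.
  have [|s sI] := @MVT_cc R (fun s => (c \o param i) (chart i z + s *: h))
      (fun s => 0) 0 1 ltr01.
    move=> s sI; have [q [qi _] Eq] := Br _ (B s sI).
    have := factor_derive0 n2 ha sc pa qi h; rewrite Eq => <-.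
    apply: is_derive_line; apply: diff_derivable.
    by apply: (smooth_on_differentiable (sc i)); rewrite -Eq; exists q.
  rewrite mul0r scale1r scale0r addr0 /h (addrC (chart i z)) subrK /= !chartK//.
  by move=> /eqP; rewrite subr_eq0 => /eqP.
apply: (@connected_ind X [set w | c x = c w] x cX) => // [z Ez|z].
  by apply: filterS (loc z) => w Ew /=; rewrite Ew.
by apply: filterS (loc z) => w Ew /=; rewrite Ew.
Qed.

End Constancy.
(** * The Riemannian distance *)

(** Young's inequality, from the positivity of G on e *: u - v, divided by e. *)
Lemma inner_add_le (R : realType) (m : nat) (G : 'M[R]_m) (u v : 'rV[R]_m) (e : R) :
  (forall u v, inner G u v = inner G v u) -> (forall u, u != 0 -> 0 < inner G u u) ->
  0 < e ->
  inner G (u + v) (u + v) <= (1 + e) * inner G u u + (1 + e^-1) * inner G v v.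
Proof.
move=> Gs Gp e0.
have H : 0 <= inner G (e *: u - v) (e *: u - v).
  by have [->|/Gp/ltW//] := eqVneq (e *: u - v) 0; rewrite inner0l.
move: H; rewrite !innerDl !innerDr !innerNl !innerNr !innerZl !innerZr opprK (Gs v u).
set a := inner G u u; set b := inner G u v; set c := inner G v v => H.
have : 0 <= e^-1 * (e * (e * a) + - (e * b) + (- (e * b) + c)).
  by rewrite mulr_ge0// invr_ge0 ltW.
have -> : e^-1 * (e * (e * a) + - (e * b) + (- (e * b) + c)) = e * a - 2 * b + e^-1 * c.
  by field; rewrite gt_eqF.
by rewrite !mulrDl; lra.
Qed.

(** Each s controls only its own neighbourhood, so one argues by continuous induction: the supremum
    b of the set S of good parameters lies in S, and b < 1 would allow a further step. *)
Lemma pointwise_lipschitz (R : realType) (phi : R -> R) (K : R) : 0 <= K ->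
  (forall s : R, s \in `[0, 1] -> \forall t \near s, t \in `[0, 1] ->
     `|phi t - phi s| <= K * `|t - s|) -> `|phi 1 - phi 0| <= K.
Proof.
move=> K0 H.
have I0 : (0 : R) \in `[0, 1] by rewrite in_itv/= lexx ler01.
pose S := [set s : R | s \in `[0, 1] /\ `|phi s - phi 0| <= K * s].
have S0 : S 0 by split => //; rewrite subrr normr0 mulr0.
have Sub : has_ubound S by exists 1 => s [+ _]; rewrite in_itv/= => /andP[].
have hS : has_sup S by split => //; exists 0.
pose b := sup S.
have b0 : 0 <= b by apply: (ub_le_sup Sub).
have b1 : b <= 1 by apply: ge_sup; [exists 0|move=> s [+ _]; rewrite in_itv/= => /andP[]].
have bI : b \in `[0, 1] by rewrite in_itv/= b0 b1.
have /nbhs_ballP[d /= d0 Hd] := H b bI.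
have Sb : S b.
  split=> //; have [s Ss bs] := sup_adherent d0 hS.
  have sb : s <= b by exact: (ub_le_sup Sub).
  have [sI Es] := Ss.
  have := Hd s; rewrite -ball_normE /ball_ /= ger0_norm ?subr_ge0// => /(_ _ sI).
  have sd : b - s < d by rewrite -/b in bs; lra.
  rewrite (distrC s b) (ger0_norm (_ : 0 <= b - s)) ?subr_ge0// => /(_ sd) E.
  rewrite -(subrKA (phi s)); apply: le_trans (ler_normD _ _) _.
  by rewrite (distrC (phi b)); lra.
suff -> : 1 = b by case: Sb => _; rewrite -[leRHS]/(K * b) => /le_trans; apply; rewrite ler_piMr.
apply/eqP; rewrite eq_le b1 andbT leNgt; apply/negP => b1'.
pose t := Num.min 1 (b + d / 2).
have bt : b < t by rewrite lt_min b1' ltrDl divr_gt0.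
have t1 : t <= 1 by rewrite ge_min lexx.
have tI : t \in `[0, 1] by rewrite in_itv/= t1 andbT (le_trans b0 (ltW bt)).
have tbd : t <= b + d / 2 by rewrite ge_min lexx orbT.
have := Hd t; rewrite -ball_normE /ball_ /= distrC gtr0_norm ?subr_gt0// => /(_ _ tI).
have td : t - b < d by lra.
move=> /(_ td) E.
have : S t.
  split=> //; rewrite -(subrKA (phi b)); apply: le_trans (ler_normD _ _) _.
  by case: Sb => _; lra.
by move=> /(ub_le_sup Sub); rewrite leNgt bt.
Qed.

Section Distance.
Variables (R : realType) (n : nat) (X : topologicalType) (A : complex_atlas R n X)
  (g : kaehler_metric A).

Definition norm2 (i : idx A) (x : X) (u : Cspace R n) :=
  inner (gram g i (chart i x)) u u.

(* Functions whose pointwise Lipschitz constant with respect to g is at most 1. *)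
Definition short (f : X -> R) := forall x, exists2 i : idx A, dom i x &
  forall e, 0 < e -> \forall z \near x,
    (f z - f x) ^+ 2 <= (1 + e) * norm2 i x (chart i z - chart i x).

(* dist_le x y r says that the Riemannian distance of x and y is at most r,
   the distance being the supremum of f x - f y over short functions f. *)
Definition dist_le (x y : X) (r : R) := forall f, short f -> `|f x - f y| <= r.

Lemma dist_le_refl x r : 0 <= r -> dist_le x x r.
Proof. by move=> r0 f _; rewrite subrr normr0. Qed.

Lemma dist_le_sym x y r : dist_le x y r -> dist_le y x r.
Proof. by move=> xy f /xy; rewrite distrC. Qed.

Lemma dist_le_trans x y z r s : dist_le x y r -> dist_le y z s -> dist_le x z (r + s).
Proof.
move=> xy yz f sf; rewrite -(subrKA (f y)).
apply: le_trans (ler_normD _ _) _; apply: lerD; [exact: xy|exact: yz].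
Qed.

Lemma dist_leW x y r s : r <= s -> dist_le x y r -> dist_le x y s.
Proof. by move=> rs xy f /xy /le_trans; apply. Qed.

Lemma norm2_ge0 i x u : dom i x -> 0 <= norm2 i x u.
Proof.
move=> xi; have [->|/(gram_pos g xi)/ltW//] := eqVneq u 0.
by rewrite /norm2 inner0l.
Qed.

Lemma norm2_upper i x : exists2 M : R, 0 < M & forall u, norm2 i x u <= M * `|u| ^+ 2.
Proof.
have [C C0 HC] := inner_bound R (n + n).
exists (C * `|gram g i (chart i x)| + 1).
  by rewrite ltr_wpDl// mulr_ge0// ltW.
move=> u; apply: le_trans (ler_norm _) _; apply: le_trans (HC _ _ _) _.
by rewrite -mulrA -expr2; apply: ler_wpM2r; rewrite ?sqr_ge0// lerDl.
Qed.

(** To first order a moves chart increments by its differential, which scales the squared norm by l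
    ^+ 2; [inner_add_le] absorbs the remainder into the factor 1 + e. For a = id this frees [short]
    from its choice of chart. *)
Lemma short_pullback (a : X -> X) (l : R) f : holomorphic_map A A a ->
  0 < l -> pullback_eq g g a (fun=> l ^+ 2) -> short f ->
  forall x i, dom i x -> forall e, 0 < e -> \forall z \near x,
    (f (a z) - f (a x)) ^+ 2 <=
    (1 + e) * (l ^+ 2 * norm2 i x (chart i z - chart i x)).
Proof.
move=> [ca ha] l0 pa sf x i xi e e0.
have [j jax Hj] := sf (a x).
pose F := local_map (A := A) (B := A) i j a; pose p := chart i x.
have oU : open (chart i @` (dom i `&` a @^-1` dom j)).
  by apply: chart_image_open; apply: open_comp (dom_open j) => z _; exact: ca.
have Up : (chart i @` (dom i `&` a @^-1` dom j)) p by exists x.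
have dF : differentiable F p := smooth_on_differentiable (ha i j).1 Up.
have [M M0 HM] := norm2_upper j (a x).
have [m m0 Hm] := inner_lower (@gram_pos _ _ _ _ g _ _ xi).
(* The error e is shared between the shortness of f at a x, the cross term and the remainder; since
   e1 <= 1, the product below is at most 1 + 5 * e1. *)
pose e1 := Num.min 1 (e / 5).
have e10 : 0 < e1 by rewrite lt_min ltr01 divr_gt0.
have e1e : (1 + e1) * (1 + 2 * e1) <= 1 + e.
  have : e1 <= 1 by rewrite ge_min lexx.
  have : e1 <= e / 5 by rewrite ge_min lexx orbT.
  by move: e10; nra.
have l20 : 0 < l ^+ 2 by rewrite exprn_gt0.
pose B := (1 + e1^-1) * M / m.
have B0 : 0 < B by rewrite divr_gt0// mulr_gt0// addr_gt0 ?invr_gt0.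
pose eta := Num.min 1 (e1 * l ^+ 2 / B).
have eta0 : 0 < eta by rewrite lt_min ltr01 divr_gt0// mulr_gt0.
have etaB : B * eta ^+ 2 <= e1 * l ^+ 2.
  have h1 : eta <= 1 by rewrite ge_min lexx.
  have : eta <= e1 * l ^+ 2 / B by rewrite ge_min lexx orbT.
  rewrite ler_pdivlMr// mulrC; apply: le_trans; rewrite ler_wpM2l ?(ltW B0)//.
  by rewrite expr2 ler_piMl// ltW.
have [d d0 Hd] := differentiable_eps dF eta0.
have N1 : \forall z \near x, (f (a z) - f (a x)) ^+ 2 <=
    (1 + e1) * norm2 j (a x) (chart j (a z) - chart j (a x)).
  exact: (ca x _ (Hj e1 e10)).
apply: filterS2 N1 (chart_ball xi d0) => z Hz [zi zd].
apply: le_trans Hz _.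
pose h := chart i z - p.
have hd : `|h| < d by move: zd; rewrite -ball_normE /ball_ /= distrC.
have := Hd h hd; rewrite {1}/h (addrC p) subrK.
have -> : F (chart i z) = chart j (a z) by rewrite /F /local_map /= chartK.
have -> : F p = chart j (a x) by rewrite /F /local_map /= chartK.
rewrite -/h; set rho := _ - _ - _ => rhoh.
have -> : chart j (a z) - chart j (a x) = 'd F p h + rho.
  by rewrite /rho [RHS]addrC subrK.
have := pa i j x xi jax h h; rewrite /= -/F -/p => Th.
have := inner_add_le ('d F p h) rho (gram_sym g jax) (@gram_pos _ _ _ _ g _ _ jax) e10.
rewrite Th -/(norm2 j (a x) _) -/(norm2 j (a x) rho) -/(norm2 i x h) => Hsum.
have rho2 : norm2 j (a x) rho <= M * (eta ^+ 2 * `|h| ^+ 2).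
  apply: le_trans (HM _) _; rewrite ler_wpM2l ?(ltW M0)// -exprMn.
  by rewrite lerXn2r// ?nnegrE ?mulr_ge0// ltW.
have h2 : `|h| ^+ 2 <= norm2 i x h / m by rewrite ler_pdivlMr// mulrC; exact: Hm.
have n0 : 0 <= norm2 i x h by exact: norm2_ge0.
have last_term : (1 + e1^-1) * norm2 j (a x) rho <= e1 * l ^+ 2 * norm2 i x h.
  apply: (@le_trans _ _ ((1 + e1^-1) * (M * (eta ^+ 2 * (norm2 i x h / m))))).
    rewrite ler_wpM2l ?addr_ge0 ?invr_ge0 ?(ltW e10)//.
    by apply: le_trans rho2 _; rewrite !ler_wpM2l ?sqr_ge0 ?(ltW M0).
  rewrite (_ : _ * _ = B * eta ^+ 2 * norm2 i x h); last by rewrite /B; ring.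
  exact: ler_wpM2r.
apply: (@le_trans _ _ ((1 + e1) * ((1 + 2 * e1) * (l ^+ 2 * norm2 i x h)))).
  rewrite ler_wpM2l ?addr_ge0 ?(ltW e10)//; apply: le_trans Hsum _.
  by move: last_term; lra.
by rewrite mulrA; apply: ler_wpM2r => //; rewrite mulr_ge0 ?(ltW l20).
Qed.

End Distance.
Lemma ball_segment (R : realType) (V : normedModType R) (c p q : V) (r s : R) :
  ball c r p -> ball c r q -> s \in `[0, 1] -> ball c r (p + s *: (q - p)).
Proof.
rewrite -!ball_normE /ball_ /= in_itv/= => pr qr /andP[s0 s1].
have -> : c - (p + s *: (q - p)) = (1 - s) *: (c - p) + s *: (c - q).
  rewrite scalerBl scale1r -[RHS]addrA [- _ + _]addrC -scalerBr.
  have -> : c - q - (c - p) = - (q - p) by rewrite !opprB addrC addrA subrK.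
  by rewrite scalerN opprD addrA.
apply: le_lt_trans (ler_normD _ _) _; rewrite !normrZ !ger0_norm ?subr_ge0//.
have h1 : (1 - s) * `|c - p| <= (1 - s) * Num.max `|c - p| `|c - q|.
  by rewrite ler_wpM2l ?subr_ge0// le_max lexx.
have h2 : s * `|c - q| <= s * Num.max `|c - p| `|c - q|.
  by rewrite ler_wpM2l// le_max lexx orbT.
have : Num.max `|c - p| `|c - q| < r by rewrite gt_max pr qr.
by lra.
Qed.

Lemma max0_lipschitz (R : realDomainType) (x y : R) :
  `|Num.max 0 x - Num.max 0 y| <= `|x - y|.
Proof.
case: (leP 0 x) => x0; case: (leP 0 y) => y0; rewrite ?subrr ?normr0 ?subr0 ?sub0r ?normrN//.
- by rewrite !ger0_norm ?subr_ge0; lra.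
- by rewrite ger0_norm// ler0_norm; lra.
Qed.

(** * Comparison of the distance with the norm in a chart *)

Section LocalEstimates.
Variables (R : realType) (n : nat) (X : topologicalType) (A : complex_atlas R n X)
  (g : kaehler_metric A).

Lemma holomorphic_map_id : holomorphic_map A A id.
Proof. by split=> [x|i j]; [exact: cvg_id|exact: transition_holomorphic]. Qed.

Lemma pullback_id : pullback_eq g g id (fun=> 1).
Proof. by move=> i j x xi xj u v T; rewrite mul1r; exact: gram_transition. Qed.

Lemma short_chart f : short g f -> forall x i, dom i x -> forall e, 0 < e ->
  \forall z \near x, (f z - f x) ^+ 2 <= (1 + e) * norm2 g i x (chart i z - chart i x).
Proof.
move=> sf x i xi e e0.
have p1 : pullback_eq g g id (fun=> 1 ^+ 2) by rewrite expr1n; exact: pullback_id.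
have := short_pullback holomorphic_map_id ltr01 p1 sf xi e0.
by apply: filterS => z; rewrite expr1n mul1r.
Qed.

(** By duality: if f is short, so is l^-1 times the composite of f with a. *)
Lemma dist_le_homothety (a : X -> X) (l : R) : holomorphic_map A A a ->
  0 < l -> pullback_eq g g a (fun=> l ^+ 2) ->
  forall x y r, dist_le g x y r -> dist_le g (a x) (a y) (l * r).
Proof.
move=> ha l0 pa x y r xy f sf.
have /xy : short g (fun z => l^-1 * f (a z)).
  move=> z; have [i zi] := dom_cover A z; exists i => // e e0.
  have := short_pullback ha l0 pa sf zi e0; apply: filterS => w.
  rewrite -mulrBr exprMn exprVn mulrCA ler_pdivrMl//.
  by rewrite exprn_gt0.
by rewrite -mulrBr normrM gtr0_norm ?invr_gt0// ler_pdivrMl.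
Qed.

Lemma metric_bounds i x : dom i x -> exists2 r : R, 0 < r &
  ball (chart i x) r `<=` chart i @` dom i /\
  exists c M : R, [/\ 0 < c, 0 < M & forall q, ball (chart i x) r q -> forall u,
    c * `|u| ^+ 2 <= inner (gram g i q) u u <= M * `|u| ^+ 2].
Proof.
move=> xi.
have [c c0 Hc] := inner_lower (@gram_pos _ _ _ _ g _ _ xi).
have [C C0 HC] := inner_bound R (n + n).
set G0 := gram g i (chart i x) in Hc.
have Ix : (chart i @` dom i) (chart i x) by exists x.
have e0 : 0 < c / (2 * C) by rewrite divr_gt0// mulr_gt0.
have cG := smooth_on_continuous (gram_smooth g i) Ix.
have /cvgrPdist_le/(_ _ e0) N1 := cG.
have N2 := open_nbhs_nbhs (conj (@img_open _ _ _ A i) Ix).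
have [r /= r0 Hr] := iffLR (nbhs_ballP _ _) (filterI N1 N2).
exists r => //; split; first by move=> q /Hr[].
exists (c / 2), (C * `|G0| + c / 2); split=> [||q /Hr[Gq _] u].
- by rewrite divr_gt0.
- by rewrite ltr_wpDl ?divr_gt0// mulr_ge0// ltW.
have E : inner G0 u u - inner (gram g i q) u u = inner (G0 - gram g i q) u u.
  by rewrite /inner mulmxBr mulmxBl !mxE.
have H1 : `|inner (G0 - gram g i q) u u| <= c / 2 * `|u| ^+ 2.
  apply: le_trans (HC _ _ _) _; rewrite -mulrA -expr2; apply: ler_wpM2r; first exact: sqr_ge0.
  have -> : c / 2 = C * (c / (2 * C)) by field; rewrite gt_eqF.
  by rewrite ler_wpM2l ?(ltW C0).
have H2 := Hc u.
have H3 : `|inner G0 u u| <= C * `|G0| * `|u| ^+ 2.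
  by apply: le_trans (HC _ _ _) _; rewrite -mulrA -expr2.
move: H1 H3; rewrite -E !ler_norml => /andP[h1 h2] /andP[h3 h4].
by rewrite mulrDl; apply/andP; split; lra.
Qed.

(** A short function is followed along the chart segment from p to q. Shortness is used with e = 1,
    which doubles M, and 2 * M + 1 is a bound for the square root of 2 * M. *)
Lemma dist_le_upper (i : idx A) x : dom i x -> exists2 r : R, 0 < r &
  ball (chart i x) r `<=` chart i @` dom i /\
  exists2 M : R, 0 < M & forall p q : Cspace R n, ball (chart i x) r p -> ball (chart i x) r q ->
    dist_le g (param i p) (param i q) (M * `|p - q|).
Proof.
move=> xi; have [r r0 [rI [c [M [c0 M0 HM]]]]] := metric_bounds xi.
exists r => //; split=> //; exists (2 * M + 1).
  by rewrite addr_gt0// mulr_gt0.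
move=> p q pr qr f sf.
pose h := q - p; pose phi s := f (param i (p + s *: h)).
have B s : s \in `[0, 1] -> ball (chart i x) r (p + s *: h) by exact: ball_segment.
have := @pointwise_lipschitz _ phi ((2 * M + 1) * `|h|).
rewrite /phi scale1r scale0r addr0 /h [p + _]addrC subrK !(distrC (f (param i q))) (distrC q).
apply; first by rewrite mulr_ge0// addr_ge0// mulr_ge0// ltW.
move=> s sI; have Bs := B s sI; have Is := rI _ Bs.
have [di Ei] := param_dom Is.
have N := short_chart sf di ltr01.
have cl : param i (p + t *: h) @[t --> s] --> param i (p + s *: h).
  have cs : p + t *: h @[t --> s] --> p + s *: h.
    by apply: cvgD; [exact: cvg_cst|apply: cvgZr_tmp; exact: cvg_id].
  exact: (cvg_comp _ _ cs (param_continuous Is)).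
have Nt : \forall t \near s, _ := cl _ N; apply: filterS Nt => t Ht tI.
have [dt Et] := param_dom (rI _ (B t tI)).
move: Ht; rewrite /= /norm2 Ei Et.
have -> : p + t *: h - (p + s *: h) = (t - s) *: h.
  by rewrite opprD addrACA subrr add0r scalerBl.
move=> Ht; have /andP[_ H2] := HM _ Bs ((t - s) *: h).
rewrite -[leLHS]ger0_norm// -ler_sqr ?nnegrE//; last first.
  by rewrite !mulr_ge0// addr_ge0// mulr_ge0// ltW.
rewrite ger0_norm// real_normK ?num_real//.
apply: le_trans Ht _.
apply: (@le_trans _ _ (2 * (M * `|(t - s) *: h| ^+ 2))); first by lra.
rewrite normrZ !exprMn; set T := _ ^+ 2; set H := `|h| ^+ 2.
have TH : 0 <= T * H by rewrite mulr_ge0 ?sqr_ge0.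
have : 2 * M * (T * H) <= (2 * M + 1) ^+ 2 * (T * H).
  by apply: ler_wpM2r => //; nra.
by rewrite (distrC p) -/h -/H; lra.
Qed.

Hypothesis X_hausdorff : hausdorff_space X.

(** One test function is enough. It takes the value K * s at p and 0 off a chart ball, so a smaller
    distance forces w into the chart. In a Hausdorff space the compact support is closed, and
    therefore the extension by 0 is short. Radius r / 4 keeps that support inside the ball of
    [metric_bounds]. *)
Lemma dist_le_lower (i : idx A) x : dom i x -> exists2 r : R, 0 < r &
  ball (chart i x) r `<=` chart i @` dom i /\
  exists2 K : R, 0 < K & forall p : Cspace R n, ball (chart i x) r p -> forall w t,
    dist_le g (param i p) w t -> t < K * r ->
    dom i w /\ K * `|chart i w - p| <= t.
Proof.
move=> xi; have [r r0 [rI [c [M [c0 M0 HM]]]]] := metric_bounds xi.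
exists (r / 4); first by rewrite divr_gt0.
split; first by apply: subset_trans rI; apply: le_ball; lra.
(* This choice gives K ^+ 2 <= c without a square root. *)
pose K := Num.min 1 c.
have K0 : 0 < K by rewrite lt_min ltr01.
have K2 : K ^+ 2 <= c.
  have : K <= 1 by rewrite ge_min lexx.
  have : K <= c by rewrite ge_min lexx orbT.
  by nra.
exists K => // p pr w t pw tK.
pose O := [set z | dom i z /\ ball (chart i x) r (chart i z)].
have oO z : O z -> nbhs z O.
  move=> [zi zb]; apply: filterI; first exact: nbhs_dom.
  apply: (chart_continuous zi); apply: open_nbhs_nbhs; split=> //; exact: ball_open.
pose s := r / 4.
pose D := [set q | `|p - q| <= s].
have Dr q : D q -> ball (chart i x) r q.
  rewrite /D /= => Dq; move: pr; rewrite -!ball_normE /ball_ /= => pr.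
  rewrite -(subrKA p); apply: le_lt_trans (ler_normD _ _) _.
  by rewrite /s in Dq; lra.
have cD : closed (param i @` D).
  apply: compact_closed => //; apply: continuous_compact; last exact: closed_ball_compact.
  apply: continuous_in_subspaceT => q; rewrite inE => /Dr/rI Iq.
  exact: param_continuous.
(* The cone of slope K and radius s around param i p is a short function. *)
pose m z : R := K * Num.max 0 (s - `|p - chart i z|).
pose f z : R := if `[< O z >] then m z else 0.
have fO z : O z -> f z = m z by rewrite /f => /asboolP ->.
have fD z : ~ (param i @` D) z -> f z = 0.
  rewrite /f; case: asboolP => // -[zi zb] nD; rewrite /m.
  have : s < `|p - chart i z|.
    rewrite ltNge; apply/negP => h; apply: nD; exists (chart i z) => //.
    exact: chartK.
  by move=> h; rewrite max_l ?mulr0// subr_le0 ltW.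
have sf : short g f.
  move=> z; have [zO|zO] := pselect (O z).
    exists i; first by case: zO.
    move=> e e0; apply: filterS (oO z zO) => y yO.
    rewrite !fO// /m -mulrBr exprMn.
    have zi := zO.1.
    have /andP[H _] := HM _ zO.2 (chart i y - chart i z).
    apply: (@le_trans _ _ (c * `|chart i y - chart i z| ^+ 2)); last first.
      apply: le_trans H _; rewrite ler_peMl//; first exact: norm2_ge0.
      by rewrite lerDl ltW.
    apply: (@le_trans _ _ (K ^+ 2 * `|chart i y - chart i z| ^+ 2)); last first.
      by rewrite ler_wpM2r ?sqr_ge0.
    rewrite ler_wpM2l ?sqr_ge0// -real_normK ?num_real//.
    rewrite ler_sqr ?nnegrE//.
    have : `| `|p - chart i z| - `|p - chart i y| | <= `|chart i y - chart i z|.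
      by apply: le_trans (ler_dist_dist _ _) _; rewrite opprB addrC addrA subrK.
    apply: le_trans; apply: le_trans (max0_lipschitz _ _) _.
    by rewrite [leLHS](_ : _ = `| `|p - chart i z| - `|p - chart i y| |)//; congr (`|_|); ring.
  have [j zj] := dom_cover A z; exists j => // e e0.
  have zD : ~ (param i @` D) z.
    move=> [q Dq qz]; apply: zO; have [di Ei] := param_dom (rI _ (Dr _ Dq)).
    by rewrite -qz; split; rewrite ?Ei//; exact: Dr.
  have nD : nbhs z (~` (param i @` D)).
    by apply: open_nbhs_nbhs; split => //; exact: closed_openC.
  apply: filterS nD => y yD; rewrite !fD// subrr expr0n/=.
  by rewrite mulr_ge0 ?norm2_ge0// addr_ge0// ltW.
have pO : O (param i p).
  have pr' : ball (chart i x) r p by apply: le_ball pr; lra.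
  by have [di Ei] := param_dom (rI _ pr'); split; rewrite ?Ei.
have Ep : chart i (param i p) = p.
  have pr' : ball (chart i x) r p by apply: le_ball pr; lra.
  by have [] := param_dom (rI _ pr').
have s0 : 0 < s by rewrite divr_gt0.
have := pw f sf; rewrite fO// /m Ep subrr normr0 subr0 max_r ?(ltW s0)// => pwf.
have wO : O w.
  apply: contrapT => wO; move: pwf; rewrite /f; case: asboolP => // _.
  rewrite subr0 gtr0_norm ?mulr_gt0//; move: tK; rewrite -/s; lra.
split; first by case: wO.
move: pwf; rewrite fO// /m -mulrBr normrM (gtr0_norm K0).
rewrite (distrC (chart i w)) => pwf.
have [h|h] := leP (s - `|p - chart i w|) 0.
  exfalso; move: pwf; rewrite max_l// subr0 (gtr0_norm s0); move: tK; rewrite -/s; lra.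
move: pwf; rewrite (max_r (ltW h)) opprB addrCA subrr addr0 ger0_norm//.
Qed.

End LocalEstimates.
Section MetricTopology.
Variables (R : realType) (n : nat) (X : topologicalType) (A : complex_atlas R n X)
  (g : kaehler_metric A).

Lemma dist_le_near (x : X) (e : R) : 0 < e -> \forall z \near x, dist_le g x z e.
Proof.
move=> e0; have [i xi] := dom_cover A x.
have [r r0 [rI [M M0 HM]]] := dist_le_upper g xi.
have s0 : 0 < Num.min r (e / M) by rewrite lt_min r0 divr_gt0.
apply: filterS (chart_ball xi s0) => z [zi zs].
have zr : ball (chart i x) r (chart i z) by apply: le_ball zs; rewrite ge_min lexx.
have := HM _ _ (ballxx _ r0) zr; rewrite !chartK//; apply: dist_leW.
rewrite mulrC -ler_pdivlMr//.
move: zs; rewrite -ball_normE /ball_ /= => /ltW /le_trans; apply.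
by rewrite ge_min lexx orbT.
Qed.

Lemma dist_le_finite : connected [set: X] -> forall x y, exists r, dist_le g x y r.
Proof.
move=> cX x; apply: (@connected_ind X [set y | exists r, dist_le g x y r] x cX).
- by exists 0; exact: dist_le_refl.
- move=> y [r xy]; apply: filterS (dist_le_near y ltr01) => z yz.
  by exists (r + 1); exact: dist_le_trans xy yz.
- move=> y; apply: filterS (dist_le_near y ltr01) => z yz [r xz].
  by exists (r + 1); exact: dist_le_trans xz (dist_le_sym yz).
Qed.

Hypothesis X_hausdorff : hausdorff_space X.

(** With [dist_le_near] this says that the distance induces the topology of X. *)
Lemma dist_le_nbhs (x : X) (O : set X) : nbhs x O ->
  exists2 e : R, 0 < e & forall w, dist_le g x w e -> O w.
Proof.
move=> xO; have [i xi] := dom_cover A x.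
have [r r0 [rI [K K0 HK]]] := dist_le_lower g X_hausdorff xi.
have [s s0 sO] := nbhs_ball_chart xi xO.
exists (K * (Num.min r s / 2)).
  by rewrite mulr_gt0// divr_gt0// lt_min r0 s0.
move=> w xw; have m0 : 0 < Num.min r s by rewrite lt_min r0 s0.
have [||wi Kw] := HK (chart i x) (ballxx _ r0) w (K * (Num.min r s / 2)).
- by rewrite chartK.
- rewrite ltr_pM2l//; have : Num.min r s <= r by rewrite ge_min lexx.
  by lra.
have /sO/chart_imageP[_] : ball (chart i x) s (chart i w).
  rewrite ler_pM2l// in Kw; rewrite -ball_normE /ball_ /= distrC.
  have : Num.min r s <= s by rewrite ge_min lexx orbT.
  by lra.
by rewrite chartK.
Qed.

Lemma dist_le_compact (x : X) : exists2 e : R, 0 < e &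
  exists2 C : set X, compact C & forall w, dist_le g x w e -> C w.
Proof.
have [i xi] := dom_cover A x.
have [r r0 [rI [K K0 HK]]] := dist_le_lower g X_hausdorff xi.
exists (K * (r / 2)); first by rewrite mulr_gt0// divr_gt0.
exists (param i @` [set q | `|chart i x - q| <= r / 2]).
  apply: continuous_compact; last exact: closed_ball_compact.
  apply: continuous_in_subspaceT => q; rewrite inE /= => qr.
  apply: param_continuous; apply: rI; rewrite -ball_normE /ball_ /=.
  by lra.
move=> w xw; have [||wi Kw] := HK (chart i x) (ballxx _ r0) w (K * (r / 2)).
- by rewrite chartK.
- by rewrite ltr_pM2l//; lra.
exists (chart i w); last by rewrite chartK.
by rewrite ler_pM2l// distrC in Kw.
Qed.

Lemma dist_le_cvgP (T : Type) (F : set_system T) {FF : Filter F} (u : T -> X) (x : X) :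
  u @ F --> x <-> forall e, 0 < e -> \forall t \near F, dist_le g x (u t) e.
Proof.
split=> [ux e e0|H O /dist_le_nbhs[e e0 He]]; first exact: ux (dist_le_near x e0).
by apply: filterS (H e e0) => t /He.
Qed.

Lemma dist_le_lim (T : Type) (F : set_system T) {FF : ProperFilter F} (u v : T -> X)
    (x y : X) (s : R) : u @ F --> x -> v @ F --> y ->
  (\forall t \near F, dist_le g (u t) (v t) s) -> dist_le g x y s.
Proof.
move=> /dist_le_cvgP ux /dist_le_cvgP vy uv f sf.
apply/ler_addgt0Pr => e e0; have e20 : 0 < e / 2 by rewrite divr_gt0.
have [t [[h1 h2] h3]] := filter_ex (filterI (filterI (ux _ e20) (vy _ e20)) uv).
have := dist_le_trans (dist_le_trans h1 h3) (dist_le_sym h2).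
have -> : e / 2 + s + e / 2 = s + e by lra.
exact.
Qed.

Lemma dist_le_cvg_to (T : Type) (F : set_system T) {FF : Filter F} (u v : T -> X)
    (x : X) : u @ F --> x ->
  (forall e, 0 < e -> \forall t \near F, dist_le g (u t) (v t) e) -> v @ F --> x.
Proof.
move=> /dist_le_cvgP ux uv; apply/dist_le_cvgP => e e0.
have e20 : 0 < e / 2 by rewrite divr_gt0.
apply: filterS2 (ux _ e20) (uv _ e20) => t h1 h2.
by rewrite [e]splitr; exact: dist_le_trans h1 h2.
Qed.

End MetricTopology.

(** * Limits of homotheties *)

(* Continuous convergence, i.e. locally uniform convergence when the limit is
   continuous. *)
Definition cconv (T : Type) (F : set_system T) (X Y : topologicalType)
    (a : T -> X -> Y) (f : X -> Y) :=
  forall x O, nbhs (f x) O ->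
    exists2 N, nbhs x N & \forall t \near F, forall z, N z -> O (a t z).

Section ContinuousConvergence.
Variables (T : Type) (F : set_system T).

Lemma cconv_comp {FF : Filter F} (X Y : topologicalType) (a : T -> X -> Y) f u x :
  cconv F a f -> u @ F --> x -> a t (u t) @[t --> F] --> f x.
Proof.
move=> af ux O /af[N xN FN].
by apply: filterS2 FN (ux _ xN) => t H /H.
Qed.

Lemma cconv_pointwise {FF : Filter F} (X Y : topologicalType) (a : T -> X -> Y) f x :
  cconv F a f -> a t x @[t --> F] --> f x.
Proof. by move=> af; apply: cconv_comp af (cvg_cst x). Qed.

(** This converts continuous convergence into convergence for the compact-open topology. *)
Lemma cconv_compact {FF : Filter F} (X Y : topologicalType) (a : T -> X -> Y) f
    (K : set X) (O : set Y) :
  cconv F a f -> compact K -> open O -> f @` K `<=` O ->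
  \forall t \near F, a t @` K `<=` O.
Proof.
move=> af /compact_near_coveringP cK oO fKO.
have H : \forall t \near F, K `<=` (fun z => O (a t z)).
  apply: cK => x Kx.
  have [|N xN FN] := af x O; first by apply: open_nbhs_nbhs; split=> //; apply: fKO; exists x.
  by exists (N, [set t | forall z, N z -> O (a t z)]) => // -[z t] /= [Nz]; exact.
by apply: filterS H => t H _ [z Kz <-]; exact: H.
Qed.

(** Continuous convergence confines the images of a neighbourhood to a unit chart ball, which is the
    bound required by [limit_holomorphic]. Holomorphy is asked only eventually and near each point,
    since the rescaled maps are meaningful only there. *)
Lemma cconv_holomorphic {FU : UltraFilter F} (R : realType) (n m : nat)
    (X Y : topologicalType) (A : complex_atlas R n X) (B : complex_atlas R m Y)
    (a : T -> X -> Y) (f : X -> Y) : continuous f -> cconv F a f ->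
  (forall x (i : idx A) (j : idx B), dom i x -> dom j (f x) -> exists2 r : R, 0 < r &
    \forall t \near F, holomorphic_on (ball (chart i x) r) (local_map i j (a t))) ->
  holomorphic_map A B f /\
  forall x (i : idx A) (j : idx B), dom i x -> dom j (f x) -> forall u,
    'd (local_map i j (a t)) (chart i x) u @[t --> F] -->
    'd (local_map i j f) (chart i x) u.
Proof.
move=> cf af H.
suff main (i : idx A) (j : idx B) :
    holomorphic_on (chart i @` (dom i `&` f @^-1` dom j)) (local_map i j f) /\
    forall p v, (chart i @` (dom i `&` f @^-1` dom j)) p ->
      'd (local_map i j (a t)) p v @[t --> F] --> 'd (local_map i j f) p v.
  split; first by split=> // i j; case: (main i j).
  by move=> x i j xi fxj u; have [_] := main i j; apply; exists x.
apply: limit_holomorphic.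
- by apply: chart_image_open; apply: open_comp (dom_open j) => z _; exact: cf.
- move=> _ [x [xi fxj] <-]; have [r r0 Hr] := H x i j xi fxj.
  have [N xN FN] := af x _ (chart_ball fxj ltr01).
  have [s s0 Hs] := nbhs_ball_chart xi xN.
  exists (Num.min r s); first by rewrite lt_min r0 s0.
  exists (`|chart j (f x)| + 1); apply: filterS2 Hr FN => t [sm cr] tN.
  have sub : ball (chart i x) (Num.min r s) `<=` ball (chart i x) r.
    by apply: le_ball; rewrite ge_min lexx.
  split; first by split; [exact: smooth_on_sub sm|move=> p /sub; exact: cr].
  move=> q qs; have [|z [zi Nz] <-] := Hs q.
    by apply: le_ball qs; rewrite ge_min lexx orbT.
  rewrite /local_map /= chartK//; have [_] := tN z Nz.
  rewrite -ball_normE /ball_ /= => /ltW; rewrite -lerBlDl; apply: le_trans.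
  by rewrite distrC; exact: lerB_dist.
- move=> _ [x [xi fxj] <-]; rewrite /local_map /= chartK//.
  exact: (cvg_comp _ _ (cconv_pointwise af) (chart_continuous fxj)).
Qed.

End ContinuousConvergence.
Lemma holomorphic_on_sub (R : realType) (n m : nat) (U U' : set (Cspace R n))
    (f : Cspace R n -> Cspace R m) :
  U' `<=` U -> holomorphic_on U f -> holomorphic_on U' f.
Proof.
move=> UU [sf cr]; split; first exact: smooth_on_sub sf.
by move=> p /UU; exact: cr.
Qed.

Section Homotheties.
Variables (R : realType) (n : nat) (X : topologicalType) (A : complex_atlas R n X)
  (g : kaehler_metric A).

(** The inverse is carried along so that the pair can be exchanged by [homothety_sym], which turns
    expanding families into contracting ones. *)
Definition homothety (l : R) (a b : X -> X) :=
  [/\ 0 < l, holomorphic_map A A a /\ holomorphic_map A A b,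
      cancel a b /\ cancel b a, pullback_eq g g a (fun=> l ^+ 2) &
      pullback_eq g g b (fun=> l^-1 ^+ 2)].

Lemma homothety_sym l a b : homothety l a b -> homothety l^-1 b a.
Proof.
by move=> [l0 [ha hb] [aK bK] pa pb]; split; rewrite ?invr_gt0 ?invrK.
Qed.

Lemma homothety_id : homothety 1 id id.
Proof.
have p1 : pullback_eq g g id (fun=> 1 ^+ 2) by rewrite expr1n; exact: pullback_id.
split=> //; last by rewrite invr1.
by split; exact: holomorphic_map_id.
Qed.

Lemma pullback_eq_inverse a b c : holomorphic_map A A a -> holomorphic_map A A b ->
  cancel b a -> 0 < c -> pullback_eq g g a (fun=> c) ->
  pullback_eq g g b (fun=> c^-1).
Proof.
move=> [ca ha] [cb hb] bK c0 pa i j y yi bj u v T.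
have abi : dom i (a (b y)) by rewrite bK.
pose Fa := local_map (A := A) (B := A) j i a.
pose Fb := local_map (A := A) (B := A) i j b.
pose q := chart i y.
have Fbq : Fb q = chart j (b y) by rewrite /Fb /local_map /= chartK.
have dFb : differentiable Fb q.
  by apply: (smooth_on_differentiable (hb i j).1); exists y.
have dFa : differentiable Fa (Fb q).
  by rewrite Fbq; apply: (smooth_on_differentiable (ha j i).1); exists (b y).
have E w : 'd Fa (Fb q) ('d Fb q w) = w.
  apply: (etrans (esym (congr1 (fun h => h w) (diff_comp dFb dFa)))).
  have near_id : \forall p \near q, p = (Fa \o Fb) p.
    have bN : nbhs y (b @^-1` dom j) by apply: (cb y); exact: nbhs_dom.
    apply: filterS (nbhs_chart_image yi bN) => _ [z [zi bz] <-].
    by rewrite /Fa /Fb /local_map /= !chartK// bK.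
  have [_ ->] := near_eq_diff (f := id) near_id (@ex_diff _ _ _ _ _ _ _ _).
  by rewrite diff_val.
have EU : 'd Fa (chart j (b y)) (T u) = u by rewrite -Fbq; exact: E.
have EV : 'd Fa (chart j (b y)) (T v) = v by rewrite -Fbq; exact: E.
have H : inner (gram g i (chart i y)) ('d Fa (chart j (b y)) (T u))
    ('d Fa (chart j (b y)) (T v)) = c * inner (gram g j (chart j (b y))) (T u) (T v).
  by have := pa j i (b y) bj abi (T u) (T v); rewrite /= bK.
have H' := etrans (esym (congr2 (inner (gram g i (chart i y))) EU EV)) H.
by rewrite H' mulrA mulVf ?mul1r// gt_eqF.
Qed.

Lemma Conf_homothety a : (2 <= n)%N -> connected [set: X] -> Conf g a ->
  exists l b, homothety l a b.
Proof.
move=> n2 cX [[ha [b [hb aK bK]]] [c [sc c0 pa]]].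
have [l l0 Hl] : exists2 l, 0 < l & forall x, c x = l ^+ 2.
  (* Connectedness as stated allows X to be empty; the ratio is then arbitrary. *)
  have [[x _]|nx] := pselect (exists x : X, True); last first.
    by exists 1 => // x; exfalso; apply: nx; exists x.
  exists (Num.sqrt (c x)); first by rewrite sqrtr_gt0.
  by move=> y; rewrite sqr_sqrtr ?(ltW (c0 x))//; exact: factor_constant n2 cX ha sc pa _ _.
have pa' : pullback_eq g g a (fun=> l ^+ 2).
  by rewrite (_ : (fun=> _) = c)//; apply/funext => x; rewrite Hl.
exists l, b; split=> //; rewrite exprVn.
by apply: pullback_eq_inverse pa'; rewrite // exprn_gt0.
Qed.

Lemma homothety_Conf l a b : homothety l a b -> Conf g a.
Proof.
move=> [l0 [ha hb] [aK bK] pa _]; split; first by split=> //; exists b.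
exists (fun=> l ^+ 2); split=> //; last by move=> _; rewrite exprn_gt0.
move=> i k; rewrite (_ : _ \o _ = fun=> l ^+ 2); first exact: Ck_cst.
by apply/funext.
Qed.

Lemma homothety_dist l a b x y r : homothety l a b -> dist_le g x y r ->
  dist_le g (a x) (a y) (l * r).
Proof. by move=> [l0 [ha _] _ pa _]; exact: dist_le_homothety. Qed.

End Homotheties.

Section BoundedFamily.
Variables (R : realType) (n : nat) (X : topologicalType) (A : complex_atlas R n X)
  (g : kaehler_metric A) (T : Type) (F : set_system T).
Hypotheses (X_hausdorff : hausdorff_space X) (X_connected : connected [set: X])
  (FU : UltraFilter F).

(* Connectedness propagates convergence from one point: the closedness step
   transports a compact ball around z by a single member of the family. *)
Lemma bounded_family_cvg (l : T -> R) (a b : T -> X -> X) (C : R) (u : T -> X) (x y : X) :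
  (forall t, homothety g (l t) (a t) (b t)) -> 0 < C ->
  (\forall t \near F, C^-1 <= l t <= C) ->
  u @ F --> x -> a t (u t) @[t --> F] --> y ->
  forall z, exists w : X, a t z @[t --> F] --> w.
Proof.
move=> hab C0 Fl ux auy.
have Da z w r : 0 <= r -> dist_le g z w r ->
    \forall t \near F, dist_le g (a t z) (a t w) (C * r).
  move=> r0 zw; apply: filterS Fl => t /andP[_ lC].
  by apply: dist_leW (homothety_dist (hab t) zw); exact: ler_wpM2r.
apply: (@connected_ind X [set z | exists w : X, a t z @[t --> F] --> w] x X_connected).
- exists y; apply: (dist_le_cvg_to (g := g) X_hausdorff auy) => e e0.
  have eC : 0 < e / C by rewrite divr_gt0.
  have Fux : \forall t \near F, dist_le g x (u t) (e / C).
    exact: (iffLR (dist_le_cvgP g X_hausdorff u x) ux _ eC).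
  apply: filterS2 Fux Fl => t xu /andP[_ lC].
  apply: dist_leW (homothety_dist (hab t) (dist_le_sym xu)).
  have : l t * (e / C) <= C * (e / C) by apply: ler_wpM2r => //; exact: ltW.
  by move=> h; apply: le_trans h _; rewrite [C * _]mulrC divfK// gt_eqF.
- move=> z [w azw]; have [e e0 [K cK HK]] := dist_le_compact g X_hausdorff w.
  have e20 : 0 < e / 2 by rewrite divr_gt0.
  have eC : 0 < e / 2 / C by rewrite divr_gt0.
  apply: filterS (dist_le_near g z eC) => z' zz'.
  have Fw : \forall t \near F, dist_le g w (a t z) (e / 2).
    exact: (iffLR (dist_le_cvgP g X_hausdorff (a^~ z) w) azw _ e20).
  have [|w' _ az'] := ultra_compact_cvg FU cK (f := fun t => a t z').
    apply: filterS2 Fw (Da _ _ _ (ltW eC) zz') => t h1 h2; apply: HK.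
    rewrite [e]splitr; apply: dist_le_trans h1 _.
    by apply: dist_leW h2; rewrite mulrC divfK// gt_eqF.
  by exists w'.
- move=> z; have [e e0 [K cK HK]] := dist_le_compact g X_hausdorff z.
  (* The points a s z and a t z will be at distance at most 4 * d = e / C, and b s stretches
     distances by at most C, hence the e of the compact ball around z. *)
  pose d := e / (4 * C).
  have d0 : 0 < d by rewrite divr_gt0// mulr_gt0.
  have dC0 : 0 < d / C by rewrite divr_gt0.
  apply: filterS (dist_le_near g z dC0) => z' zz' [w azw].
  have Fw : \forall t \near F, dist_le g w (a t z') d.
    exact: (iffLR (dist_le_cvgP g X_hausdorff (a^~ z') w) azw _ d0).
  have Fz := Da _ _ _ (ltW dC0) zz'.
  have CdC : C * (d / C) = d by rewrite mulrC divfK// gt_eqF.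
  rewrite CdC in Fz.
  have [s [[ws zs] ls]] := filter_ex (filterI (filterI Fw Fz) Fl).
  have ca : continuous (a s) by have [_ [[]]] := hab s.
  have caK : compact (a s @` K).
    by apply: continuous_compact cK; exact: continuous_subspaceT.
  have [|w' _ az'] := ultra_compact_cvg FU caK (f := fun t => a t z).
    apply: filterS2 Fw Fz => t wt zt.
    have [_ _ [_ bK] _ _] := hab s.
    exists (b s (a t z)); last exact: bK.
    apply: HK.
    have D4 : dist_le g (a s z) (a t z) (d + d + (d + d)).
      apply: dist_le_trans (dist_le_trans zs (dist_le_sym ws)) _.
      exact: dist_le_trans wt (dist_le_sym zt).
    have := homothety_dist (homothety_sym (hab s)) D4.
    have [ls0 _ [aK _] _ _] := hab s.
    rewrite aK; apply: dist_leW.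
    have -> : d + d + (d + d) = e / C by rewrite /d; field; rewrite gt_eqF.
    rewrite ler_pdivrMl// [l s * e]mulrC ler_pdivrMr// -mulrA.
    rewrite ler_peMr ?(ltW e0)//.
    move: ls => /andP[+ _]; rewrite -(ler_pM2r C0) mulVf//.
    by rewrite gt_eqF.
  by exists w'.
Qed.

(** An upper bound on the ratios makes the family equi-Lipschitz, which upgrades pointwise to
    continuous convergence. *)
Lemma bounded_family_cconv (l : T -> R) (a b : T -> X -> X) (C : R) (f : X -> X) :
  (forall t, homothety g (l t) (a t) (b t)) -> 0 < C ->
  (\forall t \near F, l t <= C) ->
  (forall z, a t z @[t --> F] --> f z) -> continuous f /\ cconv F a f.
Proof.
move=> hab C0 Fl af.
have CeC e : C * (e / C) = e by rewrite mulrC divfK// gt_eqF.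
have Da z w r : 0 <= r -> dist_le g z w r -> forall t, l t <= C ->
    dist_le g (a t z) (a t w) (C * r).
  move=> r0 zw t lC.
  by apply: dist_leW (homothety_dist (hab t) zw); exact: ler_wpM2r.
split=> [x O|x O] /(dist_le_nbhs g X_hausdorff)[e e0 He].
  have eC : 0 < e / C by rewrite divr_gt0.
  apply: filterS (dist_le_near g x eC) => z xz; apply: He.
  apply: (dist_le_lim (g := g) X_hausdorff (af x) (af z)).
  by apply: filterS Fl => t lC; have := Da _ _ _ (ltW eC) xz t lC; rewrite CeC.
have e20 : 0 < e / 2 by rewrite divr_gt0.
have eC : 0 < e / 2 / C by rewrite divr_gt0.
exists [set z | dist_le g x z (e / 2 / C)]; first exact: dist_le_near.
have Fx : \forall t \near F, dist_le g (f x) (a t x) (e / 2).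
  exact: (iffLR (dist_le_cvgP g X_hausdorff (a^~ x) (f x)) (af x) _ e20).
apply: filterS2 Fx Fl => t fx lC z xz; apply: He; rewrite [e]splitr.
by apply: dist_le_trans fx _; have := Da _ _ _ (ltW eC) xz t lC; rewrite CeC.
Qed.

Lemma family_local_holomorphic (a : T -> X -> X) (f : X -> X) :
  (forall t, holomorphic_map A A (a t)) -> cconv F a f ->
  forall x (i j : idx A), dom i x -> dom j (f x) -> exists2 r : R, 0 < r &
    \forall t \near F, holomorphic_on (ball (chart i x) r) (local_map i j (a t)).
Proof.
move=> ha af x i j xi fxj; have [N xN FN] := af x _ (nbhs_dom fxj).
have [r r0 Hr] := nbhs_ball_chart xi xN.
exists r => //; apply: filterS FN => t tN.
apply: holomorphic_on_sub ((ha t).2 i j).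
by apply: subset_trans Hr _ => _ [z [zi Nz] <-]; exists z => //; split => //; exact: tN.
Qed.

Lemma pullback_eq_lim (a : T -> X -> X) (f : X -> X) (c : T -> R) (c0 : R) :
  cconv F a f ->
  (forall x (i j : idx A), dom i x -> dom j (f x) -> forall u,
    'd (local_map i j (a t)) (chart i x) u @[t --> F] -->
    'd (local_map i j f) (chart i x) u) ->
  (forall t, pullback_eq g g (a t) (fun=> c t)) -> c @ F --> c0 ->
  pullback_eq g g f (fun=> c0).
Proof.
move=> af df pa cc i j x xi fxj u v L.
have Ij : (chart j @` dom j) (chart j (f x)) by exists (f x).
have cG : gram g j (chart j (a t x)) @[t --> F] --> gram g j (chart j (f x)).
  have cx : chart j (a t x) @[t --> F] --> chart j (f x).
    exact: (cvg_comp _ _ (cconv_pointwise af) (chart_continuous fxj)).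
  exact: (cvg_comp _ _ cx (smooth_on_continuous (gram_smooth g j) Ij)).
have FF : Filter F by typeclasses eauto.
have F1 := cvg_inner (FF := FF) cG (df x i j xi fxj u) (df x i j xi fxj v).
have F2 : c t * inner (gram g i (chart i x)) u v @[t --> F] -->
    c0 * inner (gram g i (chart i x)) u v by apply: cvgM => //; exact: cvg_cst.
have Fj : \forall t \near F, dom j (a t x) :=
  cconv_pointwise (FF := FF) af (nbhs_dom fxj).
have F3 : inner (gram g j (chart j (a t x))) ('d (local_map i j (a t)) (chart i x) u)
    ('d (local_map i j (a t)) (chart i x) v) @[t --> F] -->
    c0 * inner (gram g i (chart i x)) u v.
  by apply: cvg_trans F2; apply: near_eq_cvg; apply: filterS Fj => t jt; rewrite pa.
by apply: (cvg_unique _ F1 F3); exact: norm_hausdorff.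
Qed.

(** The inverses form a bounded family too, with x and y exchanged. As both converge continuously,
    the identities between a t and b t pass to the limit and make f bijective. *)
Lemma bounded_family_limit (l : T -> R) (a b : T -> X -> X) (C : R) (u : T -> X) (x y : X) :
  (forall t, homothety g (l t) (a t) (b t)) -> 0 < C ->
  (\forall t \near F, C^-1 <= l t <= C) ->
  u @ F --> x -> a t (u t) @[t --> F] --> y ->
  exists f, [/\ Conf g f, cconv F a f & f x = y].
Proof.
move=> hab C0 Fl ux auy.
have hba t := homothety_sym (hab t).
have Fl' : \forall t \near F, C^-1 <= (l t)^-1 <= C.
  apply: filterS Fl => t /andP[l1 l2]; have [l0 _ _ _ _] := hab t.
  rewrite lef_pV2 ?posrE// l2/= -[C]invrK lef_pV2 ?posrE//.
  by rewrite invr_gt0.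
have buy : b t (a t (u t)) @[t --> F] --> x.
  have E : (fun t => b t (a t (u t))) = u.
    by apply/funext => t; have [_ _ [aK _] _ _] := hab t; rewrite aK.
  by rewrite E.
have [f Hf] := choice (bounded_family_cvg hab C0 Fl ux auy).
have [h Hh] := choice (bounded_family_cvg hba C0 Fl' auy buy).
have FlC : \forall t \near F, l t <= C by apply: filterS Fl => t /andP[].
have FlC' : \forall t \near F, (l t)^-1 <= C by apply: filterS Fl' => t /andP[].
have [cf af] := bounded_family_cconv hab C0 FlC Hf.
have [ch bh] := bounded_family_cconv hba C0 FlC' Hh.
have fK : cancel f h.
  move=> z; apply: (cvg_unique X_hausdorff (cconv_comp bh (Hf z))).
  rewrite (_ : (fun t => b t (a t z)) = cst z); first exact: cvg_cst.
  by apply/funext => t; have [_ _ [aK _] _ _] := hab t; rewrite aK.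
have hK : cancel h f.
  move=> z; apply: (cvg_unique X_hausdorff (cconv_comp af (Hh z))).
  rewrite (_ : (fun t => a t (b t z)) = cst z); first exact: cvg_cst.
  by apply/funext => t; have [_ _ [_ bK] _ _] := hab t; rewrite bK.
(* The ratios converge inside [C^-1, C], so the limit ratio is still positive. *)
have [l0 /= l0I ll0] := ultra_compact_cvg FU (@segment_compact _ C^-1 C) Fl.
have l00 : 0 < l0.
  move: l0I; rewrite in_itv/= => /andP[+ _]; apply: lt_le_trans.
  by rewrite invr_gt0.
have [hf df] := cconv_holomorphic cf af
  (family_local_holomorphic (fun t => let: And5 _ h _ _ _ := hab t in h.1) af).
have [hh dh] := cconv_holomorphic ch bh
  (family_local_holomorphic (fun t => let: And5 _ h _ _ _ := hab t in h.2) bh).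
exists f; split=> //; last first.
  by apply: (cvg_unique X_hausdorff _ auy); exact: cconv_comp af ux.
have pf : pullback_eq g g f (fun=> l0 ^+ 2).
  apply: (pullback_eq_lim af df (c := fun t => l t ^+ 2)) => [t|].
    by have [] := hab t.
  by rewrite !expr2; apply: cvgM.
apply: (@homothety_Conf _ _ _ _ g l0 f h); split=> //.
by rewrite exprVn; apply: pullback_eq_inverse pf => //; rewrite exprn_gt0.
Qed.

End BoundedFamily.
(** * Rescaling along a contracting family *)

Section HolomorphicAffine.
Variables (R : realType) (n m k : nat).

Lemma holomorphic_affine_comp (U : set (Cspace R n)) (f : Cspace R n -> Cspace R m)
    (B : 'M[R]_(m + m, k + k)) (b : Cspace R k) : open U ->
  (forall v : Cspace R m, Jstd v *m B = Jstd (v *m B : Cspace R k)) ->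
  holomorphic_on U f -> holomorphic_on U (fun q => f q *m B + b).
Proof.
move=> oU JB [sf cr].
have cL : continuous (mulmxr B : 'rV[R]_(m + m) -> 'rV[R]_(k + k)).
  exact: linear_rV_continuous.
split=> [i|p Up v]; first exact: (Ck_affine_comp b cL oU (sf i)).
have [_ E] := diff_affine_comp b cL (smooth_on_differentiable sf Up).
by rewrite E /= cr// JB.
Qed.

Lemma diff_mulmxr (f : Cspace R n -> Cspace R m)
    (B : 'M[R]_(m + m, k + k)) (b : Cspace R k) p v : differentiable f p ->
  'd (fun q => f q *m B + b) p v = 'd f p v *m B.
Proof.
move=> df.
have cL : continuous (mulmxr B : 'rV[R]_(m + m) -> 'rV[R]_(k + k)).
  exact: linear_rV_continuous.
by have [_ E] := diff_affine_comp b cL df; rewrite E.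
Qed.

Lemma holomorphic_comp_affine (U : set (Cspace R m)) (f : Cspace R m -> Cspace R k)
    (B : 'M[R]_(n + n, m + m)) (b : Cspace R m) : open U ->
  (forall v : Cspace R n, Jstd v *m B = Jstd (v *m B : Cspace R m)) ->
  holomorphic_on U f ->
  holomorphic_on ((fun q => q *m B + b) @^-1` U) (fun q => f (q *m B + b)).
Proof.
move=> oU JB [sf cr].
have cL : continuous (mulmxr B : 'rV[R]_(n + n) -> 'rV[R]_(m + m)).
  exact: linear_rV_continuous.
split=> [i|p Up v]; first exact: (Ck_comp_affine b cL oU (sf i)).
have [_ E] := diff_comp_affine cL (smooth_on_differentiable sf Up).
by rewrite E /= JB cr.
Qed.

End HolomorphicAffine.

Lemma mulmx_bound (R : realType) (m k : nat) (B : 'M[R]_(m, k)) :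
  exists2 C : R, 0 < C & forall v : 'rV[R]_m, `|v *m B| <= C * `|v|.
Proof.
have cL : continuous (mulmxr B : 'rV[R]_m -> 'rV[R]_k) by exact: linear_rV_continuous.
by have [C C0 HC] := linear_lipschitz cL; exists C.
Qed.

Lemma cconv_continuous_norm (R : realType) (V : normedModType R) (T : Type)
    (F : set_system T) (FF : ProperFilter F) (X : topologicalType)
    (a : T -> X -> V) (f : X -> V) : cconv F a f -> continuous f.
Proof.
move=> af x; apply/cvgrPdist_le => e e0.
have [N xN FN] := af x _ (nbhsx_ballx (f x) e e0).
apply: filterS xN => z Nz.
have H : `|f x - a t z| @[t --> F] --> `|f x - f z|.
  by apply: cvg_norm; apply: cvgB; [exact: cvg_cst|exact: cconv_pointwise].
apply: (cvgr_to_le H); apply: filterS FN => t /(_ z Nz).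
by rewrite -ball_normE => /ltW.
Qed.

Section Rescaling.
Variables (R : realType) (n : nat) (X : topologicalType) (A : complex_atlas R n X)
  (g : kaehler_metric A) (T : Type) (F : set_system T).
Hypotheses (X_hausdorff : hausdorff_space X) (X_connected : connected [set: X])
  (FU : UltraFilter F).
Variables (l : T -> R) (a b : T -> X -> X) (u : T -> X) (x y : X).
Hypotheses (hab : forall t, homothety g (l t) (a t) (b t))
  (l_small : forall e, 0 < e -> \forall t \near F, l t < e)
  (ux : u @ F --> x) (auy : a t (u t) @[t --> F] --> y).

Let l_gt0 t : 0 < l t. Proof. by have [] := hab t. Qed.
Let aK t : cancel (a t) (b t). Proof. by have [_ _ []] := hab t. Qed.
Let bK t : cancel (b t) (a t). Proof. by have [_ _ []] := hab t. Qed.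

Let l_small_mul c e : 0 < e -> \forall t \near F, l t * c < e.
Proof.
move=> e0; have c0 : 0 < `|c| + 1 by rewrite ltr_wpDl.
have ec : 0 < e / (`|c| + 1) by rewrite divr_gt0.
apply: filterS (l_small ec) => t; rewrite ltr_pdivlMr//; apply: le_lt_trans.
rewrite ler_wpM2l ?(ltW (l_gt0 t))//.
by apply: le_trans (ler_norm c) _; rewrite lerDl.
Qed.

Let u_near : \forall t \near F, dist_le g x (u t) 1.
Proof. exact: (iffLR (dist_le_cvgP g X_hausdorff u x) ux _ ltr01). Qed.

(* Large balls are carried by a contraction into a small, relatively compact one. *)
Lemma contracting_proper (rho : R) : 0 <= rho ->
  exists2 C : set X, compact C & forall w, dist_le g x w rho -> C w.
Proof.
move=> rho0; have [e e0 [C cC HC]] := dist_le_compact g X_hausdorff y.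
have e20 : 0 < e / 2 by rewrite divr_gt0.
have Fy : \forall t \near F, dist_le g y (a t (u t)) (e / 2).
  exact: (iffLR (dist_le_cvgP g X_hausdorff (fun t => a t (u t)) y) auy _ e20).
have [t [[yt xt] lt]] := filter_ex (filterI (filterI Fy u_near) (l_small_mul (1 + rho) e20)).
have cb : continuous (b t) by have [_ [_ []]] := hab t.
exists (b t @` C).
  by apply: continuous_compact cC; exact: continuous_subspaceT.
move=> w xw; exists (a t w); last exact: aK.
apply: HC; rewrite [e]splitr; apply: dist_le_trans yt _.
apply: dist_leW (ltW lt) _; apply: (homothety_dist (hab t)).
exact: dist_le_trans (dist_le_sym xt) xw.
Qed.

(** Data at the limit point y: a chart ball on which distance and norm are comparable, a unitary
    frame P of the tangent space, and its inverse B. *)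
Variables (j : idx A) (r K M : R) (P B : 'M[R]_(n + n)).
Hypotheses (yj : dom j y) (r0 : 0 < r) (K0 : 0 < K) (M0 : 0 < M)
  (rI : ball (chart j y) r `<=` chart j @` dom j)
  (lower : forall p, ball (chart j y) r p -> forall w t,
    dist_le g (param j p) w t -> t < K * r -> dom j w /\ K * `|chart j w - p| <= t)
  (upper : forall p q, ball (chart j y) r p -> ball (chart j y) r q ->
    dist_le g (param j p) (param j q) (M * `|p - q|))
  (PG : P *m gram g j (chart j y) *m P^T = 1%:M)
  (PB : P *m B = 1%:M)
  (JP : forall v : Cspace R n, Jstd v *m P = Jstd (v *m P : Cspace R n)).

Let q t := chart j (a t (u t)).
Let Bt t := (l t)^-1 *: B.
Let Pt t := l t *: P.

Let BP : B *m P = 1%:M. Proof. exact: mulmx1C PB. Qed.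

Let BPt t : Bt t *m Pt t = 1%:M.
Proof. by rewrite -scalemxAl -scalemxAr scalerA mulVf ?scale1r// gt_eqF. Qed.

Let PBt t : Pt t *m Bt t = 1%:M. Proof. exact: mulmx1C (BPt t). Qed.

Let JPt t (v : Cspace R n) : Jstd v *m Pt t = Jstd (v *m Pt t : Cspace R n).
Proof. by rewrite -!scalemxAr JP -linearZ. Qed.

Let JBt t (v : Cspace R n) : Jstd v *m Bt t = Jstd (v *m Bt t : Cspace R n).
Proof.
rewrite -[RHS]mulmx1 -(PBt t) mulmxA JPt -(mulmxA v) BPt mulmx1.
by [].
Qed.

Let q_near e : 0 < e -> \forall t \near F, dom j (a t (u t)) /\ ball (chart j y) e (q t).
Proof. by move=> e0; exact: (auy (chart_ball yj e0)). Qed.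

(* phi t blows up the chart around a t (u t) by (l t)^-1, and h t is its inverse
   wherever the chart is defined; since l t -> 0, any given point is eventually
   in the domain of either map. *)
Let phi t z : Cspace R n := chart j (a t z) *m Bt t + - (q t *m Bt t).
Let h t (w : Cspace R n) := b t (param j (w *m Pt t + q t)).

(** By [lower], chart increments of a t are at most l t / K times distances, and the factor (l t)^-1
    of [Bt] cancels l t, so L is independent of t. [lower] is applied from q t to reach a t z, then
    from there to reach a t z'; the extra 1 is the distance from x to u t. *)
Let phi_lipschitz : exists2 L : R, 0 < L & forall S, 0 <= S ->
  \forall t \near F, forall z z' s, dist_le g x z S -> dist_le g z z' s -> 0 <= s -> s <= S ->
    [/\ dom j (a t z), dom j (a t z') & `|phi t z - phi t z'| <= L * s].
Proof.
have [C C0 HC] := mulmx_bound B; exists (C / K); first by rewrite divr_gt0.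
move=> S S0; have Kr : 0 < K * (r / 2) by rewrite mulr_gt0// divr_gt0.
have r20 : 0 < r / 2 by rewrite divr_gt0.
apply: filterS2 (filterI u_near (q_near r20)) (l_small_mul (1 + S) Kr).
move=> t [xu [yt qt]] lt z z' s xz zz' s0 sS.
have lt0 := l_gt0 t.
have Kr2 : K * (r / 2) <= K * r by rewrite ler_pM2l//; lra.
have qr : ball (chart j y) r (q t) by apply: le_ball qt; lra.
have D1 : dist_le g (param j (q t)) (a t z) (l t * (1 + S)).
  rewrite chartK//; apply: (homothety_dist (hab t)).
  exact: dist_le_trans (dist_le_sym xu) xz.
have [zj Hz] := lower qr D1 (lt_le_trans lt Kr2).
have zr : ball (chart j y) r (chart j (a t z)).
  move: qt; rewrite -!ball_normE /ball_ /= => qt.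
  have Hz' : `|chart j (a t z) - q t| < r / 2.
    by rewrite -(ltr_pM2l K0); exact: le_lt_trans Hz lt.
  rewrite -(subrKA (q t)) [r]splitr; apply: le_lt_trans (ler_normD _ _) _.
  by rewrite (distrC (q t)) ltrD.
have D2 : dist_le g (param j (chart j (a t z))) (a t z') (l t * s).
  by rewrite chartK//; exact: (homothety_dist (hab t)).
have ls : l t * s < K * r.
  apply: lt_le_trans Kr2; apply: le_lt_trans lt; rewrite ler_pM2l//.
  by apply: le_trans sS _; rewrite lerDr.
have [zj' Hz'] := lower zr D2 ls.
split=> //; rewrite /phi opprD addrACA subrr addr0 -mulmxBl -scalemxAr normrZ.
rewrite gtr0_norm ?invr_gt0// ler_pdivrMl//.
apply: le_trans (HC _) _; rewrite distrC.
rewrite (_ : l t * _ = C * (l t * s / K)); last by ring.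
by rewrite ler_pM2l// ler_pdivlMr// mulrC.
Qed.

(** The same cancellation in reverse: [Pt] shrinks by l t, [upper] costs M, and b t stretches by (l
    t)^-1. *)
Let h_lipschitz : exists2 L : R, 0 < L & forall W, 0 <= W ->
  \forall t \near F, forall w w', `|w| <= W -> `|w'| <= W ->
    ball (chart j y) r (w *m Pt t + q t) /\ dist_le g (h t w) (h t w') (L * `|w - w'|).
Proof.
have [C C0 HC] := mulmx_bound P; exists (M * C); first by rewrite mulr_gt0.
move=> W W0; have r20 : 0 < r / 2 by rewrite divr_gt0.
apply: filterS2 (q_near r20) (l_small_mul (C * W) r20) => t [yt qt] lt.
have lt0 := l_gt0 t.
have near_ball w : `|w| <= W -> ball (chart j y) r (w *m Pt t + q t).
  move=> wW; move: qt; rewrite -!ball_normE /ball_ /= => qt.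
  rewrite opprD addrCA; apply: le_lt_trans (ler_normD _ _) _.
  rewrite [r]splitr normrN; apply: ler_ltD; last exact: qt.
  rewrite -scalemxAr normrZ gtr0_norm//; apply: le_trans (ltW lt).
  rewrite ler_pM2l//; apply: le_trans (HC w) _.
  by rewrite ler_pM2l.
move=> w w' wW wW'; split; first exact: near_ball.
have [_ _ _ _ _] := hab t.
have := homothety_dist (homothety_sym (hab t)) (upper (near_ball w wW) (near_ball w' wW')).
apply: dist_leW; rewrite ler_pdivrMl// opprD addrACA subrr addr0 -mulmxBl.
rewrite -scalemxAr normrZ gtr0_norm//.
rewrite (_ : l t * (M * C * _) = M * (l t * (C * `|w - w'|))); last by ring.
by rewrite ler_pM2l// ler_pM2l.
Qed.

Let phi_u t : phi t (u t) = 0.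
Proof. by rewrite /phi /q subrr. Qed.

Let h_0 : \forall t \near F, h t 0 = u t.
Proof.
by apply: filterS (q_near r0) => t [yt _]; rewrite /h mul0mx add0r /q chartK// aK.
Qed.

Let phi_h w : \forall t \near F, phi t (h t w) = w.
Proof.
have [L L0 HL] := h_lipschitz.
apply: filterS (HL `|w| (normr_ge0 w)) => t H.
have [/rI Ip _] := H w w (lexx _) (lexx _).
have [_ E] := param_dom Ip.
by rewrite /phi /h bK E mulmxDl -mulmxA PBt mulmx1 addrK.
Qed.

Let h_phi z : \forall t \near F, h t (phi t z) = z.
Proof.
have [L L0 HL] := phi_lipschitz; have [rho xz] := dist_le_finite g X_connected x z.
have xz' : dist_le g x z `|rho| by apply: dist_leW xz; exact: ler_norm.
apply: filterS (HL `|rho| (normr_ge0 _)) => t H.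
have zz : dist_le g z z 0 by exact: dist_le_refl.
have [zj _ _] := H z z 0 xz' zz (lexx 0) (normr_ge0 _).
by rewrite /h /phi mulmxDl mulNmx -!mulmxA BPt !mulmx1 subrK chartK// aK.
Qed.

Let phi_cvg z : exists w : Cspace R n, phi t z @[t --> F] --> w.
Proof.
have [L L0 HL] := phi_lipschitz; have [rho xz] := dist_le_finite g X_connected x z.
apply: (@rV_ultra_cvg _ _ _ _ _ (L * (1 + `|rho|))).
have S0 : 0 <= 1 + `|rho| by rewrite addr_ge0.
apply: filterS2 (HL _ S0) u_near => t H xu.
have xz' : dist_le g x z `|rho| by apply: dist_leW xz; exact: ler_norm.
have [||_ _] := H (u t) z (1 + `|rho|) _ _ S0 (lexx _).
- by apply: dist_leW xu; rewrite lerDl.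
- exact: dist_le_trans (dist_le_sym xu) xz'.
by rewrite phi_u sub0r normrN.
Qed.

(** Since h t 0 = u t stays near x, the points h t w lie in a fixed ball around x, and
    [contracting_proper] makes that ball relatively compact. *)
Let h_cvg w : exists z : X, h t w @[t --> F] --> z.
Proof.
have [L L0 HL] := h_lipschitz.
have [|C cC HC] := @contracting_proper (1 + L * `|w|).
  by rewrite addr_ge0// mulr_ge0// ltW.
have [|z _ Hz] := ultra_compact_cvg FU cC (f := h^~ w); last by exists z.
apply: filterS2 (HL _ (normr_ge0 w)) (filterI u_near h_0) => t H [xu h0].
apply: HC; apply: dist_le_trans xu _; rewrite -h0.
have [|_] := H 0 w _ (lexx _); first by rewrite normr0.
by rewrite sub0r normrN.
Qed.

(** Equi-Lipschitz bounds give continuous convergence, under which the identities [h_phi] and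
    [phi_h], valid eventually at each fixed point, pass to the limit. *)
Lemma rescaling_limits : exists (f : X -> Cspace R n) (k : Cspace R n -> X),
  [/\ cconv F phi f, cconv F h k, cancel f k & cancel k f].
Proof.
have [f Hf] := choice phi_cvg; have [k Hk] := choice h_cvg.
have pf : cconv F phi f.
  move=> z O /nbhs_ballP[e /= e0 eO].
  have [L L0 HL] := phi_lipschitz; have [rho xz] := dist_le_finite g X_connected x z.
  have xz' : dist_le g x z (1 + `|rho|).
    by apply: dist_leW xz; apply: le_trans (ler_norm _) _; rewrite lerDr.
  pose s := Num.min 1 (e / 2 / L).
  have s0 : 0 < s by rewrite lt_min ltr01 !divr_gt0.
  exists [set z' | dist_le g z z' s]; first exact: dist_le_near.
  have S0 : 0 <= 1 + `|rho| by rewrite addr_ge0.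
  have e20 : 0 < e / 2 by rewrite divr_gt0.
  have Fz : \forall t \near F, ball (f z) (e / 2) (phi t z).
    exact: (Hf z _ (nbhsx_ballx (f z) _ e20)).
  apply: filterS2 (HL _ S0) Fz => t H fz z' zz'; apply: eO.
  have sS : s <= 1 + `|rho| by apply: (@le_trans _ _ 1); rewrite ?lerDl// ge_min lexx.
  have [_ _ pz] := H z z' s xz' zz' (ltW s0) sS.
  move: fz; rewrite -!ball_normE /ball_ /= => fz.
  rewrite -(subrKA (phi t z)); apply: le_lt_trans (ler_normD _ _) _.
  rewrite [e]splitr; apply: ltr_leD => //; apply: le_trans pz _.
  by rewrite mulrC -ler_pdivlMr// /s ge_min lexx orbT.
have ph : cconv F h k.
  move=> w O /(dist_le_nbhs g X_hausdorff)[e e0 He].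
  have [L L0 HL] := h_lipschitz.
  pose s := Num.min 1 (e / 2 / L).
  have s0 : 0 < s by rewrite lt_min ltr01 !divr_gt0.
  exists (ball w s); first exact: nbhsx_ballx.
  have W0 : 0 <= `|w| + 1 by rewrite addr_ge0.
  have e20 : 0 < e / 2 by rewrite divr_gt0.
  have Fw : \forall t \near F, dist_le g (k w) (h t w) (e / 2).
    exact: (iffLR (dist_le_cvgP g X_hausdorff (h^~ w) (k w)) (Hk w) _ e20).
  apply: filterS2 (HL _ W0) Fw => t H kw w'.
  rewrite -ball_normE /ball_ /= => ww'; apply: He; rewrite [e]splitr.
  apply: dist_le_trans kw _.
  have s1 : s <= 1 by rewrite ge_min lexx.
  have [||_] := H w w'; first by rewrite lerDl.
    rewrite -lerBlDl; apply: le_trans (ltW (lt_le_trans ww' s1)).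
    by rewrite distrC; exact: lerB_dist.
  apply: dist_leW; rewrite mulrC -ler_pdivlMr//.
  by apply: le_trans (ltW ww') _; rewrite /s ge_min lexx orbT.
exists f, k; split=> // z.
  apply: (cvg_unique X_hausdorff (cconv_comp ph (Hf z))).
  have Fc : cst z t @[t --> F] --> z by exact: cvg_cst.
  apply: cvg_trans Fc; apply: near_eq_cvg.
  by apply: filterS (h_phi z) => t ->.
have F1 : phi t (h t z) @[t --> F] --> f (k z) by exact: cconv_comp pf (Hk z).
have F2 : phi t (h t z) @[t --> F] --> z.
  have Fc : cst z t @[t --> F] --> z by exact: cvg_cst.
  apply: cvg_trans Fc; apply: near_eq_cvg.
  by apply: filterS (phi_h z) => t ->.
by apply: (cvg_unique _ F1 F2); exact: norm_hausdorff.
Qed.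

Let Fprop : ProperFilter F := ultra_proper.

Let phi_holomorphic z (i : idx A) (c : idx (Cn_atlas R n)) : dom i z ->
  exists2 s : R, 0 < s & \forall t \near F,
    [/\ holomorphic_on (ball (chart i z) s) (local_map i c (phi t)), dom j (a t z) &
    forall v, 'd (local_map i c (phi t)) (chart i z) v =
      'd (local_map i j (a t)) (chart i z) v *m Bt t].
Proof.
move=> zi.
have [L L0 HL] := phi_lipschitz; have [rho xz] := dist_le_finite g X_connected x z.
have xz' : dist_le g x z (1 + `|rho|).
  by apply: dist_leW xz; apply: le_trans (ler_norm _) _; rewrite lerDr.
have S0 : 0 <= 1 + `|rho| by rewrite addr_ge0.
have [s s0 Hs] := nbhs_ball_chart zi (dist_le_near g z ltr01).
exists s => //; apply: filterS (HL _ S0) => t H.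
have sub : ball (chart i z) s `<=` chart i @` (dom i `&` a t @^-1` dom j).
  move=> p /Hs[z' [zi' zz'] <-]; exists z' => //; split=> //.
  have S1 : 1 <= 1 + `|rho| by rewrite lerDl.
  by have [] := H z z' 1 xz' zz' ler01 S1.
have [_ [[_ ha] _] _ _ _] := hab t.
have hol := holomorphic_on_sub sub (ha i j).
split.
- have oB : open (ball (chart i z) s) by exact: ball_open.
  have H1 := holomorphic_affine_comp (- (q t *m Bt t) : Cspace R n) oB (JBt t) hol.
  exact: H1.
- have zz : dist_le g z z 0 by exact: dist_le_refl.
  by have [] := H z z 0 xz' zz (lexx 0) S0.
move=> v; apply: (diff_mulmxr (f := local_map i j (a t))).
exact: smooth_on_differentiable hol.1 (ballxx _ s0).
Qed.

Let h_holomorphic k w (c : idx (Cn_atlas R n)) (i : idx A) : cconv F h k ->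
  dom i (k w) -> exists2 s : R, 0 < s & \forall t \near F,
    holomorphic_on (ball w s) (local_map c i (h t)).
Proof.
move=> hk ki; have [N wN FN] := hk w _ (nbhs_dom ki).
have [s1 /= s10 HN] := iffLR (nbhs_ballP _ _) wN.
have [L L0 HL] := h_lipschitz.
have W0 : 0 <= `|w| + 1 by rewrite addr_ge0.
exists (Num.min 1 s1); first by rewrite lt_min ltr01.
apply: filterS2 (HL _ W0) FN => t H tN.
have [_ [_ [cb hb]] _ _ _] := hab t.
have oU : open (chart j @` (dom j `&` b t @^-1` dom i)).
  by apply: chart_image_open; apply: open_comp (dom_open i) => ? _; exact: cb.
apply: holomorphic_on_sub (holomorphic_comp_affine (q t) oU (JPt t) (hb j i)).
move=> w' ww' /=; apply/chart_imageP; split.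
  apply: rI; have [||//] := H w' w' _ _.
  - have : ball w 1 w' by apply: le_ball ww'; rewrite ge_min lexx.
    rewrite -ball_normE /ball_ /= => /ltW h1.
    rewrite -lerBlDl; apply: le_trans h1.
    by rewrite distrC; exact: lerB_dist.
  - have : ball w 1 w' by apply: le_ball ww'; rewrite ge_min lexx.
    rewrite -ball_normE /ball_ /= => /ltW h1.
    rewrite -lerBlDl; apply: le_trans h1.
    by rewrite distrC; exact: lerB_dist.
apply: tN; apply: HN; apply: le_ball ww'.
by rewrite ge_min lexx orbT.
Qed.

(** The differential of a t divided by l t is an exact isometry from g at z to g at a t z. All a t z
    tend to the same y, so the limit is isometric to the constant metric at y, which P makes
    standard. *)
Lemma rescaling_isometric : holomorphically_isometric g (Cn_flat R n).
Proof.
have [f [k [pf ph fK kK]]] := rescaling_limits.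
have cf : continuous f := cconv_continuous_norm Fprop pf.
have ck : continuous k.
  move=> w O /(dist_le_nbhs g X_hausdorff)[e e0 He].
  have [N wN FN] := ph w _ (dist_le_near g (k w) e0).
  apply: filterS wN => w' Nw'; apply: He.
  have F1 : cst (k w) t @[t --> F] --> k w by exact: cvg_cst.
  have F2 : h t w' @[t --> F] --> k w' by exact: cconv_pointwise.
  by apply: (dist_le_lim (g := g) X_hausdorff F1 F2); apply: filterS FN => t; apply.
have [hf df] : holomorphic_map A (Cn_atlas R n) f /\
    forall z (i : idx A) (c : idx (Cn_atlas R n)), dom i z -> dom c (f z) -> forall v,
    'd (local_map i c (phi t)) (chart i z) v @[t --> F] -->
    'd (local_map i c f) (chart i z) v.
  apply: (cconv_holomorphic (FU := FU) cf pf) => z i c zi _.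
  have [s s0 Hs] := phi_holomorphic c zi; exists s => //.
  by apply: filterS Hs => t [].
have [hk _] : holomorphic_map (Cn_atlas R n) A k /\
    forall w (c : idx (Cn_atlas R n)) (i : idx A), dom c w -> dom i (k w) -> forall v,
    'd (local_map c i (h t)) (chart c w) v @[t --> F] -->
    'd (local_map c i k) (chart c w) v.
  apply: (cconv_holomorphic (FU := FU) ck ph) => w c i _ ki.
  exact: h_holomorphic ph ki.
exists f; split; first by split=> //; exists k.
move=> i c z zi _ v v'; rewrite mul1r.
have [rho xz] := dist_le_finite g X_connected x z.
(* The ratios tend to 0 and z is at finite distance from x, so a t z has the same limit as a t (u
   t). *)
have az : a t z @[t --> F] --> y.
  apply: (dist_le_cvg_to (g := g) X_hausdorff auy) => e e0.
  apply: filterS2 u_near (l_small_mul (1 + rho) e0) => t xu lt.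
  apply: dist_leW (ltW lt) _; apply: (homothety_dist (hab t)).
  exact: dist_le_trans (dist_le_sym xu) xz.
have Iy : (chart j @` dom j) (chart j y) by exists y.
have cG : gram g j (chart j (a t z)) @[t --> F] --> gram g j (chart j y).
  have cy : chart j (a t z) @[t --> F] --> chart j y.
    exact: (cvg_comp _ _ az (chart_continuous yj)).
  exact: (cvg_comp _ _ cy (smooth_on_continuous (gram_smooth g j) Iy)).
have dP w : 'd (local_map i c (phi t)) (chart i z) w *m P @[t --> F] -->
    'd (local_map i c f) (chart i z) w *m P.
  have cP : continuous (mulmxr P : 'rV[R]_(n + n) -> 'rV[R]_(n + n)).
    exact: linear_rV_continuous.
  exact: (cvg_comp _ _ (df z i c zi I w) (cP _)).
have FF : Filter F by typeclasses eauto.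
have F1 := cvg_inner (FF := FF) cG (dP v) (dP v').
have F2 : cst (inner (gram g i (chart i z)) v v') t @[t --> F] -->
    inner (gram g i (chart i z)) v v' by exact: cvg_cst.
have [s s0 Hs] := phi_holomorphic c zi.
have F3 : inner (gram g j (chart j (a t z)))
    ('d (local_map i c (phi t)) (chart i z) v *m P)
    ('d (local_map i c (phi t)) (chart i z) v' *m P) @[t --> F] -->
    inner (gram g i (chart i z)) v v'.
  apply: cvg_trans F2; apply: near_eq_cvg; apply: filterS Hs => t [_ azj E].
  have EP w : 'd (local_map i c (phi t)) (chart i z) w *m P =
      (l t)^-1 *: 'd (local_map i j (a t)) (chart i z) w.
    apply: (etrans (congr1 (mulmx^~ P) (E w))).
    move: ('d (local_map i j (a t)) (chart i z) w) => v0.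
    by rewrite -mulmxA /Bt -scalemxAl BP -scalemxAr mulmx1.
  have [_ _ _ pa _] := hab t.
  apply: esym; apply: (etrans (congr2 (inner _) (EP v) (EP v'))).
  rewrite innerZl innerZr.
  apply: (etrans (congr1 (fun s => (l t)^-1 * ((l t)^-1 * s)) (pa i j z zi azj v v'))).
  rewrite /cst; move: (inner (gram g i (chart i z)) v v') => s1.
  by rewrite mulrA -expr2 mulrA exprVn mulVf ?mul1r// expf_neq0// gt_eqF.
have : inner (gram g j (chart j y)) ('d (local_map i c f) (chart i z) v *m P)
    ('d (local_map i c f) (chart i z) v' *m P) = inner (gram g i (chart i z)) v v'.
  by apply: (cvg_unique _ F1 F3); exact: norm_hausdorff.
(* P moves from the vectors to the Gram matrix at y, which becomes the identity. *)
by rewrite -inner_mulmx PG.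
Qed.

End Rescaling.
Lemma compact_chart_nbhs (R : realType) (n : nat) (X : topologicalType)
    (A : complex_atlas R n X) (x : X) (O : set X) : nbhs x O ->
  exists2 K : set X, compact K & nbhs x K /\ K `<=` O.
Proof.
move=> xO; have [i xi] := dom_cover A x.
have [r r0 Hr] := nbhs_ball_chart xi xO.
have B p : `|chart i x - p| <= r / 2 -> ball (chart i x) r p.
  by move=> h; rewrite -ball_normE /ball_ /=; apply: le_lt_trans h _; lra.
exists (param i @` [set p | `|chart i x - p| <= r / 2]).
  apply: continuous_compact; last exact: closed_ball_compact.
  apply: continuous_in_subspaceT => p; rewrite inE => /B/Hr/chart_imageP[Ip _].
  exact: param_continuous.
split; last by move=> _ [p /B/Hr/chart_imageP[_ Op] <-].
have r20 : 0 < r / 2 by rewrite divr_gt0.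
apply: filterS (chart_ball xi r20) => z [zi]; rewrite -ball_normE /ball_ /= => /ltW zb.
by exists (chart i z) => //; rewrite chartK.
Qed.

Lemma contracting_family_isometric (R : realType) (n : nat) (X : topologicalType)
    (A : complex_atlas R n X) (g : kaehler_metric A) (T : Type) (F : set_system T)
    (l : T -> R) (a b : T -> X -> X) (u : T -> X) (x y : X) :
  hausdorff_space X -> connected [set: X] -> UltraFilter F ->
  (forall t, homothety g (l t) (a t) (b t)) ->
  (forall e, 0 < e -> \forall t \near F, l t < e) ->
  u @ F --> x -> a t (u t) @[t --> F] --> y ->
  holomorphically_isometric g (Cn_flat R n).
Proof.
move=> X_hausdorff cX FU hab l0 ux auy; have [j yj] := dom_cover A y.
have [r1 r10 [r1I [M M0 HM]]] := dist_le_upper g yj.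
have [r2 r20 [r2I [K K0 HK]]] := dist_le_lower g X_hausdorff yj.
have [P [PG JP]] := unitary_frame (gram_sym g yj) (gram_hermitian g yj)
  (@gram_pos _ _ _ _ g _ _ yj).
have r0 : 0 < Num.min r1 r2 by rewrite lt_min r10 r20.
have B1 : ball (chart j y) (Num.min r1 r2) `<=` ball (chart j y) r1.
  by apply: le_ball; rewrite ge_min lexx.
have B2 : ball (chart j y) (Num.min r1 r2) `<=` ball (chart j y) r2.
  by apply: le_ball; rewrite ge_min lexx orbT.
have Pu : P \in unitmx.
  by have [] := mulmx1_unit (etrans (mulmxA _ _ _) PG).
apply: (@rescaling_isometric R n X A g T F X_hausdorff cX FU l a b u x y hab l0 ux auy
  j (Num.min r1 r2) K M P (invmx P) yj r0 K0 M0 _ _ _ PG (mulmxV Pu) JP).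
- by move=> p /B1/r1I.
- move=> p /B2 pr w t pw tK; apply: (HK p pr w t pw).
  by apply: lt_le_trans tK _; rewrite ler_pM2l// ge_min lexx orbT.
- by move=> p q /B1 pr /B1 qr; exact: HM.
Qed.

(** * Case distinction on the ratios, and properness *)

Lemma ultra_trichotomy (R : realType) (T : Type) (F : set_system T) (l : T -> R) :
  UltraFilter F -> (forall t, 0 < l t) ->
  [\/ exists2 C, 0 < C & \forall t \near F, C^-1 <= l t <= C,
      forall e, 0 < e -> \forall t \near F, l t < e |
      forall e, 0 < e -> \forall t \near F, (l t)^-1 < e].
Proof.
move=> FU l0.
(* An ultrafilter contains each set or its complement, so a function that does not tend to 0 is
   eventually bounded below; this is applied to l and to its inverse. *)
have dich (k : T -> R) : (forall e, 0 < e -> \forall t \near F, k t < e) \/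
    exists2 e, 0 < e & \forall t \near F, e <= k t.
  have [?|/existsNP[e /not_implyP[e0 nF]]] :=
    pselect (forall e, 0 < e -> \forall t \near F, k t < e); [by left|right].
  exists e => //; have [//|FC] := in_ultra_setVsetC [set t | k t < e] FU.
  by apply: filterS FC => t /negP; rewrite -leNgt.
have [?|[e1 e10 F1]] := dich l; first exact: Or32.
have [?|[e2 e20 F2]] := dich (fun t => (l t)^-1); first exact: Or33.
apply: Or31; exists (Num.max e1^-1 e2^-1); first by rewrite lt_max invr_gt0 e10.
apply: filterS2 F1 F2 => t h1 h2; apply/andP; split.
  rewrite -[l t]invrK lef_pV2 ?posrE ?invr_gt0// ?lt_max ?invr_gt0 ?e10//.
  by rewrite le_max lef_pV2 ?posrE// h1.
by rewrite le_max -[l t]invrK [X in _ || X]lef_pV2 ?posrE ?invr_gt0// h2 orbT.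
Qed.

(** Evaluation is jointly continuous because X is locally compact: a compact neighbourhood K of x
    with f K inside P' gives a subbasic open set of maps. *)
Lemma evaluation_within_continuous (R : realType) (n : nat) (X : topologicalType)
    (A : complex_atlas R n X) (G : set (X -> X)) : (forall a, G a -> continuous a) ->
  {within [set q : {compact-open, X -> X} * X | G q.1],
    continuous (fun q : {compact-open, X -> X} * X => (q.1 q.2, q.2))}.
Proof.
move=> cG; apply/subspace_continuousP => -[f x] /= Gf W [[P Q] [/= fP xQ] PQW].
have [P' [oP' P'fx] P'P] : exists2 P', open_nbhs (f x) P' & P' `<=` P.
  by move: fP; rewrite nbhsE => -[P' h1 h2]; exists P'.
have [K cK [xK KP]] := compact_chart_nbhs A (cG f Gf x P' (open_nbhs_nbhs (conj oP' P'fx))).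
exists ([set a : {compact-open, X -> X} | a @` K `<=` P'], K `&` Q); last first.
  move=> [a z] /= [aK [Kz Qz]] _; apply: PQW; split => //=; apply: P'P; apply: aK.
  by exists z.
split=> /=; last exact: filterI.
apply: open_nbhs_nbhs; split; first exact: compact_open_open.
by move=> _ [z /KP ? <-].
Qed.

Theorem theorem6 (R : realType) (n : nat) (hn : (2 <= n)%N)
    (X : topologicalType) (X_hausdorff : hausdorff_space X)
    (X_second_countable : @second_countable X)
    (X_connected : connected [set: X])
    (A : complex_atlas R n X) (g : kaehler_metric A) :
  ~ holomorphically_isometric g (Cn_flat R n) -> acts_properly (Conf g).
Proof.
move=> not_flat; split.
  by apply: (evaluation_within_continuous A) => a [[[]]].
move=> K cK; rewrite compact_ultra => F FU FGK.
(* Pairs whose map is not in Conf are given the identity, so that ratio and inverse become total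
   functions of t; along F the true map is recovered. *)
have lab (t : {compact-open, X -> X} * X) : exists lab : R * (X -> X) * (X -> X),
    homothety g lab.1.1 lab.1.2 lab.2 /\ (Conf g t.1 -> lab.1.2 = t.1).
  have [Gt|nGt] := pselect (Conf g t.1).
    have [l [b hl]] := Conf_homothety hn X_connected Gt.
    by exists (l, t.1 : X -> X, b).
  by exists (1, id, id); split; [exact: homothety_id|].
have [c Hc] := choice lab.
pose l t := (c t).1.1; pose a t := (c t).1.2; pose b t := (c t).2.
have hab t : homothety g (l t) (a t) (b t) by have [] := Hc t.
have l0 t : 0 < l t by have [] := hab t.
have FG : \forall t \near F, a t = t.1 by apply: filterS FGK => t [/(Hc t).2].
have FK : \forall t \near F, K (t.1 t.2, t.2) by apply: filterS FGK => t [].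
have [[y x] Kyx Fyx] := ultra_compact_cvg FU cK FK.
have ux : t.2 @[t --> F] --> x by exact: (cvg_comp _ _ Fyx (@cvg_snd _ _ _ _ _)).
have tuy : t.1 t.2 @[t --> F] --> y by exact: (cvg_comp _ _ Fyx (@cvg_fst _ _ _ _ _)).
have auy : a t t.2 @[t --> F] --> y.
  by apply: cvg_trans tuy; apply: near_eq_cvg; apply: filterS FG => t ->.
have [[C C0 FC]|l_small|l_large] := ultra_trichotomy FU l0.
- have [f [Gf af fx]] := bounded_family_limit X_hausdorff X_connected FU hab C0 FC ux auy.
  exists (f, x); split; first by split=> //=; rewrite fx.
  have Ff : t.1 @[t --> F] --> (f : {compact-open, X -> X}).
    apply/compact_open_cvgP => K' O cK' oO fKO.
    by apply: filterS2 FG (cconv_compact af cK' oO fKO) => t ->.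
  move=> W [[P Q] [/= fP xQ] PQW].
  have FP : \forall t \near F, P t.1 by exact: Ff _ fP.
  have FQ : \forall t \near F, Q t.2 by exact: ux _ xQ.
  by apply: filterS2 FP FQ => -[a' z] /= aP zQ; exact: PQW.
- by case: not_flat; exact: contracting_family_isometric hab l_small ux auy.
(* The inverses contract, and they take a t t.2, which tends to y, back to t.2, which tends to x. *)
- case: not_flat.
  have bux : b t (a t t.2) @[t --> F] --> x.
    apply: cvg_trans ux; apply: near_eq_cvg; apply: nearW => t.
    by have [_ _ [aK _] _ _] := hab t; rewrite aK.
  exact: (contracting_family_isometric X_hausdorff X_connected FU
    (fun t => homothety_sym (hab t)) l_large auy bux).
Qed.
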